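(* Let $G$ be a connected Lie group with Lie algebra $\mathfrak g$, $K$ an $\mathrm{Ad}$-invariant non-degenerate symmetric bilinear form on $\mathfrak g$, and $\sigma$ an involutive automorphism of $G$ whose differential (also denoted $\sigma$) is orthogonal for $K$. Let $D=G\times G$, $G_+=\{(g,g)\}\subset D$, $S=D/G_+$, $G_+^\sigma=\{(g,\sigma(g))\}\subset D$, and let $P_D^\sigma$ be the bivector field on $D$ associated with the quasi-triple $(D,G_+^\sigma,\mathfrak g_-^\sigma)$ (defined in the context). Then: (1) The bivector field $P_D^\sigma$ is projectable onto $S$ (that is, there is a bivector field $P_S^\sigma$ on $S$ such that the projection $D\to S$ maps $P_D^\sigma$ to $P_S^\sigma$). (2) Identify $S$ with $G$ via the map induced by $(g,h)\mapsto gh^{-1}$, and trivialise tangent and cotangent spaces by right translations, so that $T_sS\simeq\mathfrak g$ and $T_s^*S\simeq\mathfrak g^*$. Then for every $s\in S$ and $\xi\in\mathfrak g^*$, $$P_S^\sigma(s)(\xi)=\tfrac12\big(\mathrm{Ad}_{\sigma(s)^{-1}}-\mathrm{Ad}_s\big)\circ\sigma\circ K^{-1}(\xi).$$ (3) The action $$G_+^\sigma\times S\to S,\qquad (g,s)\mapsto g\,s\,\sigma(g)^{-1}$$ (where $G_+^\sigma$ is identified with $G$ via $g\mapsto(g,\sigma(g))$) of the quasi-Poisson Lie group $G_+^\sigma$ on $(S,P_S^\sigma)$ is a quasi-Poisson action. (4) For every $s\in S$, the image of $P_S^\sigma(s)$, seen as a map $T_s^*S\to T_sS$, is tangent to the orbit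 through $s$ of this action of $G_+^\sigma$ on $S$.
   Context: $K$ also denotes the isomorphism $\mathfrak g\to\mathfrak g^*$, $x\mapsto K(x,\cdot)$. A bivector $P$ at a point $m$ is viewed as a map $T_m^*\to T_m$, $\alpha\mapsto P(\alpha)$, with $\beta(P(\alpha))=P(\alpha,\beta)$. Let $\mathfrak d=\mathfrak g\oplus\mathfrak g$ be the Lie algebra of $D$, with the invariant form $\langle(x,y),(x',y')\rangle=K(x,x')-K(y,y')$. Let $\mathfrak g_+^\sigma=\{(x,\sigma(x)):x\in\mathfrak g\}$ (the Lie algebra of $G_+^\sigma$) and $\mathfrak g_-^\sigma=\{(x,-\sigma(x)):x\in\mathfrak g\}$. These are complementary isotropic subspaces of $\mathfrak d$, so $(D,G_+^\sigma,\mathfrak g_-^\sigma)$ is a quasi-triple (Alekseev and Kosmann-Schwarzbach). Using $\mathfrak d=\mathfrak g_+^\sigma\oplus\mathfrak g_-^\sigma$, write $\mathfrak d^*=(\mathfrak g_+^\sigma)^*\oplus(\mathfrak g_-^\sigma)^*$. Let $j:(\mathfrak g_+^\sigma)^*\to\mathfrak g_-^\sigma$ be defined by $\langle j(\alpha),X\rangle=\alpha(X)$ for $X\in\mathfrak g_+^\sigma$. The r-matrix is $r_{\mathfrak d}^\sigma:\mathfrak d^*\to\mathfrak d$, $(\alpha,\beta)\mapsto j(\alpha)$ for $\alpha\in(\mathfrak g_+^\sigma)^*$, $\beta\in(\mathfrak g_-^\sigma)^*$, viewed as an element of $\mathfrak d\otimes\mathfrak d$. The bivector field is $P_D^\sigma=(r_{\mathfrak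 d}^\sigma)^\lambda-(r_{\mathfrak d}^\sigma)^\rho$, where the superscripts $\lambda,\rho$ denote the left-invariant and right-invariant tensor fields on $D$ generated by the given element. The trivector $\varphi^\sigma\in\bigwedge^3\mathfrak g_+^\sigma$ is $\varphi^\sigma(\alpha,\beta,\gamma)=\langle j(\gamma),[j(\alpha),j(\beta)]\rangle$ for $\alpha,\beta,\gamma\in(\mathfrak g_+^\sigma)^*$. The quasi-Poisson Lie group $G_+^\sigma$ is $G_+^\sigma$ with the bivector field $P_{G_+^\sigma}$ induced by the quasi-triple (the restriction of $P_D^\sigma$ to $G_+^\sigma$) and the trivector $\varphi^\sigma$. In general, an action of a quasi-Poisson Lie group $(L,P_L,\varphi)$ with Lie algebra $\mathfrak l$ on a manifold $M$ with a bivector field $P_M$ is quasi-Poisson if: (i) the action map $L\times M\to M$ sends $P_L\oplus P_M$ to $P_M$, i.e. $P_M(g\cdot m)=(m'\mapsto g\cdot m')_*P_M(m)+(g'\mapsto g'\cdot m)_*P_L(g)$ for all $g\in L$, $m\in M$; and (ii) $\frac12[P_M,P_M]=\varphi_M$, where $\varphi_M(m)$ is the image of $\varphi$ under $\bigwedge^3$ of the infinitesimal action $\mathfrak l\to T_mM$, $X\mapsto\frac{d}{dt}|_{t=0}\exp(tX)\cdot m$. Here $[\,,]$ is the Schouten–Nijenhuis bracket, with the sign convention $\frac12[P,P](df,dg,dh)=\{\{f,g\},h\}+\{\{g,h\},f\}+\{\{h,f\},g\}$, $\{f,g\}=P(df,dg)$. *)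

(* Defs.v *)
From HB Require Import structures.
From mathcomp Require Import all_boot all_order all_algebra generic_quotient.
From mathcomp Require Import all_classical all_reals all_analysis.
Import Order.TTheory GRing.Theory Num.Theory.
Import numFieldNormedType.Exports.

Set Implicit Arguments.
Unset Strict Implicit.
Unset Printing Implicit Defensive.

Local Open Scope quotient_scope.
Local Open Scope classical_set_scope.
Local Open Scope ring_scope.

(* Manifolds are presented as follows.  An atlas on M
   gives for every m : M a chart around m; the tangent space T_m M is R^n, read
   in the chart of m, and the differential of a map is the Frechet derivative
   of its expression in the charts of the source point and of its image. *)

#[short(type="topGroupType")]
HB.structure Definition TopGroup := {G of Topological G & Group G}.

Section Smoothness.
Context {R : realType} {V W : normedModType R}.

(* C^k on an open set U *)
Fixpoint Ck_on (k : nat) (U : set V) (f : V -> W) : Prop :=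
  match k with
  | 0 => forall x, U x -> {for x, continuous f}
  | k'.+1 => (forall x, U x -> differentiable f x) /\
             (forall v, Ck_on k' U (fun x => 'D_v f x))
  end.

Definition smooth_on (U : set V) (f : V -> W) := forall k, Ck_on k U f.

End Smoothness.

(* cotangent vectors, and bivectors P seen as maps alpha |-> P(alpha), with
   beta (P alpha) = P(alpha, beta); [bivec] is the space of all 2-tensors *)
Notation covec R n := 'Hom('rV[R]_n, R^o).
Notation bivec R n := 'Hom('Hom('rV[R]_n, R^o), 'rV[R]_n).

Section LinearAlgebra.
Context {R : realType}.

Definition skew n (P : bivec R n) :=
  forall a b : covec R n, b (P a) = - a (P b).

(* image of a 2-tensor under a linear map *)
Definition push n k (A : 'Hom('rV[R]_n, 'rV[R]_k)) (P : bivec R n) : bivec R k :=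
  linfun (fun b : covec R k => A (P (b \o A)%VF)).

End LinearAlgebra.

(* [point A m] is the inverse of the chart [coord A m]; values of
   [coord A m] off [dom A m], and of [point A m] off the image, are junk. *)
Record atlas (R : realType) (n : nat) (M : Type) := Atlas {
  dom : M -> set M;
  coord : M -> M -> 'rV[R]_n;
  point : M -> 'rV[R]_n -> M }.

Definition img {R : realType} {n} {M : Type} (A : atlas R n M) (m : M) :
  set 'rV[R]_n := coord A m @` dom A m.

Definition is_manifold {R : realType} {n} {M : topologicalType}
    (A : atlas R n M) : Prop :=
  [/\ hausdorff_space M, @second_countable M,
      forall m, [/\ dom A m m, open (dom A m), open (img A m),
        forall x, dom A m x -> point A m (coord A m x) = x &
        (forall x, dom A m x -> {for x, continuous (coord A m)}) /\
        (forall u, img A m u -> {for u, continuous (point A m)})] &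
      forall m m', smooth_on (coord A m @` (dom A m `&` dom A m'))
                             (coord A m' \o point A m)].

Definition prod_atlas {R : realType} {n k} {M N : Type}
    (A : atlas R n M) (B : atlas R k N) : atlas R (n + k) (M * N) :=
  Atlas (fun m => dom A m.1 `*` dom B m.2)
        (fun m x => row_mx (coord A m.1 x.1) (coord B m.2 x.2))
        (fun m u => (point A m.1 (lsubmx u), point B m.2 (rsubmx u))).

(* the atlas on N making a bijection f : N -> M, of inverse g, a
   diffeomorphism *)
Definition transport_atlas {R : realType} {n} {M N : Type}
    (A : atlas R n M) (f : N -> M) (g : M -> N) : atlas R n N :=
  Atlas (fun y => f @^-1` dom A (f y))
        (fun y z => coord A (f y) (f z))
        (fun y u => g (point A (f y) u)).

Section Calculus.
Context {R : realType} {n k : nat} {M N : Type}.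
Variables (A : atlas R n M) (B : atlas R k N).

Definition smooth_map (f : M -> N) : Prop :=
  forall m, exists2 U : set 'rV[R]_n, open U &
    [/\ U (coord A m m), U `<=` img A m,
        forall u, U u -> dom B (f m) (f (point A m u)) &
        smooth_on U (coord B (f m) \o f \o point A m)].

Definition smooth_fun (f : M -> R) : Prop :=
  forall m, smooth_on (img A m) ((f \o point A m) : 'rV[R]_n -> R^o).

Definition dmap (f : M -> N) (m : M) : 'Hom('rV[R]_n, 'rV[R]_k) :=
  linfun ('d (coord B (f m) \o f \o point A m) (coord A m m)).

Definition dfun (f : M -> R) (m : M) : covec R n :=
  linfun ('d ((f \o point A m) : 'rV[R]_n -> R^o) (coord A m m)).

(* differential at p of the chart of m, i.e. change of coordinates from T_p M
   to the chart of m *)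
Definition dcoord (m p : M) : 'Hom('rV[R]_n, 'rV[R]_n) :=
  linfun ('d (coord A m \o point A p) (coord A p p)).

(* a bivector field is smooth when its components in charts are *)
Definition bivector_field (P : M -> bivec R n) : Prop :=
  (forall m, skew (P m)) /\
  forall m (a b : covec R n),
    smooth_on (img A m)
      ((fun u => let p := point A m u in b (push (dcoord m p) (P p) a))
         : 'rV[R]_n -> R^o).

Definition lie_bracket (X Y : M -> 'rV[R]_n) (m : M) : 'rV[R]_n :=
  let loc Z u := let p := point A m u in dcoord m p (Z p) in
  'D_(X m) (loc Y) (coord A m m) - 'D_(Y m) (loc X) (coord A m m).

(* {f, g} = P(df, dg) *)
Definition bracket_of (P : M -> bivec R n) (f g : M -> R) : M -> R :=
  fun m => dfun g m (P m (dfun f m)).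

(* (1/2) [P, P] (df, dg, dh) *)
Definition half_schouten (P : M -> bivec R n) (f g h : M -> R) : M -> R :=
  fun m => bracket_of P (bracket_of P f g) h m
         + bracket_of P (bracket_of P g h) f m
         + bracket_of P (bracket_of P h f) g m.

End Calculus.

Section LieGroups.
Context {R : realType} {n : nat}.

Definition is_lie_group {G : topGroupType} (A : atlas R n G) : Prop :=
  [/\ is_manifold A,
      smooth_map (prod_atlas A A) A (fun x : G * G => (x.1 * x.2)%g) &
      smooth_map A A (fun x : G => (x^-1)%g)].

Section Group.
Context {G : groupType} (A : atlas R n G).

(* the Lie algebra is T_1 G *)
Definition Ad (g : G) : 'Hom('rV[R]_n, 'rV[R]_n) :=
  dmap A A (fun x : G => (g * x * g^-1)%g) 1%g.

Definition left_field (X : 'rV[R]_n) (g : G) : 'rV[R]_n :=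
  dmap A A (fun x : G => (g * x)%g) 1%g X.

Definition bracket (X Y : 'rV[R]_n) : 'rV[R]_n :=
  lie_bracket A (left_field X) (left_field Y) 1%g.

Definition left_tensor (r : bivec R n) (g : G) : bivec R n :=
  push (dmap A A (fun x : G => (g * x)%g) 1%g) r.

Definition right_tensor (r : bivec R n) (g : G) : bivec R n :=
  push (dmap A A (fun x : G => (x * g)%g) 1%g) r.

End Group.

Section Action.
Context {k : nat} {L : groupType} {M : Type}.
Variables (AL : atlas R n L) (AM : atlas R k M) (act : L -> M -> M).

Definition is_smooth_action : Prop :=
  [/\ forall m, act 1%g m = m,
      forall g h m, act (g * h)%g m = act g (act h m) &
      smooth_map (prod_atlas AL AM) AM (fun x => act x.1 x.2)].

(* X |-> d/dt exp(tX).m at t = 0, i.e. the differential at 1 of g |-> g.m *)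
Definition inf_action (m : M) : 'Hom('rV[R]_n, 'rV[R]_k) :=
  dmap AL AM (fun g => act g m) 1%g.

Definition quasi_poisson_action (PL : L -> bivec R n)
    (phi : covec R n -> covec R n -> covec R n -> R)
    (PM : M -> bivec R k) : Prop :=
  [/\ is_smooth_action,
      forall g m, PM (act g m) =
        push (dmap AM AM (act g) m) (PM m)
        + push (dmap AL AM (fun g' => act g' m) g) (PL g) &
      forall f g h, smooth_fun AM f -> smooth_fun AM g -> smooth_fun AM h ->
        forall m, half_schouten AM PM f g h m =
          phi (dfun AM f m \o inf_action m)%VF
              (dfun AM g m \o inf_action m)%VF
              (dfun AM h m \o inf_action m)%VF].

End Action.
End LieGroups.

Section Quotient.
Variable G : groupType.

Definition same_coset (d d' : G * G) : bool :=
  let k := (d^-1 * d')%g in k.1 == k.2.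

Lemma same_cosetE d d' : same_coset d d' = (d.1 / d.2 == d'.1 / d'.2)%g.
Proof.
case: d d' => [a b] [c e]; rewrite /same_coset /=.
change ((a^-1 * c == b^-1 * e)%g = (a * b^-1 == c * e^-1)%g).
apply/eqP/eqP => H.
  have -> : c = (a * (b^-1 * e))%g by rewrite -H mulgA mulgV mul1g.
  by rewrite !mulgA mulgK.
have -> : c = (a * b^-1 * e)%g by rewrite H mulgVK.
by rewrite !mulgA mulVg mul1g.
Qed.

Lemma same_coset_equiv : equiv_class_of same_coset.
Proof.
split=> [d|d d'|d d' d'']; rewrite !same_cosetE //.
by move=> /eqP ->.
Qed.

Canonical same_coset_rel := EquivRelPack same_coset_equiv.

(* S = D / G_+, the space of left cosets d G_+ *)
Definition quotS := {eq_quot same_coset_rel}.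

Definition projS (d : G * G) : quotS := \pi_quotS d.

(* the identification S -> G induced by (g, h) |-> g h^-1, and its inverse *)
Definition S_to_G (s : quotS) : G := ((repr s).1 / (repr s).2)%g.
Definition G_to_S (g : G) : quotS := projS (g, 1%g).

Lemma S_to_GE d : S_to_G (projS d) = (d.1 / d.2)%g.
Proof.
apply/eqP; rewrite -same_cosetE.
have /eqP/eqmodP : repr (projS d) == d %[mod quotS] by rewrite reprK.
by [].
Qed.

Lemma S_to_GK : cancel S_to_G G_to_S.
Proof.
move=> s; rewrite -[RHS]reprK; apply/eqmodP.
by rewrite /= same_cosetE /= invg1 mulg1 /S_to_G.
Qed.

Lemma G_to_SK : cancel G_to_S S_to_G.
Proof. by move=> g; rewrite S_to_GE /= invg1 mulg1. Qed.

End Quotient.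

(* The quotient manifold structure: g |-> (g, 1) is a global section of
   D -> S, so S -> G is a diffeomorphism. *)
Definition atlasS {R : realType} {n} {G : groupType} (A : atlas R n G) :
  atlas R n (quotS G) := transport_atlas A (@S_to_G G) (@G_to_S G).

Section QuasiTriple.
Context {R : realType} {n : nat} {G : groupType} (A : atlas R n G).
(* K : g -> g^*; the bilinear form is (x, y) |-> K x y *)
Variables (K : 'Hom('rV[R]_n, covec R n)) (sigma : G -> G).

Definition atlasD : atlas R (n + n) (G * G) := prod_atlas A A.

Definition dsigma : 'Hom('rV[R]_n, 'rV[R]_n) := dmap A A sigma 1%g.

(* d = g (+) g; a pair (x, y) is [row_mx x y] *)
Definition form_d (u v : 'rV[R]_(n + n)) : R :=
  K (lsubmx u) (lsubmx v) - K (rsubmx u) (rsubmx v).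

Definition bracket_d (u v : 'rV[R]_(n + n)) : 'rV[R]_(n + n) :=
  row_mx (bracket A (lsubmx u) (lsubmx v)) (bracket A (rsubmx u) (rsubmx v)).

(* G_+^sigma is parametrised by G through g |-> (g, sigma g), and accordingly
   its Lie algebra by g through x |-> (x, sigma x). *)
Definition incl_sigma (g : G) : G * G := (g, sigma g).
Definition g_plus : 'Hom('rV[R]_n, 'rV[R]_(n + n)) :=
  linfun (fun x : 'rV[R]_n => row_mx x (dsigma x)).

Definition g_minus : set 'rV[R]_(n + n) :=
  [set row_mx x (- dsigma x) | x in [set: 'rV[R]_n]].

(* j(alpha) is the element of g_-^sigma representing alpha on g_+^sigma *)
Definition jmap (a : covec R n) : 'rV[R]_(n + n) :=
  xget 0 [set Y | g_minus Y /\ forall X, form_d Y (g_plus X) = a X].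

(* the (g_+^sigma)^* component of a covector on d is its restriction *)
Definition r_d : bivec R (n + n) :=
  linfun (fun theta : covec R (n + n) => jmap (theta \o g_plus)%VF).

Definition P_D (d : G * G) : bivec R (n + n) :=
  left_tensor atlasD r_d d - right_tensor atlasD r_d d.

Definition phi_sigma (a b c : covec R n) : R :=
  form_d (jmap c) (bracket_d (jmap a) (jmap b)).

Definition actS (g : G) (s : quotS G) : quotS G :=
  G_to_S (g * S_to_G s * (sigma g)^-1)%g.

End QuasiTriple.

(* Main.v *)
(* Identify S with G by (g, h) |-> g h^-1 and write tau_s = Ad_s o sigma, an
   orthogonal automorphism of the Lie algebra.  By orthogonality of sigma,
   j(alpha) = (K^-1 alpha, - sigma K^-1 alpha) / 2.  The left translate of the
   r-matrix is killed by the projection to S, the right translate gives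
   P(s) = (tau_s^-1 - tau_s) K^-1 / 2 in the right trivialisation, and P_D
   vanishes along G_+^sigma, so that the bivector of G_+^sigma is 0.  For u in
   the Lie algebra, P(s)(K u) is the value at s of the action of
   (u + tau_s^-1 u) / 2.

   With R_i and L^i the right and left invariant derivations along dual bases
   e_i and sigma e^i, {f, g} = (1/2) sum_i (R_i g L^i f - R_i f L^i g).  As
   [R_x, L_y] = 0, the second derivatives in the Jacobiator of this bracket
   cancel, up to the structure constants of [L_x, L_y] = L_[x, y] and
   [R_x, R_y] = - R_[x, y]; these recombine into the trivector because
   K([x, y], z) is alternating and tau_s-invariant.  The commutation relations
   reduce to the symmetry of second derivatives. *)

Require Import Defs.
From HB Require Import structures.
From mathcomp Require Import all_boot all_order all_algebra generic_quotient.
From mathcomp Require Import all_classical all_reals all_analysis.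
From mathcomp Require Import ring lra.
Import Order.TTheory GRing.Theory Num.Theory.
Import numFieldNormedType.Exports.

Set Implicit Arguments.
Unset Strict Implicit.
Unset Printing Implicit Defensive.

Local Open Scope classical_set_scope.
Local Open Scope ring_scope.
Local Notation point := Defs.point.
Local Notation coord := Defs.coord.
Local Notation skew := Defs.skew.

(** * Functions of class C^k *)

Section Ck.
Context {R : realType} {V W : normedModType R}.

(** Smoothness is handled one point at a time. The functions that test identities between tangent
    vectors are linear functions of a chart, smooth only on its domain, so the rules for invariant
    derivations are stated at a point where their arguments are smooth. Tangent vectors arise as
    velocities of maps from a normed space into the manifold, which turns identities between
    differentials into identities between such maps. The left translate dies on S because a covector
    coming from S, moved to the identity by left translation, depends on x - y only; the r-matrix
    sends it to a diagonal vector (w, w), tangent to the fibre. Along G_+^sigma the two translates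
    agree because Ad of (g, sigma g) preserves the form, g_+^sigma and g_-^sigma, hence the
    r-matrix. Invariance of K is given on the group; its infinitesimal form, which makes K([x, y],
    z) alternating, comes from differentiating K (Ad_q y) (Ad_q z) in q at the identity. The
    constants agree since the iterated bracket carries (1/2)^2, and the trivector (1/2)^3 from j,
    doubled by the two copies of g in d. *)

Lemma near_eq_differentiable (f g : V -> W) x :
  (\near x, f x = g x) -> differentiable f x -> differentiable g x.
Proof.
move=> fg df; have fgx : f x = g x by apply: (nbhs_singleton fg).
(* The expansion of f at x, carried over to g near x; uniqueness of the differential then identifies
   'd g x with 'd f x. *)
have key : g \o shift x = cst (g x) + 'd f x +o_ (0 : V) id.
  apply/eqaddoP => e e0.
  have /eqaddoP/(_ e e0) := diff_locally df.
  move: fg; rewrite (near_shift 0 x) subr0; apply: filterS2 => h /= E.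
  by rewrite ![(_ - _ : V -> W) _]/(_ - _) /= E fgx.
have E : 'd g x = 'd f x :> (V -> W).
  exact: (diff_unique (diff_continuous df) key).
by apply/diff_locallyP; rewrite E; split => //; exact: diff_continuous.
Qed.

Lemma open_near (U : set V) (P : V -> Prop) x :
  open U -> U x -> (forall y, U y -> P y) -> \near x, P x.
Proof. by move=> oU Ux UP; apply: filterS (open_nbhs_nbhs (conj oU Ux)). Qed.

Lemma Ck_on_eq k (U : set V) (f g : V -> W) : open U ->
  (forall x, U x -> f x = g x) -> Ck_on k U f -> Ck_on k U g.
Proof.
move=> oU; elim: k f g => [|k IH] f g fg /=.
  move=> cf x Ux; change (g y @[y --> x] --> g x); rewrite -(fg _ Ux).
  apply: cvg_trans (cf _ Ux); apply: near_eq_cvg.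
  by apply: (open_near oU Ux) => y /fg.
move=> [df Df]; split=> [x Ux|v].
  by apply: near_eq_differentiable (df _ Ux); exact: (open_near oU Ux).
apply: IH (Df v) => x Ux; apply: near_eq_derive; exact: (open_near oU Ux).
Qed.

Lemma Ck_on_sub k (U U' : set V) (f : V -> W) :
  U `<=` U' -> Ck_on k U' f -> Ck_on k U f.
Proof.
move=> UU'; elim: k f => [|k IH] f /= => [cf x /UU'/cf //|[df Df]].
by split=> [x /UU'/df//|v]; apply: IH (Df v).
Qed.

Lemma Ck_on_pred k (U : set V) (f : V -> W) : Ck_on k.+1 U f -> Ck_on k U f.
Proof.
elim: k f => [|k IH] f /= [df Df]; last by split=> // v; apply: IH (Df v).
by move=> x /df; apply: differentiable_continuous.
Qed.

(** Each clause of [Ck_on] concerns the total functions f, 'D_v f, ... at one point of U at a time,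
    so singletons, which need not be open, are enough. *)
Lemma Ck_on_bigcup k (U : set V) (f : V -> W) :
  (forall x, U x -> Ck_on k [set x] f) -> Ck_on k U f.
Proof.
elim: k f => [|k IH] f /= H; first by move=> x Ux; apply: H Ux _ _.
split=> [x Ux|v]; first by apply: (H x Ux).1.
by apply: IH => x Ux; apply: (H x Ux).2.
Qed.

Lemma Ck_on_cst k (U : set V) (c : W) : Ck_on k U (cst c).
Proof.
elim: k c => [|k IH] c /=; first by move=> x _; exact: cvg_cst.
split=> [x _|v]; first exact: differentiable_cst.
have -> : (fun x : V => 'D_v (cst c) x) = cst 0 :> (V -> W) by
  apply/funext => x; rewrite derive_cst.
exact: IH.
Qed.

Lemma Ck_onD k (U : set V) (f g : V -> W) : open U ->
  Ck_on k U f -> Ck_on k U g -> Ck_on k U (fun x => f x + g x).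
Proof.
move=> oU; elim: k f g => [|k IH] f g /=.
  by move=> cf cg x Ux; apply: cvgD; [exact: cf|exact: cg].
move=> [df Df] [dg Dg]; split=> [x Ux|v].
  by apply: differentiableD; [exact: df|exact: dg].
apply: (Ck_on_eq oU _ (IH _ _ (Df v) (Dg v))) => x Ux.
by rewrite [RHS]deriveD //; apply: diff_derivable; [exact: df|exact: dg].
Qed.

End Ck.

Section CkReal.
Context {R : realType} {V W : normedModType R}.

Lemma derive_lin {W' : normedModType R} (L : {linear W -> W'}) (f : V -> W) x v :
  continuous L -> differentiable f x -> 'D_v (L \o f) x = L ('D_v f x).
Proof.
move=> cL df; have dL : differentiable L (f x) by apply: linear_differentiable.
rewrite !deriveE //; last exact: differentiable_comp.
by rewrite diff_comp //= diff_lin.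
Qed.

Lemma Ck_on_lin {W' : normedModType R} (L : {linear W -> W'}) k (U : set V)
  (f : V -> W) : open U -> continuous L -> Ck_on k U f -> Ck_on k U (L \o f).
Proof.
move=> oU cL; elim: k f => [|k IH] f /=.
  by move=> cf x Ux; apply: continuous_comp; [exact: cf|exact: cL].
move=> [df Df]; split=> [x Ux|v].
  by apply: differentiable_comp; [exact: df|exact: linear_differentiable].
apply: (Ck_on_eq oU _ (IH _ (Df v))) => x Ux.
by rewrite derive_lin //; exact: df.
Qed.

Lemma Ck_onM k (U : set V) (f g : V -> R^o) : open U ->
  Ck_on k U f -> Ck_on k U g -> Ck_on k U ((fun x => f x * g x) : V -> R^o).
Proof.
move=> oU; elim: k f g => [|k IH] f g.
  by move=> /= cf cg x Ux; apply: cvgM; [exact: cf|exact: cg].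
move=> Cf Cg; have /= [df Df] := Cf; have /= [dg Dg] := Cg.
split=> [x Ux|v].
  by apply: differentiableM; [exact: df|exact: dg].
have C1 : Ck_on k U ((fun x => f x * 'D_v g x + g x * 'D_v f x) : V -> R^o).
  by apply: Ck_onD => //; apply: IH => //; exact: Ck_on_pred.
apply: (Ck_on_eq oU _ C1) => x Ux.
by rewrite [RHS]deriveM //; apply: diff_derivable; [exact: df|exact: dg].
Qed.

Lemma Ck_on_sum (I : Type) (r : seq I) (P : pred I) k (U : set V)
    (F : I -> V -> W) : open U ->
  (forall i, P i -> Ck_on k U (F i)) ->
  Ck_on k U (fun x => \sum_(i <- r | P i) F i x).
Proof.
move=> oU H; elim: r => [|i r IH].
  by apply: (Ck_on_eq oU _ (Ck_on_cst k U 0)) => x _; rewrite big_nil.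
case Pi : (P i).
  have C := Ck_onD oU (H i Pi) IH.
  by apply: (Ck_on_eq oU _ C) => x _; rewrite big_cons Pi.
by apply: (Ck_on_eq oU _ IH) => x _; rewrite big_cons Pi.
Qed.

End CkReal.

Section CkComp.
Context {R : realType}.

Lemma linear_rV_continuous n {W : normedModType R}
  (L : {linear 'rV[R]_n -> W}) : continuous L.
Proof.
have -> : (L : 'rV[R]_n -> W) =
    (fun u => \sum_i (u ord0 i : R) *: L (delta_mx ord0 i)).
  apply/funext => u; rewrite [in LHS](row_sum_delta u) linear_sum.
  by apply: eq_bigr => i _; rewrite linearZ.
(* Continuity of a finite sum is the case k = 0 of [Ck_on_sum]. *)
move=> u; apply: (@Ck_on_sum _ _ _ _ _ _ 0 setT) => //; first exact: openT.
by move=> i _ y _; exact: (cvgZr_tmp (@coord_continuous R 1 n ord0 i y)).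
Qed.
#[local] Hint Resolve linear_rV_continuous : core.

Definition rv_coord n (i : 'I_n) (u : 'rV[R]_n) : R^o := u ord0 i.

Lemma rv_coord_is_linear n (i : 'I_n) : linear (@rv_coord n i).
Proof. by move=> c x y; rewrite /rv_coord !mxE. Qed.

HB.instance Definition _ n (i : 'I_n) :=
  GRing.isLinear.Build R 'rV[R]_n R^o _ (@rv_coord n i)
    (@rv_coord_is_linear n i).

Lemma Ck_on_rV {V : normedModType R} n k (U : set V) (f : V -> 'rV[R]_n) :
  open U -> (forall i, Ck_on k U ((fun x => f x ord0 i) : V -> R^o)) ->
  Ck_on k U f.
Proof.
move=> oU H.
pose F i x := (f x ord0 i : R) *: (delta_mx ord0 i : 'rV[R]_n).
have CF i : Ck_on k U (F i).
  have lin : linear ( *:%R^~ (delta_mx ord0 i : 'rV[R]_n) : R^o -> _).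
    by move=> u y z; rewrite scalerDl scalerA.
  pose L : {linear R^o -> 'rV[R]_n} :=
    HB.pack ( *:%R^~ (delta_mx ord0 i : 'rV[R]_n) : R^o -> _)
      (GRing.isLinear.Build _ _ _ _ _ lin).
  have cL : continuous L by apply: scalel_continuous.
  exact: (Ck_on_lin oU cL (H i)).
have CS := Ck_on_sum (index_enum 'I_n) oU (fun i (_ : true) => CF i).
apply: (Ck_on_eq oU _ CS).
by move=> x _; rewrite /F -row_sum_delta.
Qed.

Lemma derive_comp {V W : normedModType R} (V' : normedModType R)
    (f : V -> V') (g : V' -> W) x v :
  differentiable f x -> differentiable g (f x) ->
  'D_v (g \o f) x = 'd g (f x) ('D_v f x).
Proof.
move=> df dg; rewrite !deriveE //; last exact: differentiable_comp.
by rewrite diff_comp.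
Qed.

Lemma diff_rVE n {W : normedModType R} (g : 'rV[R]_n -> W) y u :
  differentiable g y ->
  'd g y u = \sum_i (u ord0 i : R) *: 'D_(delta_mx ord0 i) g y.
Proof.
move=> dg; rewrite [in LHS](row_sum_delta u) linear_sum.
by apply: eq_bigr => i _; rewrite linearZ deriveE.
Qed.

(** By the chain rule, 'D_v (g \o f) is the sum over i of ('D_v f)_i times the i-th partial
    derivative of g composed with f. The induction hypothesis applies to these partial derivatives,
    and products preserve the class; the target is real so that the products make sense. *)
Lemma Ck_on_comp_real {V : normedModType R} n k (U : set V)
    (U' : set 'rV[R]_n) (f : V -> 'rV[R]_n) (g : 'rV[R]_n -> R^o) :
  open U -> (forall x, U x -> U' (f x)) ->
  Ck_on k U f -> Ck_on k U' g -> Ck_on k U (g \o f).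
Proof.
move=> oU UU'; elim: k f g UU' => [|k IH] f g UU'.
  move=> /= cf cg x Ux; apply: continuous_comp; first exact: cf.
  exact/cg/UU'.
move=> Cf Cg; have /= [df Df] := Cf; have /= [dg Dg] := Cg.
split=> [x Ux|v].
  by apply: differentiable_comp; [exact: df|apply: dg; exact: UU'].
pose F i x := rv_coord i ('D_v f x) * 'D_(delta_mx ord0 i) g (f x) : R^o.
have CF i : Ck_on k U (F i).
  apply: Ck_onM => //.
    exact: (Ck_on_lin oU (@linear_rV_continuous _ _ (@rv_coord n i)) (Df v)).
  apply: (IH f (fun y => 'D_(delta_mx ord0 i) g y) UU') => //.
  exact: Ck_on_pred.
have CS := Ck_on_sum (index_enum 'I_n) oU (fun i (_ : true) => CF i).
apply: (Ck_on_eq oU _ CS).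
move=> x Ux; have [dfx dgx] : differentiable f x /\ differentiable g (f x).
  by split; [exact: df|apply: dg; exact: UU'].
by rewrite /F [RHS]derive_comp // [RHS]diff_rVE.
Qed.

End CkComp.
#[global] Hint Resolve linear_rV_continuous : core.

(** * Smoothness near a point *)

Section SmoothAt.
Context {R : realType}.
Implicit Types V W : normedModType R.

(** Smoothness on a whole neighbourhood, so that it passes to nearby points and to directional
    derivatives without tracking domains. *)
Definition smooth_at V W (f : V -> W) (x : V) :=
  exists2 U : set V, open U /\ U x & smooth_on U f.

Lemma smooth_at_near V W (f : V -> W) x :
  smooth_at f x -> \near x, smooth_at f x.
Proof.
move=> [U [oU Ux] sf]; apply: (open_near oU Ux) => y Uy.
by exists U.
Qed.

(** The neighbourhoods given at different points, which may depend on the point but not on k, are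
    glued by [Ck_on_bigcup]. *)
Lemma smooth_onP V W (U : set V) (f : V -> W) : open U ->
  smooth_on U f <-> forall x, U x -> smooth_at f x.
Proof.
move=> oU; split=> [sf x Ux|H k]; first by exists U.
apply: Ck_on_bigcup => x /H[U' [oU' U'x] sf].
by apply: Ck_on_sub (sf k) => y ->.
Qed.

Lemma smooth_at_eq V W (f g : V -> W) x :
  (\near x, f x = g x) -> smooth_at f x -> smooth_at g x.
Proof.
rewrite -nbhs_nearE nbhsE => -[U' [oU' U'x] fg] [U [oU Ux] sf].
exists (U' `&` U); first by split=> //; exact: openI.
move=> k; apply: (@Ck_on_eq _ _ _ _ _ f); first exact: openI.
  by move=> y [/fg].
by apply: Ck_on_sub (sf k) => y [].
Qed.

Lemma smooth_at_cst V W (c : W) (x : V) : smooth_at (fun=> c) x.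
Proof. by exists setT => [|k]; [by split => //; exact: openT|exact: Ck_on_cst]. Qed.

Lemma smooth_at_diff V W (f : V -> W) x : smooth_at f x -> differentiable f x.
Proof. by move=> [U [oU Ux] sf]; apply: (sf 1%N).1. Qed.

Lemma smooth_at_derive V W (f : V -> W) x v :
  smooth_at f x -> smooth_at (fun y => 'D_v f y) x.
Proof. by move=> [U UP sf]; exists U => // k; apply: (sf k.+1).2. Qed.

Lemma smooth_at_derivable V W (f : V -> W) x v :
  smooth_at f x -> derivable f x v.
Proof. by move=> /smooth_at_diff df; apply: diff_derivable. Qed.

Lemma smooth_at_continuous V W (f : V -> W) x :
  smooth_at f x -> {for x, continuous f}.
Proof. by move=> /smooth_at_diff/differentiable_continuous. Qed.

Lemma smooth_at2 V W W' W'' (x : V) (f : V -> W) (g : V -> W') (h : V -> W'') :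
  (forall k U, open U -> Ck_on k U f -> Ck_on k U g -> Ck_on k U h) ->
  smooth_at f x -> smooth_at g x -> smooth_at h x.
Proof.
move=> H [U [oU Ux] sf] [U' [oU' U'x] sg].
exists (U `&` U'); first by split=> //; exact: openI.
move=> k; apply: H; first exact: openI.
  by apply: Ck_on_sub (sf k) => y [].
by apply: Ck_on_sub (sg k) => y [].
Qed.

Lemma smooth_atD V W (f g : V -> W) x :
  smooth_at f x -> smooth_at g x -> smooth_at (fun y => f y + g y) x.
Proof. by apply: smooth_at2 => k U oU; exact: Ck_onD. Qed.

Lemma smooth_atM V (f g : V -> R^o) x :
  smooth_at f x -> smooth_at g x ->
  smooth_at ((fun y => f y * g y) : V -> R^o) x.
Proof. by apply: smooth_at2 => k U oU; exact: Ck_onM. Qed.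

Lemma smooth_at_lin V W W' (L : {linear W -> W'}) (f : V -> W) x :
  continuous L -> smooth_at f x -> smooth_at (L \o f) x.
Proof.
move=> cL [U [oU Ux] sf]; exists U => // k.
by apply: Ck_on_lin => //; exact: sf.
Qed.

Lemma smooth_at_id V (x : V) : smooth_at id x.
Proof.
exists setT; first by split => //; exact: openT.
case=> [|k] /=; first by move=> y _; exact: cvg_id.
split=> [y _|v]; first exact: ex_diff.
apply: (Ck_on_eq openT _ (Ck_on_cst k setT v)) => y _.
by rewrite derive_id.
Qed.

Lemma smooth_at_linear n W (L : {linear 'rV[R]_n -> W}) x : smooth_at L x.
Proof. exact: (smooth_at_lin (@linear_rV_continuous _ _ _ L) (smooth_at_id x)). Qed.

Lemma smooth_at_sum V W (I : finType) (F : I -> V -> W) x :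
  (forall i, smooth_at (F i) x) -> smooth_at (fun y => \sum_i F i y) x.
Proof.
move=> H; elim: (index_enum I) => [|i r IH].
  apply: smooth_at_eq (smooth_at_cst 0 x).
  by apply: nearW => y; rewrite big_nil.
apply: smooth_at_eq (smooth_atD (H i) IH).
by apply: nearW => y; rewrite big_cons.
Qed.

Lemma smooth_at_rV V n (f : V -> 'rV[R]_n) x :
  (forall i, smooth_at ((fun y => f y ord0 i) : V -> R^o) x) -> smooth_at f x.
Proof.
move=> H; pose F i y := (f y ord0 i : R) *: (delta_mx ord0 i : 'rV[R]_n).
have SF i : smooth_at (F i) x.
  have [U [oU Ux] sf] := H i; exists U => // k; apply: Ck_on_rV => // j.
  apply: (Ck_on_eq oU _ (Ck_onM oU (sf k)
     (Ck_on_cst k U ((delta_mx ord0 i : 'rV[R]_n) ord0 j : R^o)))).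
  by move=> y _; rewrite /F !mxE.
apply: smooth_at_eq (smooth_at_sum SF).
by apply: nearW => y; rewrite /F -row_sum_delta.
Qed.

Lemma smooth_at_coord V n (f : V -> 'rV[R]_n) x i :
  smooth_at f x -> smooth_at ((fun y => f y ord0 i) : V -> R^o) x.
Proof.
exact: (@smooth_at_lin _ _ _ (@rv_coord R n i) f x
  (@linear_rV_continuous _ _ _ _)).
Qed.

(** Continuity of f at x shrinks its neighbourhood until f maps it into the set where g is
    smooth. *)
Lemma smooth_at_comp_real V n (f : V -> 'rV[R]_n) (g : 'rV[R]_n -> R^o) x :
  smooth_at f x -> smooth_at g (f x) -> smooth_at (g \o f) x.
Proof.
move=> sf [U' [oU' U'x] sg].
have := smooth_at_continuous sf => /(_ U' (open_nbhs_nbhs (conj oU' U'x))).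
rewrite /= nbhs_simpl nbhsE => -[U1 [oU1 U1x] fU1].
have [U [oU Ux] sf'] := sf.
have oI := openI oU1 oU.
exists (U1 `&` U) => // k; apply: (@Ck_on_comp_real _ _ _ _ _ U') => //.
  by move=> y [/fU1].
by apply: Ck_on_sub (sf' k) => y [].
Qed.

Lemma smooth_at_comp V n m (f : V -> 'rV[R]_n) (g : 'rV[R]_n -> 'rV[R]_m) x :
  smooth_at f x -> smooth_at g (f x) -> smooth_at (g \o f) x.
Proof.
move=> sf sg; apply: smooth_at_rV => i.
exact: (smooth_at_comp_real sf (smooth_at_coord i sg)).
Qed.

Lemma smooth_at_row_mx V n m (f : V -> 'rV[R]_n) (g : V -> 'rV[R]_m) x :
  smooth_at f x -> smooth_at g x -> smooth_at (fun y => row_mx (f y) (g y)) x.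
Proof.
move=> sf sg; apply: smooth_at_rV => i.
case: (split_ordP i) => j ->.
  apply: smooth_at_eq (smooth_at_coord j sf).
  by apply: nearW => y; rewrite row_mxEl.
apply: smooth_at_eq (smooth_at_coord j sg).
by apply: nearW => y; rewrite row_mxEr.
Qed.

Lemma smooth_at_lsubmx n m (x : 'rV[R]_(n + m)) :
  smooth_at (lsubmx : 'rV[R]_(n + m) -> 'rV[R]_n) x.
Proof. exact: smooth_at_linear. Qed.

Lemma smooth_at_rsubmx n m (x : 'rV[R]_(n + m)) :
  smooth_at (rsubmx : 'rV[R]_(n + m) -> 'rV[R]_m) x.
Proof. exact: smooth_at_linear. Qed.

End SmoothAt.

(** * Symmetry of second derivatives *)

Section Schwarz.
Context {R : realType} {V : normedModType R}.
Implicit Types (f : V -> R^o) (p q x y : V).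

Lemma is_derive_line f q x (s : R) : differentiable f (s *: x + q) ->
  is_derive s 1 (fun s : R => f (s *: x + q)) ('D_x f (s *: x + q)).
Proof.
move=> df; pose l (s : R^o) := s *: x + q.
have dl : is_diff s l (fun h => h *: x).
  have -> : (fun h : R^o => h *: x) = (fun h => h *: x) + cst 0.
    by apply/funext => h; rewrite fctE addr0.
  exact: is_diffD.
have dfl : differentiable f (l s) by [].
apply: DeriveDef.
  by apply: diff_derivable; apply: (@differentiable_comp _ _ _ _ l f).
have := @derive_comp R _ _ _ l f s 1 (@ex_diff _ _ _ _ _ _ _ dl) dfl.
move=> ->; rewrite !deriveE // diff_val scale1r //.
Qed.

(** The second difference over the parallelogram spanned by t x and t y is t^2 times the mixed
    derivative, up to o(t^2). The mean value theorem in the x-direction leaves a difference of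
    values of 'D_x f, which is then expanded to first order at p. *)
Lemma second_difference f p x y (e : R) : smooth_at f p -> 0 < e ->
  exists2 d, 0 < d & forall t, 0 < t < d ->
   `|f (t *: x + (t *: y + p)) - f (t *: x + p) - (f (t *: y + p) - f p)
     - t ^+ 2 * 'D_y (fun q => 'D_x f q) p| <= e * t ^+ 2.
Proof.
move=> sf e0; pose N := `|x| + `|y| + 1.
have N0 : 0 < N by rewrite ltr_wpDl // addr_ge0.
pose g q := 'D_x f q : R^o.
have dg : differentiable g p by apply/smooth_at_diff/smooth_at_derive.
(* The increments below have norm less than t N, so each of the two remainders is at most e t /
   2. *)
have /eqaddoP/(_ (e / (2 * N))) := diff_locally dg.
have eN : 0 < e / (2 * N) by rewrite divr_gt0 // mulr_gt0.
move=> /(_ eN)/nbhs_norm0P[r /= r0 Hr].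
have /nbhs_normP[r' /= r'0 Hr'] := smooth_at_near sf.
have small (a b t : R) : 0 <= a <= t -> 0 <= b <= t -> 0 < t ->
    `|a *: x + b *: y| <= t * (`|x| + `|y|).
  move=> /andP[a0 at_] /andP[b0 bt] t0.
  rewrite (le_trans (ler_normD _ _)) // !normrZ mulrDr.
  by rewrite !ger0_norm // lerD // ler_wpM2r.
(* Keeps every point a x + b y + p with 0 <= a, b <= t inside both the ball where the expansion of
   'D_x f is controlled and the ball where f is smooth. *)
exists (Num.min r r' / N); first by rewrite divr_gt0 // lt_min r0.
move=> t /andP[t0]; rewrite ltr_pdivlMr // lt_min => /andP[tr tr'].
have lN a b : 0 <= a <= t -> 0 <= b <= t -> `|a *: x + b *: y| < t * N.
  move=> Ha Hb; rewrite (le_lt_trans (small _ _ _ Ha Hb t0)) //.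
  by rewrite ltr_pM2l // ltrDl.
have tt : 0 <= t <= t by rewrite (ltW t0) lexx.
have zt : (0 : R) <= 0 <= t by rewrite lexx (ltW t0).
have sm a b : 0 <= a <= t -> 0 <= b <= t ->
    differentiable f (a *: x + (b *: y + p)).
  move=> Ha Hb; apply: smooth_at_diff; apply: Hr'.
  rewrite /ball_ /= addrA opprD addrCA subrr addr0 normrN.
  exact: lt_trans (lN _ _ Ha Hb) tr'.
pose phi := (fun s : R => f (s *: x + (t *: y + p)) - f (s *: x + p)) : R -> R.
pose dphi s := g (s *: x + (t *: y + p)) - g (s *: x + p).
have dphiP s : 0 <= s <= t -> is_derive s 1 phi (dphi s).
  move=> Hs; have := sm s 0 Hs zt; rewrite scale0r add0r => d0.
  have D1 := is_derive_line (sm s t Hs tt).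
  have D2 := is_derive_line d0.
  exact: is_deriveB D1 D2.
have Hd s : s \in `]0, t[%R -> is_derive s 1 phi (dphi s).
  by rewrite in_itv /= => /andP[s0 st]; apply: dphiP; rewrite !ltW.
have Hc : {within `[0, t], continuous phi}.
  apply: derivable_within_continuous => s; rewrite in_itv /= => Hs.
  by have [] := dphiP s Hs.
(* Only the x-increment goes through the mean value theorem, so no second derivative away from p is
   involved. *)
have [c] := MVT t0 Hd Hc; rewrite in_itv /= subr0 => /andP[c0 ct].
rewrite {1 2}/phi !scale0r !add0r => ->.
have Hct : 0 <= c <= t by rewrite !ltW.
have bound h : `|h| < t * N ->
    `|g (h + p) - (g p + 'd g p h)| <= e * t / 2.
  move=> hN; have /Hr : `|h| < r by apply: lt_trans hN _.
  move=> /le_trans; apply; rewrite /= (le_trans (ler_wpM2l (ltW eN) (ltW hN))) //.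
  by rewrite le_eqVlt; apply/orP; left; apply/eqP; field; rewrite gt_eqF.
have b1 := bound _ (lN _ _ Hct tt).
have b2 := bound _ (lN _ _ Hct zt).
rewrite deriveE // -/g.
(* The linear parts at c x + t y and at c x differ by t 'd g p y, which is exactly the term
   subtracted. *)
have -> : dphi c * t - t ^+ 2 * 'd g p y =
    t * ((g (c *: x + t *: y + p) - (g p + 'd g p (c *: x + t *: y)))
     - (g (c *: x + 0 *: y + p) - (g p + 'd g p (c *: x + 0 *: y)))).
  have -> : 'd g p (c *: x + t *: y) = 'd g p (c *: x) + t * 'd g p y.
    by rewrite linearD; congr (_ + _); rewrite linearZ.
  by rewrite /dphi scale0r addr0 addrA; ring.
rewrite normrM gtr0_norm // expr2 mulrCA ler_pM2l //.
rewrite (le_trans (ler_normB _ _)) // (le_trans (lerD b1 b2)) //.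
by rewrite -splitr.
Qed.

(** The second difference is symmetric in x and y, so both mixed derivatives approximate the same
    quantity, each with error (e / 2) t^2. *)
Lemma derive_swap f p x y : smooth_at f p ->
  'D_x (fun q => 'D_y f q) p = 'D_y (fun q => 'D_x f q) p.
Proof.
move=> sf; apply/eqP; rewrite -subr_eq0 -normr_le0.
apply/ler_addgt0Pl => e e0; rewrite addr0.
have e20 : 0 < e / 2 by rewrite divr_gt0.
have [d1 d10 H1] := second_difference x y sf e20.
have [d2 d20 H2] := second_difference y x sf e20.
(* Half of the minimum, to be strictly below both thresholds. *)
pose t := Num.min d1 d2 / 2.
have m0 : 0 < Num.min d1 d2 by rewrite lt_min d10.
have t0 : 0 < t by rewrite divr_gt0.
have tm : t < Num.min d1 d2 by rewrite ltr_pdivrMr // ltr_pMr // ltr1n.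
move: tm; rewrite lt_min => /andP[td1 td2].
have {}H1 := H1 t (introT andP (conj t0 td1)).
have {}H2 := H2 t (introT andP (conj t0 td2)).
have t20 : 0 < t ^+ 2 by rewrite exprn_gt0.
rewrite -(ler_pM2l t20) -[X in X * `|_|]gtr0_norm // -normrM.
move: H1 H2; set a := 'D_y _ p; set b := 'D_x _ p.
(* Identifies the far corners of the two parallelograms. *)
rewrite (addrCA (t *: y)).
set F1 := f (_ + (_ + _)); set F2 := f (_ + p); set F3 := f (_ + p).
move=> H1 H2.
have -> : t ^+ 2 * (b - a) = (F1 - F2 - (F3 - f p) - t ^+ 2 * a)
    - (F1 - F3 - (F2 - f p) - t ^+ 2 * b) by ring.
rewrite (le_trans (ler_normB _ _)) // (le_trans (lerD H1 H2)) //.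
by rewrite -mulrDl -splitr mulrC.
Qed.

End Schwarz.

(** * Second derivatives of vector-valued maps and of compositions *)

Section SecondOrder.
Context {R : realType}.
Implicit Types V W : normedModType R.

Lemma derive_coord V n (f : V -> 'rV[R]_n) x v i : smooth_at f x ->
  ('D_v f x) ord0 i = 'D_v ((fun y => f y ord0 i) : V -> R^o) x.
Proof.
move=> sf; rewrite (derive_mx (smooth_at_derivable sf)) mxE //.
Qed.

(** An equality near x also holds near every point close to x, so it can be differentiated and
    remain an equality near x, ready to be differentiated again. *)
Lemma near_derive V W (f g : V -> W) (x v : V) :
  (\near x, f x = g x) -> \near x, 'D_v f x = 'D_v g x.
Proof.
move=> fg; have := near_join fg.
by apply: filterS => y; exact: near_eq_derive.
Qed.

Lemma derive2_coord V n (f : V -> 'rV[R]_n) p x y i : smooth_at f p ->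
  ('D_x (fun q => 'D_y f q) p) ord0 i =
  'D_x (fun q => 'D_y ((fun q => f q ord0 i) : V -> R^o) q) p.
Proof.
move=> sf; rewrite derive_coord; last exact: smooth_at_derive.
apply: near_eq_derive; apply: filterS (smooth_at_near sf) => q.
exact: derive_coord.
Qed.

Lemma derive_swap_rV V n (f : V -> 'rV[R]_n) p x y : smooth_at f p ->
  'D_x (fun q => 'D_y f q) p = 'D_y (fun q => 'D_x f q) p.
Proof.
move=> sf; apply/rowP => i.
have e1 := derive2_coord x y i sf; have e2 := derive2_coord y x i sf.
have e3 := derive_swap x y (smooth_at_coord i sf).
exact: (etrans e1 (etrans e3 (esym e2))).
Qed.

Lemma derive_sum_fin V W (I : finType) (F : I -> V -> W) p x :
  (forall i, derivable (F i) p x) ->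
  'D_x (fun q => \sum_i F i q) p = \sum_i 'D_x (F i) p.
Proof.
move=> dF; suff H (r : seq I) :
    is_derive p x (fun q => \sum_(i <- r) F i q) (\sum_(i <- r) 'D_x (F i) p).
  exact: (@derive_val _ _ _ _ _ _ _ (H _)).
elim: r => [|i r IH].
  have -> : (fun q => \sum_(i <- [::]) F i q) = cst 0.
    by apply/funext => q; rewrite big_nil.
  by rewrite big_nil; exact: is_derive_cst.
have -> : (fun q => \sum_(j <- i :: r) F j q) =
     F i + (fun q => \sum_(j <- r) F j q).
  by apply/funext => q; rewrite big_cons.
by rewrite big_cons; apply: is_deriveD => //; exact: derivableP.
Qed.

Lemma derive_sum_scale V (I : finType) (a : I -> R) (F : I -> V -> R^o) p x :
  (forall i, derivable (F i) p x) ->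
  'D_x ((fun q => \sum_i a i * F i q) : V -> R^o) p = \sum_i a i * 'D_x (F i) p.
Proof.
move=> dF; have := @derive_sum_fin V R^o I (fun i => a i \*: F i) p x.
move=> ->; last by move=> i; exact: derivableZ.
by apply: eq_bigr => i _; rewrite deriveZ.
Qed.

(** Second-order chain rule. Near p the inner derivative is the sum over i of ('D_y m)_i times the
    i-th partial derivative of F along m; the Leibniz rule gives the Hessian of F, with the
    direction 'D_y m frozen at p, plus the differential of F on the second derivative of m. *)
Lemma derive2_comp V n (F : 'rV[R]_n -> R^o) (m : V -> 'rV[R]_n) p x y :
  smooth_at m p -> smooth_at F (m p) ->
  'D_x (fun q => 'D_y (F \o m) q) p =
  'D_('D_x m p) (fun z => 'D_('D_y m p) F z) (m p)
  + 'd F (m p) ('D_x (fun q => 'D_y m q) p).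
Proof.
move=> sm sF.
pose DF i z := 'D_(delta_mx ord0 i) F z : R^o.
pose M i q := 'D_y m q ord0 i : R^o.
have sDF i : smooth_at (DF i) (m p) by apply: smooth_at_derive.
have sM i : smooth_at (M i) p.
  by apply: smooth_at_coord; exact: smooth_at_derive.
have step1 : 'D_x (fun q => 'D_y (F \o m) q) p =
    'D_x ((fun q => \sum_i M i q * DF i (m q)) : V -> R^o) p.
  apply: near_eq_derive.
  have sFn : \near p, smooth_at F (m p).
    exact: (smooth_at_continuous sm (smooth_at_near sF)).
  move: sFn; apply: filterS2 (smooth_at_near sm) => q smq sFq.
  rewrite derive_comp; try exact: smooth_at_diff.
  by rewrite diff_rVE //; exact: smooth_at_diff.
have sMD i : smooth_at ((fun q => M i q * DF i (m q)) : V -> R^o) p.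
  by apply: smooth_atM => //; exact: (smooth_at_comp_real sm (sDF i)).
rewrite step1 derive_sum_fin; last by move=> i; exact: smooth_at_derivable.
have step2 i : 'D_x ((fun q => M i q * DF i (m q)) : V -> R^o) p =
    M i p * 'D_('D_x m p) (DF i) (m p) + DF i (m p) * 'D_x (M i) p.
  have s1 := smooth_at_comp_real sm (sDF i).
  have e1 : 'D_x (DF i \o m) p = 'D_('D_x m p) (DF i) (m p).
    rewrite derive_comp; try exact: smooth_at_diff.
    by rewrite [RHS]deriveE //; exact: smooth_at_diff.
  have e2 := deriveM (smooth_at_derivable (sM i)) (smooth_at_derivable s1).
  by rewrite -e1; exact: e2.
rewrite (eq_bigr _ (fun i _ => step2 i)) big_split /=; congr (_ + _).
  rewrite -derive_sum_scale; last by move=> i; exact: smooth_at_derivable.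
  apply: near_eq_derive; apply: filterS (smooth_at_near sF) => z sFz.
  by rewrite deriveE ?diff_rVE //; exact: smooth_at_diff.
rewrite diff_rVE; last exact: smooth_at_diff.
apply: eq_bigr => i _; rewrite mulrC derive_coord //.
exact: smooth_at_derive.
Qed.

End SecondOrder.

(** * Mixed partial derivatives in two vector variables *)

Section MixedPartials.
Context {R : realType} {k l : nat}.
Implicit Types (a x : 'rV[R]_k) (b y : 'rV[R]_l).

(** Turns partial derivatives into derivatives along [row_mx x 0] and [row_mx 0 y], so that results
    in one variable apply. *)
Definition uncurry_rV {T : Type} (H : 'rV[R]_k -> 'rV[R]_l -> T)
  (z : 'rV[R]_(k + l)) := H (lsubmx z) (rsubmx z).

(** The difference quotients coincide as functions of h, so no differentiability is required. *)
Lemma derive_snd {W : normedModType R} (H : 'rV[R]_k -> 'rV[R]_l -> W) a b y :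
  'D_y (H a) b = 'D_(row_mx 0 y) (uncurry_rV H) (row_mx a b).
Proof.
have E : (fun h : R => h^-1 *: ((H a \o shift b) (h *: y) - H a b)) =
    (fun h => h^-1 *: ((uncurry_rV H \o shift (row_mx a b)) (h *: row_mx 0 y) -
       uncurry_rV H (row_mx a b))).
  apply/funext => h /=; rewrite /uncurry_rV !linearD !linearZ /=.
  by rewrite !row_mxKl !row_mxKr !scaler0 !add0r.
by rewrite /derive E.
Qed.

Lemma derive_fst {W : normedModType R} (H : 'rV[R]_k -> 'rV[R]_l -> W) a b x :
  'D_x (H^~ b) a = 'D_(row_mx x 0) (uncurry_rV H) (row_mx a b).
Proof.
have E : (fun h : R => h^-1 *: ((H^~ b \o shift a) (h *: x) - H a b)) =
    (fun h => h^-1 *: ((uncurry_rV H \o shift (row_mx a b)) (h *: row_mx x 0) -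
       uncurry_rV H (row_mx a b))).
  apply/funext => h /=; rewrite /uncurry_rV !linearD !linearZ /=.
  by rewrite !row_mxKl !row_mxKr !scaler0 !add0r.
by rewrite /derive E.
Qed.

Lemma derive_fst_snd {W : normedModType R} (H : 'rV[R]_k -> 'rV[R]_l -> W)
  a b x y : 'D_x (fun w => 'D_y (H w) b) a =
  'D_(row_mx x 0) (fun q => 'D_(row_mx 0 y) (uncurry_rV H) q) (row_mx a b).
Proof.
have -> : (fun w => 'D_y (H w) b) =
    (fun w w' => 'D_(row_mx 0 y) (uncurry_rV H) (row_mx w w'))^~ b.
  by apply/funext => w; exact: derive_snd.
pose H' w w' := 'D_(row_mx 0 y) (uncurry_rV H) (row_mx w w').
have <- : uncurry_rV H' = fun q => 'D_(row_mx 0 y) (uncurry_rV H) q.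
  by apply/funext => q; rewrite {1}/uncurry_rV /H' hsubmxK.
exact: (derive_fst H' a b x).
Qed.

Lemma derive_snd_fst {W : normedModType R} (H : 'rV[R]_k -> 'rV[R]_l -> W)
  a b x y : 'D_y (fun w' => 'D_x (H^~ w') a) b =
  'D_(row_mx 0 y) (fun q => 'D_(row_mx x 0) (uncurry_rV H) q) (row_mx a b).
Proof.
have -> : (fun w' => 'D_x (H^~ w') a) =
    (fun w w' => 'D_(row_mx x 0) (uncurry_rV H) (row_mx w w')) a.
  by apply/funext => w'; exact: derive_fst.
pose H' w w' := 'D_(row_mx x 0) (uncurry_rV H) (row_mx w w').
have <- : uncurry_rV H' = fun q => 'D_(row_mx x 0) (uncurry_rV H) q.
  by apply/funext => q; rewrite {1}/uncurry_rV /H' hsubmxK.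
exact: (derive_snd H' a b y).
Qed.

Lemma mixed_swap (H : 'rV[R]_k -> 'rV[R]_l -> R^o) a b x y :
  smooth_at (uncurry_rV H) (row_mx a b) ->
  'D_x (fun w => 'D_y (H w) b) a = 'D_y (fun w' => 'D_x (H^~ w') a) b.
Proof.
move=> sH; rewrite (derive_fst_snd H a b x y) (derive_snd_fst H a b x y).
exact: derive_swap.
Qed.

Lemma mixed_comp n (F : 'rV[R]_n -> R^o) (m : 'rV[R]_k -> 'rV[R]_l -> 'rV[R]_n)
  a b x y : smooth_at (uncurry_rV m) (row_mx a b) -> smooth_at F (m a b) ->
  'D_x (fun w => 'D_y (fun w' => F (m w w')) b) a =
  'D_('D_x (m^~ b) a) (fun z => 'D_('D_y (m a) b) F z) (m a b)
  + 'd F (m a b) ('D_x (fun w => 'D_y (m w) b) a).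
Proof.
have mE : uncurry_rV m (row_mx a b) = m a b.
  by rewrite /uncurry_rV row_mxKl row_mxKr.
move=> sm; rewrite -mE => sF.
rewrite (derive_fst_snd (fun w w' => F (m w w'))).
by rewrite (derive2_comp _ _ sm sF) -derive_fst -derive_snd -derive_fst_snd.
Qed.

(** Source of the smoothness in the group variable of everything defined by differentiating at the
    identity: [right_deriv], [left_deriv] and the entries of [Ad]. *)
Lemma smooth_at_snd (H : 'rV[R]_k -> 'rV[R]_l -> R^o) a b y :
  smooth_at (uncurry_rV H) (row_mx a b) ->
  smooth_at ((fun w => 'D_y (H w) b) : _ -> R^o) a.
Proof.
move=> sH; have -> : (fun w => 'D_y (H w) b) =
    (fun q => 'D_(row_mx 0 y) (uncurry_rV H) q) \o (fun w => row_mx w b).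
  by apply/funext => w; exact: derive_snd.
apply: smooth_at_comp_real; last exact: smooth_at_derive.
by apply: smooth_at_row_mx; [exact: smooth_at_id|exact: smooth_at_cst].
Qed.

End MixedPartials.

(** * Charts and plots *)

Section Charts.
Context {R : realType}.
Implicit Types V : normedModType R.

(** The part of [is_manifold] that refers to no topology on M; it passes to products and to
    [quotS]. *)
Definition good_charts n (M : Type) (A : atlas R n M) :=
  forall m, [/\ dom A m m, open (img A m) &
    forall x, dom A m x -> point A m (coord A m x) = x].

(* Smoothness at one point, in the chart centred at the value there. *)
Definition plot n (M : Type) (A : atlas R n M) V (phi : V -> M) (x : V) :=
  (\forall y \near x, dom A (phi x) (phi y)) /\
  smooth_at (fun y => coord A (phi x) (phi y)) x.

(** The velocity of the plot, read in the chart of phi x as tangent vectors at phi x are. *)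
Definition pdiff n (M : Type) (A : atlas R n M) V (phi : V -> M) (x v : V) :=
  'D_v (fun y => coord A (phi x) (phi y)) x.

Lemma img_center n M (A : atlas R n M) m :
  good_charts A -> img A m (coord A m m).
Proof. by move=> /(_ m)[d _ _]; exists m. Qed.

Lemma point_center n M (A : atlas R n M) m :
  good_charts A -> point A m (coord A m m) = m.
Proof. by move=> /(_ m)[d _]; apply. Qed.

Lemma imgP n M (A : atlas R n M) m u : good_charts A -> img A m u ->
  dom A m (point A m u) /\ coord A m (point A m u) = u.
Proof. by move=> /(_ m)[_ _ K] [x dx <-]; rewrite K. Qed.

Lemma near_img n M (A : atlas R n M) m u : good_charts A -> img A m u ->
  \forall w \near u, img A m w.
Proof. by move=> /(_ m)[_ o _] iu; exact: (open_near o iu). Qed.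

Lemma plot_point_center n M (A : atlas R n M) m : good_charts A ->
  plot A (point A m) (coord A m m).
Proof.
move=> gA; have ni := near_img gA (img_center m gA).
split; rewrite point_center //.
  by apply: filterS ni => u /(imgP gA)[].
apply: smooth_at_eq (smooth_at_id _).
by apply: filterS ni => u /(imgP gA)[_ ->].
Qed.

Lemma pdiff_point_center n M (A : atlas R n M) m v : good_charts A ->
  pdiff A (point A m) (coord A m m) v = v.
Proof.
move=> gA; rewrite /pdiff point_center // -[RHS](derive_id (coord A m m)).
apply: near_eq_derive; apply: filterS (near_img gA (img_center m gA)) => u.
by move=> /(imgP gA)[_ ->].
Qed.

Section Maps.
Context {n k : nat} {M N : Type} {A : atlas R n M} {B : atlas R k N}.
Hypothesis gA : good_charts A.

Lemma smooth_mapP (f : M -> N) :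
  smooth_map A B f <-> forall m, plot B (f \o point A m) (coord A m m).
Proof.
split=> [sf m|H m].
  have [U oU [Um Ui dU sU]] := sf m.
  split=> /=; rewrite point_center //; first exact: (open_near oU Um).
  by exists U.
have [/= d s] := H m; rewrite point_center // in d s.
have [U [oU Um] sU] := s.
move: d; rewrite -nbhs_nearE nbhsE => -[U' [oU' U'm] dU'].
have [_ oI _] := gA m.
(* U carries the smoothness, U' keeps the values of f in the chart of f m. *)
exists (U `&` U' `&` img A m); first by apply: openI => //; exact: openI.
split.
- by split=> //; exact: img_center.
- by move=> u [].
- by move=> u [[_ U'u] _]; exact: dU'.
- by move=> j; apply: Ck_on_sub (sU j) => u [[]].
Qed.

(** Near x, phi y is the point of coordinates coord A (phi x) (phi y), so f \o phi is locally the
    expression of f in charts composed with that of phi. *)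
Lemma plot_comp V (f : M -> N) (phi : V -> M) x :
  smooth_map A B f -> plot A phi x -> plot B (f \o phi) x.
Proof.
move=> /smooth_mapP/(_ (phi x))[/= df sf] [dp sp].
rewrite point_center // in df sf.
have [_ _ K] := gA (phi x).
have cp := smooth_at_continuous sp.
split=> /=.
  have := cp _ df; rewrite /= nbhs_simpl.
  by move: dp; apply: filterS2 => y dy; rewrite /= K.
apply: smooth_at_eq (smooth_at_comp sp sf).
by apply: filterS dp => y dy; rewrite /= K.
Qed.

Lemma dmap_smooth (f : M -> N) m : smooth_map A B f ->
  smooth_at (coord B (f m) \o f \o point A m) (coord A m m).
Proof. by move=> /smooth_mapP/(_ m)[_]; rewrite /= point_center. Qed.

Lemma pdiff_comp V (f : M -> N) (phi : V -> M) x v :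
  smooth_map A B f -> plot A phi x ->
  pdiff B (f \o phi) x v = dmap A B f (phi x) (pdiff A phi x v).
Proof.
move=> sf [dp sp]; rewrite /dmap lfunE /=.
have [_ _ K] := gA (phi x).
rewrite /pdiff -derive_comp; last exact/smooth_at_diff/dmap_smooth.
  apply: near_eq_derive; apply: filterS dp => y dy.
  by rewrite /= K.
exact: smooth_at_diff.
Qed.

Lemma dmapE (f : M -> N) m v : smooth_map A B f ->
  dmap A B f m v = pdiff B (f \o point A m) (coord A m m) v.
Proof.
move=> sf; rewrite (pdiff_comp _ sf); last exact: plot_point_center.
by rewrite (pdiff_point_center m v gA) (point_center m gA).
Qed.

End Maps.

Lemma dmap_ext n k M N (A : atlas R n M) (B : atlas R k N) (f g : M -> N) m v :
  f =1 g -> dmap A B f m v = dmap A B g m v.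
Proof. by move=> /funext ->. Qed.

Lemma smooth_map_comp n1 n2 n3 (M1 M2 M3 : Type) (A1 : atlas R n1 M1)
  (A2 : atlas R n2 M2) (A3 : atlas R n3 M3) (g : M2 -> M3) (f : M1 -> M2) :
  good_charts A1 -> good_charts A2 ->
  smooth_map A2 A3 g -> smooth_map A1 A2 f -> smooth_map A1 A3 (g \o f).
Proof.
move=> gA1 gA2 sg sf; apply/smooth_mapP => // m.
by apply: (plot_comp gA2 sg); move/smooth_mapP: sf; apply.
Qed.

Lemma dmap_comp n1 n2 n3 (M1 M2 M3 : Type) (A1 : atlas R n1 M1)
  (A2 : atlas R n2 M2) (A3 : atlas R n3 M3) (g : M2 -> M3) (f : M1 -> M2) m v :
  good_charts A1 -> good_charts A2 ->
  smooth_map A2 A3 g -> smooth_map A1 A2 f ->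
  dmap A1 A3 (g \o f) m v = dmap A2 A3 g (f m) (dmap A1 A2 f m v).
Proof.
move=> gA1 gA2 sg sf; have sgf := smooth_map_comp gA1 gA2 sg sf.
rewrite (dmapE gA1 _ _ sgf) (dmapE gA1 _ _ sf).
have := pdiff_comp gA2 v sg ((smooth_mapP gA1 f).1 sf m).
by rewrite /= (point_center m gA1).
Qed.

Lemma smooth_map_id n M (A : atlas R n M) : good_charts A ->
  smooth_map A A id.
Proof. by move=> gA; apply/smooth_mapP => // m; exact: plot_point_center. Qed.

Lemma dmap_id n M (A : atlas R n M) m v : good_charts A ->
  dmap A A id m v = v.
Proof.
move=> gA; rewrite (dmapE gA m v (smooth_map_id gA)).
exact: pdiff_point_center.
Qed.

Lemma plot_cst n M (A : atlas R n M) V m (x : V) : good_charts A ->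
  plot A (fun=> m) x.
Proof.
move=> /(_ m)[d _ _]; split; first exact: nearW.
exact: smooth_at_cst.
Qed.

Lemma pdiff_cst n M (A : atlas R n M) V m (x v : V) :
  pdiff A (fun=> m) x v = 0.
Proof. exact: derive_cst. Qed.

Lemma smooth_map_cst n k M N (A : atlas R n M) (B : atlas R k N) (p : N) :
  good_charts A -> good_charts B -> smooth_map A B (fun=> p).
Proof. by move=> gA gB; apply/smooth_mapP => // m; exact: plot_cst. Qed.

(** * Products of manifolds *)

Section Products.
Context {n k : nat} {M N : Type} {A : atlas R n M} {B : atlas R k N}.

Lemma img_prod m : img (prod_atlas A B) m =
  lsubmx @^-1` img A m.1 `&` rsubmx @^-1` img B m.2.
Proof.
apply/seteqP; split=> [u /= [[x y] /= [dx dy] <-]|u /= [[x dx Ex] [y dy Ey]]].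
  by rewrite /= row_mxKl row_mxKr; split; [exists x|exists y].
by exists (x, y) => //=; rewrite Ex Ey hsubmxK.
Qed.

Lemma good_charts_prod :
  good_charts A -> good_charts B -> good_charts (prod_atlas A B).
Proof.
move=> gA gB [m1 m2].
have [d1 o1 K1] := gA m1; have [d2 o2 K2] := gB m2.
split=> //=.
  rewrite img_prod; apply: openI.
    by apply: open_comp => // u _; exact: continuous_lsubmx.
  by apply: open_comp => // u _; exact: continuous_rsubmx.
by move=> [x y] /= [dx dy]; rewrite row_mxKl row_mxKr K1 ?K2.
Qed.

Lemma plot_pair V (phi : V -> M) (psi : V -> N) x :
  plot A phi x -> plot B psi x ->
  plot (prod_atlas A B) (fun y => (phi y, psi y)) x.
Proof.
move=> [d1 s1] [d2 s2]; split=> /=; last exact: smooth_at_row_mx.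
by move: d1 d2; apply: filterS2.
Qed.

Lemma pdiff_pair V (phi : V -> M) (psi : V -> N) x v :
  plot A phi x -> plot B psi x ->
  pdiff (prod_atlas A B) (fun y => (phi y, psi y)) x v =
  row_mx (pdiff A phi x v) (pdiff B psi x v).
Proof.
move=> [d1 s1] [d2 s2]; apply/rowP => i.
have s12 := smooth_at_row_mx s1 s2.
have [j ->|j ->] := split_ordP i.
  rewrite row_mxEl; apply: etrans (derive_coord v (lshift k j) s12) _.
  apply: etrans (esym (derive_coord v j s1)); apply: (congr1 (fun f => 'D_v f x)).
  by apply/funext => y; rewrite row_mxEl.
rewrite row_mxEr; apply: etrans (derive_coord v (rshift n j) s12) _.
apply: etrans (esym (derive_coord v j s2)); apply: (congr1 (fun f => 'D_v f x)).
by apply/funext => y; rewrite row_mxEr.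
Qed.

Lemma smooth_pair n' (M' : Type) (A' : atlas R n' M') (f : M' -> M) (g : M' -> N) :
  good_charts A' -> smooth_map A' A f -> smooth_map A' B g ->
  smooth_map A' (prod_atlas A B) (fun x => (f x, g x)).
Proof.
move=> gA' /(smooth_mapP gA') sf /(smooth_mapP gA') sg.
by apply/(smooth_mapP gA') => m; exact: plot_pair (sf m) (sg m).
Qed.

Lemma dmap_pair n' (M' : Type) (A' : atlas R n' M') (f : M' -> M)
    (g : M' -> N) m v :
  good_charts A' -> smooth_map A' A f -> smooth_map A' B g ->
  dmap A' (prod_atlas A B) (fun x => (f x, g x)) m v =
  row_mx (dmap A' A f m v) (dmap A' B g m v).
Proof.
move=> gA' sf sg; rewrite (dmapE gA' m v (smooth_pair gA' sf sg)).
rewrite (dmapE gA' m v sf) (dmapE gA' m v sg).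
have pf := (smooth_mapP gA' f).1 sf m; have pg := (smooth_mapP gA' g).1 sg m.
exact: pdiff_pair pf pg.
Qed.

Lemma smooth_fst : good_charts A -> good_charts B ->
  smooth_map (prod_atlas A B) A fst.
Proof.
move=> gA gB; apply/(smooth_mapP (good_charts_prod gA gB)) => -[m1 m2].
have [d s] := plot_point_center m1 gA.
have := @continuous_lsubmx _ 1 n k (row_mx (coord A m1 m1) (coord B m2 m2)).
rewrite /continuous_at row_mxKl => c.
split; rewrite /= row_mxKl.
  by have := c _ d; rewrite /= nbhs_simpl.
pose z := row_mx (coord A m1 m1) (coord B m2 m2).
have := @smooth_at_comp R _ _ _ _ (fun y => coord A (point A m1 (coord A m1 m1))
  (point A m1 y)) z (smooth_at_lsubmx z).
by rewrite row_mxKl; apply.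
Qed.

Lemma smooth_snd : good_charts A -> good_charts B ->
  smooth_map (prod_atlas A B) B snd.
Proof.
move=> gA gB; apply/(smooth_mapP (good_charts_prod gA gB)) => -[m1 m2].
have [d s] := plot_point_center m2 gB.
have := @continuous_rsubmx _ 1 n k (row_mx (coord A m1 m1) (coord B m2 m2)).
rewrite /continuous_at row_mxKr => c.
split; rewrite /= row_mxKr.
  by have := c _ d; rewrite /= nbhs_simpl.
pose z := row_mx (coord A m1 m1) (coord B m2 m2).
have := @smooth_at_comp R _ _ _ _ (fun y => coord B (point B m2 (coord B m2 m2))
  (point B m2 y)) z (smooth_at_rsubmx z).
by rewrite row_mxKr; apply.
Qed.

(** Composing f with the slices a |-> (a, m.2) and b |-> (m.1, b), whose differentials are x |-> (x,
    0) and y |-> (0, y), splits the differential. *)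
Lemma dmap_prod n' (M' : Type) (C : atlas R n' M') (f : M * N -> M') m x y :
  good_charts A -> good_charts B -> smooth_map (prod_atlas A B) C f ->
  dmap (prod_atlas A B) C f m (row_mx x y) =
  dmap A C (fun a => f (a, m.2)) m.1 x + dmap B C (fun b => f (m.1, b)) m.2 y.
Proof.
move=> gA gB sf; have gP := good_charts_prod gA gB.
have sc1 : smooth_map A (prod_atlas A B) (fun a => (a, m.2)).
  by apply: smooth_pair => //; [exact: smooth_map_id|exact: smooth_map_cst].
have sc2 : smooth_map B (prod_atlas A B) (fun b => (m.1, b)).
  by apply: smooth_pair => //; [exact: smooth_map_cst|exact: smooth_map_id].
rewrite (dmap_comp _ _ gA gP sf sc1) (dmap_comp _ _ gB gP sf sc2).
rewrite -surjective_pairing -linearD; congr (dmap _ _ _ _ _).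
rewrite (dmap_pair _ _ gA (smooth_map_id gA) (smooth_map_cst m.2 gA gB)).
rewrite (dmap_pair _ _ gB (smooth_map_cst m.1 gB gA) (smooth_map_id gB)).
rewrite !dmap_id // (dmapE gA _ _ (smooth_map_cst m.2 gA gB)).
rewrite (dmapE gB _ _ (smooth_map_cst m.1 gB gA)).
by rewrite /comp !pdiff_cst add_row_mx addr0 add0r.
Qed.

End Products.

Definition smooth_fun_at n (M : Type) (A : atlas R n M) (f : M -> R) (m : M) :=
  smooth_at ((f \o point A m) : 'rV[R]_n -> R^o) (coord A m m).

Section Functions.
Context {n : nat} {M : Type} {A : atlas R n M}.
Hypothesis gA : good_charts A.

Lemma smooth_fun_comp V (f : M -> R) (phi : V -> M) x :
  smooth_fun_at A f (phi x) -> plot A phi x ->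
  smooth_at ((f \o phi) : V -> R^o) x.
Proof.
move=> sf [dp sp]; have [_ _ K] := gA (phi x).
apply: smooth_at_eq (smooth_at_comp_real sp sf).
by apply: filterS dp => y dy; rewrite /= K.
Qed.

Lemma derive_fun_comp V (f : M -> R) (phi : V -> M) x v :
  smooth_fun_at A f (phi x) -> plot A phi x ->
  'D_v ((f \o phi) : V -> R^o) x = dfun A f (phi x) (pdiff A phi x v).
Proof.
move=> sf [dp sp]; rewrite /dfun lfunE /=.
have [_ _ K] := gA (phi x).
rewrite /pdiff -derive_comp; last exact: smooth_at_diff.
  apply: near_eq_derive; apply: filterS dp => y dy.
  by rewrite /= K.
exact: smooth_at_diff.
Qed.

End Functions.

(** * Changes of charts *)

Section Manifold.
Context {n : nat} {M : topologicalType} {A : atlas R n M}.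
Hypothesis mA : is_manifold A.

Lemma manifold_charts : good_charts A.
Proof. by have [_ _ H _] := mA => m; have [d _ o K _] := H m. Qed.
Let gA := manifold_charts.

(** The transition maps are assumed smooth on overlaps; openness of the overlap makes this a
    statement at each of its points. *)
Lemma overlap_open m m' : open (coord A m @` (dom A m `&` dom A m')).
Proof.
have [_ _ H _] := mA; have [dm odm oim Km [ccm cpm]] := H m.
have [_ odm' _ _ _] := H m'.
rewrite openE => _ [x [dx d'x] <-]; rewrite /interior.
have ix : img A m (coord A m x) by exists x.
have : \forall u \near coord A m x, dom A m' (point A m u).
  have := cpm _ ix (dom A m'); rewrite /= nbhs_simpl Km //; apply.
  exact: (open_nbhs_nbhs (conj odm' d'x)).
move: (near_img gA ix); apply: filterS2 => u iu d'u.
by have [du Eu] := imgP gA iu; exists (point A m u).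
Qed.

Lemma transition_smooth m m' x : dom A m x -> dom A m' x ->
  smooth_at (coord A m' \o point A m) (coord A m x).
Proof.
move=> dx d'x; have [_ _ _ H] := mA.
by move/smooth_onP: (H m m'); apply; [exact: overlap_open|exists x].
Qed.

Lemma near_dom m u m' : img A m u -> dom A m' (point A m u) ->
  \forall w \near u, dom A m' (point A m w).
Proof.
move=> iu du; have [_ _ H _] := mA.
have [_ _ _ Km [_ cpm]] := H m; have [_ odm' _ _ _] := H m'.
have := cpm _ iu (dom A m'); rewrite /= nbhs_simpl; apply.
exact: (open_nbhs_nbhs (conj odm' du)).
Qed.

(** The velocity of a plot read in the chart of another point m: [dcoord] is the change of
    coordinates. *)
Lemma pdiff_dcoord V (phi : V -> M) x m v : plot A phi x -> dom A m (phi x) ->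
  'D_v (fun y => coord A m (phi y)) x = dcoord A m (phi x) (pdiff A phi x v).
Proof.
move=> [dp sp] dm; have [d _ K] := gA (phi x).
rewrite /dcoord lfunE /= /pdiff -derive_comp.
- by apply: near_eq_derive; apply: filterS dp => y dy /=; rewrite K.
- exact: smooth_at_diff.
- exact/smooth_at_diff/transition_smooth.
Qed.

Lemma plot_point m u : img A m u -> plot A (point A m) u.
Proof.
move=> iu; have [du Eu] := imgP gA iu.
have [d _ _] := gA (point A m u).
split; first exact: near_dom.
by have := transition_smooth du d; rewrite Eu.
Qed.

(** Smoothness at each point in its own chart suffices because the inverse of any chart is a plot
    everywhere on its image, by smoothness of the transition maps. *)
Lemma smooth_funP (f : M -> R) :
  smooth_fun A f <-> forall m, smooth_fun_at A f m.
Proof.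
split=> [sf m|H m].
  have [_ o _] := gA m.
  by move/(smooth_onP _ o): (sf m); apply; exact: img_center.
have [_ o _] := gA m.
apply/(smooth_onP _ o) => u iu.
by apply: smooth_fun_comp => //; exact: plot_point.
Qed.

Lemma smooth_fun_coord m (a : covec R n) p : dom A m p ->
  smooth_fun_at A (fun x => a (coord A m x)) p.
Proof.
move=> dm; rewrite /smooth_fun_at.
have [d _ _] := gA p.
have ca := @linear_rV_continuous R n R^o a.
have := smooth_at_lin ca (transition_smooth d dm).
exact.
Qed.

Lemma dfun_coord m (a : covec R n) p v : dom A m p ->
  dfun A (fun x => a (coord A m x)) p v = a (dcoord A m p v).
Proof.
move=> dm; have [d _ _] := gA p.
have dt := smooth_at_diff (transition_smooth d dm).
have da z : differentiable (a : 'rV[R]_n -> R^o) z.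
  exact: smooth_at_diff (smooth_at_linear _ _).
have E1 : 'd ((a : 'rV[R]_n -> R^o) \o (coord A m \o point A p)) (coord A p p) v =
    a ('d (coord A m \o point A p) (coord A p p) v).
  rewrite (diff_comp dt (da _)).
  have L z : 'd (a : 'rV[R]_n -> R^o) z = a :> ('rV[R]_n -> R^o).
    by apply: diff_lin; exact: linear_rV_continuous.
  exact: (congr1 (fun h : 'rV[R]_n -> R^o =>
    h ('d (coord A m \o point A p) (coord A p p) v)) (L _)).
rewrite /dfun /dcoord !lfunE; exact: E1.
Qed.

End Manifold.
End Charts.

(** * Invariant derivations on a Lie group *)

(* Sealed, so that unification never compares two derivatives by unfolding. *)
HB.lock Definition right_deriv {R : realType} {n : nat} {G : groupType}
    (A : atlas R n G) (x : 'rV[R]_n) (f : G -> R) : G -> R :=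
  fun p => 'D_x ((fun w => f (point A 1 w * p)%g) : 'rV[R]_n -> R^o)
             (coord A 1%g 1%g).

HB.lock Definition left_deriv {R : realType} {n : nat} {G : groupType}
    (A : atlas R n G) (x : 'rV[R]_n) (f : G -> R) : G -> R :=
  fun p => 'D_x ((fun w => f (p * point A 1 w)%g) : 'rV[R]_n -> R^o)
             (coord A 1%g 1%g).

Section LieGroup.
Context {R : realType} {n : nat} {G : topGroupType} {A : atlas R n G}.
Hypothesis G_lie : is_lie_group A.
Implicit Types (V : normedModType R) (f : G -> R) (p : G) (x y : 'rV[R]_n).

Lemma lie_manifold : is_manifold A. Proof. by case: G_lie. Qed.
Lemma lie_charts : good_charts A.
Proof. exact: manifold_charts lie_manifold. Qed.
Let mA := lie_manifold.
Let gA := lie_charts.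
Let gAA := good_charts_prod gA gA.

Lemma plot_mul V (phi psi : V -> G) v : plot A phi v -> plot A psi v ->
  plot A (fun z => (phi z * psi z)%g) v.
Proof.
move=> pphi ppsi; have [_ sm _] := G_lie.
exact: (plot_comp gAA sm (plot_pair pphi ppsi)).
Qed.

Lemma plot_inv V (phi : V -> G) v : plot A phi v ->
  plot A (fun z => (phi z)^-1%g) v.
Proof. by move=> pphi; have [_ _ si] := G_lie; exact: (plot_comp gA si pphi). Qed.

Lemma plot_precomp V k (phi : 'rV[R]_k -> G) (h : V -> 'rV[R]_k) v :
  plot A phi (h v) -> smooth_at h v -> plot A (phi \o h) v.
Proof.
move=> [d s] sh; split; last exact: (smooth_at_comp sh s).
by have := smooth_at_continuous sh d; rewrite /= nbhs_simpl.
Qed.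

Lemma smooth_mulg k (M : Type) (B : atlas R k M) (f g : M -> G) :
  good_charts B -> smooth_map B A f -> smooth_map B A g ->
  smooth_map B A (fun z => (f z * g z)%g).
Proof.
move=> gB /(smooth_mapP gB) sf /(smooth_mapP gB) sg.
by apply/(smooth_mapP gB) => m; exact: plot_mul (sf m) (sg m).
Qed.

Lemma smooth_invg k (M : Type) (B : atlas R k M) (f : M -> G) :
  good_charts B -> smooth_map B A f -> smooth_map B A (fun z => (f z)^-1%g).
Proof.
move=> gB /(smooth_mapP gB) sf.
by apply/(smooth_mapP gB) => m; exact: plot_inv (sf m).
Qed.

Lemma smooth_rmul p : smooth_map A A (fun z => (z * p)%g).
Proof.
exact: smooth_mulg gA (smooth_map_id gA) (smooth_map_cst p gA gA).
Qed.

Lemma smooth_lmul p : smooth_map A A (fun z => (p * z)%g).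
Proof.
exact: smooth_mulg gA (smooth_map_cst p gA gA) (smooth_map_id gA).
Qed.

Lemma smooth_conj p : smooth_map A A (fun z => (p * z * p^-1)%g).
Proof. exact: smooth_mulg gA (smooth_lmul p) (smooth_map_cst _ gA gA). Qed.

Local Notation e := (coord A 1%g 1%g).
Local Notation pt := (point A 1%g).
Local Notation TR p := (dmap A A (fun z : G => (z * p)%g) 1%g).
Local Notation TL p := (dmap A A (fun z : G => (p * z)%g) 1%g).

Local Notation Rd := (right_deriv A).
Local Notation Ld := (left_deriv A).

Lemma RdF x f : Rd x f =
  fun p => 'D_x ((fun w => f (pt w * p)%g) : 'rV[R]_n -> R^o) e.
Proof. by rewrite right_deriv.unlock. Qed.

Lemma LdF x f : Ld x f =
  fun p => 'D_x ((fun w => f (p * pt w)%g) : 'rV[R]_n -> R^o) e.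
Proof. by rewrite left_deriv.unlock. Qed.

Lemma pt_e : pt e = 1%g. Proof. exact: point_center. Qed.

Lemma plot_pt : plot A pt e. Proof. exact: plot_point_center. Qed.

Lemma plot_rmul p : plot A (fun w => (pt w * p)%g) e.
Proof. exact: plot_mul plot_pt (plot_cst _ _ gA). Qed.

Lemma plot_lmul p : plot A (fun w => (p * pt w)%g) e.
Proof. exact: plot_mul (plot_cst _ _ gA) plot_pt. Qed.

Lemma pdiff_rmul p x : pdiff A (fun w => (pt w * p)%g) e x = TR p x.
Proof. by rewrite (dmapE gA 1%g x (smooth_rmul p)). Qed.

Lemma pdiff_lmul p x : pdiff A (fun w => (p * pt w)%g) e x = TL p x.
Proof. by rewrite (dmapE gA 1%g x (smooth_lmul p)). Qed.

Lemma RdE x f p : smooth_fun_at A f p -> Rd x f p = dfun A f p (TR p x).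
Proof.
move=> sf; have E : (pt e * p)%g = p by rewrite pt_e mul1g.
have sf' : smooth_fun_at A f (pt e * p)%g by rewrite E.
have := derive_fun_comp gA x sf' (plot_rmul p).
by rewrite pdiff_rmul E RdF.
Qed.

Lemma LdE x f p : smooth_fun_at A f p -> Ld x f p = dfun A f p (TL p x).
Proof.
move=> sf; have E : (p * pt e)%g = p by rewrite pt_e mulg1.
have sf' : smooth_fun_at A f (p * pt e)%g by rewrite E.
have := derive_fun_comp gA x sf' (plot_lmul p).
by rewrite pdiff_lmul E LdF.
Qed.

Lemma smooth_rmul_at f p : smooth_fun_at A f p ->
  smooth_at ((fun w => f (pt w * p)%g) : 'rV[R]_n -> R^o) e.
Proof.
move=> sf; have sf' : smooth_fun_at A f (pt e * p)%g by rewrite pt_e mul1g.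
exact: (smooth_fun_comp gA sf' (plot_rmul p)).
Qed.

Lemma smooth_lmul_at f p : smooth_fun_at A f p ->
  smooth_at ((fun w => f (p * pt w)%g) : 'rV[R]_n -> R^o) e.
Proof.
move=> sf; have sf' : smooth_fun_at A f (p * pt e)%g by rewrite pt_e mulg1.
exact: (smooth_fun_comp gA sf' (plot_lmul p)).
Qed.

Lemma plot_fst (phi : 'rV[R]_n -> G) (a b : 'rV[R]_n) : plot A phi a ->
  plot A (fun z : 'rV[R]_(n + n) => phi (lsubmx z)) (row_mx a b).
Proof.
move=> pphi; apply: (@plot_precomp _ _ phi lsubmx); first by rewrite row_mxKl.
exact: smooth_at_lsubmx.
Qed.

Lemma plot_snd (phi : 'rV[R]_n -> G) (a b : 'rV[R]_n) : plot A phi b ->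
  plot A (fun z : 'rV[R]_(n + n) => phi (rsubmx z)) (row_mx a b).
Proof.
move=> pphi; apply: (@plot_precomp _ _ phi rsubmx); first by rewrite row_mxKr.
exact: smooth_at_rsubmx.
Qed.

Lemma smooth_fun_uncurry f (H : 'rV[R]_n -> 'rV[R]_n -> G) (a b : 'rV[R]_n) p :
  plot A (uncurry_rV H) (row_mx a b) -> H a b = p -> smooth_fun_at A f p ->
  smooth_at ((uncurry_rV (fun w w' => f (H w w'))) : _ -> R^o) (row_mx a b).
Proof.
move=> pH Hp sf; apply: (smooth_fun_comp gA _ pH).
by rewrite /uncurry_rV row_mxKl row_mxKr Hp.
Qed.

(** In the chart of p the derivative is a partial derivative, at the identity, of the smooth
    function (u, w) |-> f (pt w * point A p u). *)
Lemma smooth_Rd x f p : smooth_fun_at A f p -> smooth_fun_at A (Rd x f) p.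
Proof.
move=> sf; pose H u w := (pt w * point A p u)%g; rewrite RdF.
apply: (@smooth_at_snd _ _ _ (fun u w => f (H u w) : R^o)).
apply: (@smooth_fun_uncurry f H _ _ p _ _ sf).
  apply: plot_mul; first exact: plot_snd plot_pt.
  exact: plot_fst (plot_point_center _ gA).
by rewrite /H pt_e mul1g point_center.
Qed.

Lemma smooth_Ld x f p : smooth_fun_at A f p -> smooth_fun_at A (Ld x f) p.
Proof.
move=> sf; pose H u w := (point A p u * pt w)%g; rewrite LdF.
apply: (@smooth_at_snd _ _ _ (fun u w => f (H u w) : R^o)).
apply: (@smooth_fun_uncurry f H _ _ p _ _ sf).
  apply: plot_mul; last exact: plot_snd plot_pt.
  exact: plot_fst (plot_point_center _ gA).
by rewrite /H pt_e mulg1 point_center.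
Qed.

(** Left and right translations commute: both sides are mixed partial derivatives of (w, w') |-> f
    (pt w' * p * pt w). *)
Lemma Ld_Rd x y f p : smooth_fun_at A f p -> Ld x (Rd y f) p = Rd y (Ld x f) p.
Proof.
move=> sf; pose H w w' := (pt w' * (p * pt w))%g.
have sH : smooth_at ((uncurry_rV (fun w w' => f (H w w'))) : _ -> R^o)
    (row_mx e e).
  apply: (@smooth_fun_uncurry f H _ _ p _ _ sf); last by rewrite /H pt_e mulg1 mul1g.
  apply: plot_mul; first exact: plot_snd plot_pt.
  apply: plot_mul; first exact: plot_cst.
  exact: plot_fst plot_pt.
have := mixed_swap x y sH; rewrite !LdF !RdF => ->.
by apply: (congr1 (fun h => 'D_y h e)); apply/funext => w';
   apply: (congr1 (fun h => 'D_x h e)); apply/funext => w; rewrite /H mulgA.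
Qed.

(** * The bracket as the antisymmetrised second-order part of the multiplication *)

Definition mul_chart w w' := coord A 1%g (pt w * pt w')%g.
(** The bilinear term B of the expansion x + y + B(x, y) + ... of the product in the chart of 1,
    taken relative to the coordinates of 1. *)
Definition mu x y := 'D_x (fun w => 'D_y (mul_chart w) e) e.

Lemma plot_mul2 : plot A (uncurry_rV (fun w w' => (pt w * pt w')%g)) (row_mx e e).
Proof. exact: plot_mul (plot_fst _ plot_pt) (plot_snd _ plot_pt). Qed.

Lemma mul2_e : uncurry_rV (fun w w' => (pt w * pt w')%g) (row_mx e e) = 1%g.
Proof. by rewrite /uncurry_rV row_mxKl row_mxKr pt_e mul1g. Qed.

Lemma dom1 : dom A 1%g 1%g. Proof. by have [] := gA 1%g. Qed.

Lemma smooth_mul_chart : smooth_at (uncurry_rV mul_chart) (row_mx e e).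
Proof. by have [_] := plot_mul2; rewrite mul2_e. Qed.

Lemma near_mul2 : \forall z \near row_mx e e,
  dom A 1%g (uncurry_rV (fun w w' => (pt w * pt w')%g) z).
Proof. by have [] := plot_mul2; rewrite mul2_e. Qed.

Lemma near_coord_pt : \forall w \near e, coord A 1%g (pt w) = w.
Proof.
apply: filterS (near_img gA (img_center 1%g gA)) => w iw.
by have [] := imgP gA iw.
Qed.

Lemma near_dom_pt : \forall w \near e, dom A 1%g (pt w).
Proof. by have [] := plot_pt; rewrite pt_e. Qed.

Lemma mul_chart_e : mul_chart e e = e.
Proof. by rewrite /mul_chart pt_e mulg1. Qed.

Lemma derive_mul_chart_l x : 'D_x (mul_chart^~ e) e = x.
Proof.
rewrite -[RHS](derive_id e x); apply: near_eq_derive.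
by apply: filterS near_coord_pt => w Ew; rewrite /mul_chart pt_e mulg1.
Qed.

Lemma derive_mul_chart_r x : 'D_x (mul_chart e) e = x.
Proof.
rewrite -[RHS](derive_id e x); apply: near_eq_derive.
by apply: filterS near_coord_pt => w Ew; rewrite /mul_chart pt_e mul1g.
Qed.

(** Multiplication by 1 on either side is the identity, so the first derivatives of [mul_chart] are
    x and y, and the second-order chain rule leaves the Hessian of F and the term in [mu]. *)
Lemma derive2_mul (F : 'rV[R]_n -> R^o) (f : G -> R) x y :
  smooth_at F e -> (forall w, F w = f (pt w)) ->
  'D_x (fun w => 'D_y ((fun w' => f (pt w * pt w')%g) : _ -> R^o) e) e =
  'D_x (fun z => 'D_y F z) e + 'd F e (mu x y).
Proof.
move=> sF Ff.
have sFm : smooth_at F (mul_chart e e) by rewrite mul_chart_e.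
have := mixed_comp x y smooth_mul_chart sFm.
rewrite derive_mul_chart_l derive_mul_chart_r mul_chart_e => <-.
pose H1 w w' := f (pt w * pt w')%g : R^o.
pose H2 w w' := F (mul_chart w w').
apply: etrans (derive_fst_snd H1 e e x y) _.
apply: etrans _ (esym (derive_fst_snd H2 e e x y)).
apply: near_eq_derive; apply: near_derive.
apply: filterS near_mul2 => z dz; rewrite /uncurry_rV /H1 /H2 Ff /mul_chart.
by have [_ _ ->] := gA 1%g.
Qed.

Lemma TL1 x : TL 1%g x = x.
Proof.
rewrite (_ : (fun z : G => (1 * z)%g) = id); first exact: dmap_id.
by apply/funext => z; rewrite mul1g.
Qed.

Lemma TR1 x : TR 1%g x = x.
Proof.
rewrite (_ : (fun z : G => (z * 1)%g) = id); first exact: dmap_id.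
by apply/funext => z; rewrite mulg1.
Qed.

Lemma derive_mul_chart_TL w y : dom A 1%g (pt w) ->
  'D_y (mul_chart w) e = dcoord A 1%g (pt w) (TL (pt w) y).
Proof.
move=> dw; have E : (pt w * pt e)%g = pt w by rewrite pt_e mulg1.
have dw' : dom A 1%g (pt w * pt e)%g by rewrite E.
have := pdiff_dcoord mA y (plot_lmul (pt w)) dw'.
by rewrite pdiff_lmul E.
Qed.

(** In the chart of 1, the left invariant field of y at pt w is the derivative of [mul_chart] w
    along y; differentiating it along x gives mu x y. *)
Lemma bracketE x y : bracket A x y = mu x y - mu y x.
Proof.
have key u v : 'D_u (fun w => dcoord A 1%g (pt w) (left_field A v (pt w))) e =
    mu u v.
  apply: near_eq_derive; apply: filterS near_dom_pt => w dw.
  by rewrite derive_mul_chart_TL.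
have lf z : left_field A z 1%g = z := TL1 z.
by rewrite -(key x y) -(key y x) /bracket /lie_bracket (lf x) (lf y).
Qed.

Lemma diff_derive_fun x (F : 'rV[R]_n -> R^o) u : smooth_at F u ->
  'd F u x = 'D_x F u.
Proof. by move=> sF; rewrite deriveE //; exact: smooth_at_diff. Qed.

(** The Hessian terms cancel by symmetry and the terms in [mu] antisymmetrise to the bracket. *)
Lemma Ld_bracket x y f p : smooth_fun_at A f p ->
  Ld x (Ld y f) p - Ld y (Ld x f) p = Ld (bracket A x y) f p.
Proof.
move=> sf; pose F w := f (p * pt w)%g : R^o.
have sF : smooth_at F e by apply: smooth_lmul_at.
have key u v : Ld u (Ld v f) p = 'D_u (fun z => 'D_v F z) e + 'd F e (mu u v).
  rewrite !LdF.
  apply: etrans _ (@derive2_mul F (fun q => f (p * q)%g) u v sF (fun=> erefl)).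
  apply: (congr1 (fun h => 'D_u h e)); apply/funext => w.
  apply: (congr1 (fun h => 'D_v h e)); apply/funext => w'.
  by rewrite mulgA.
rewrite (key x y) (key y x) (derive_swap x y sF) opprD addrACA subrr add0r.
by rewrite -linearB -bracketE LdF; exact: diff_derive_fun.
Qed.

(** In f (pt w' * pt w * p) the inner derivation acts on the leftmost factor, so the arguments of
    [mu] come in reverse order; hence the sign. *)
Lemma Rd_bracket x y f p : smooth_fun_at A f p ->
  Rd x (Rd y f) p - Rd y (Rd x f) p = - Rd (bracket A x y) f p.
Proof.
move=> sf; pose F w := f (pt w * p)%g : R^o.
have sF : smooth_at F e by apply: smooth_rmul_at.
have key u v : Rd u (Rd v f) p = 'D_v (fun z => 'D_u F z) e + 'd F e (mu v u).
  rewrite !RdF.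
  apply: etrans _ (@derive2_mul F (fun q => f (q * p)%g) v u sF (fun=> erefl)).
  pose H w w' := (pt w' * (pt w * p))%g.
  have sH : smooth_at ((uncurry_rV (fun w w' => f (H w w'))) : _ -> R^o)
      (row_mx e e).
    apply: (@smooth_fun_uncurry f H _ _ p _ _ sf); last by rewrite /H pt_e !mul1g.
    apply: plot_mul; first exact: plot_snd plot_pt.
    apply: plot_mul; last exact: plot_cst.
    exact: plot_fst plot_pt.
  apply: etrans (mixed_swap u v sH) _.
  apply: (congr1 (fun h => 'D_v h e)); apply/funext => w'.
  apply: (congr1 (fun h => 'D_u h e)); apply/funext => w.
  by rewrite /H mulgA.
rewrite (key x y) (key y x) (derive_swap x y sF) opprD addrACA subrr add0r.
rewrite -linearB -opprB linearN -bracketE RdF.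
exact: (congr1 -%R (diff_derive_fun _ sF)).
Qed.

Lemma mu_DE x y : mu x y =
  'D_(row_mx x 0) (fun z => 'D_(row_mx 0 y) (uncurry_rV mul_chart) z) (row_mx e e).
Proof. exact: derive_fst_snd. Qed.

(** Linearity is visible only in the direction of the outer derivative; exchanging the derivatives
    makes it available in y as well. *)
Lemma mu_DE' x y : mu x y =
  'D_(row_mx 0 y) (fun z => 'D_(row_mx x 0) (uncurry_rV mul_chart) z) (row_mx e e).
Proof. by rewrite mu_DE; exact: (derive_swap_rV _ _ smooth_mul_chart). Qed.

Lemma mu_linear_l y : linear (mu^~ y).
Proof.
move=> c x z; rewrite !mu_DE.
have d := smooth_at_diff (smooth_at_derive (row_mx 0 y) smooth_mul_chart).
rewrite !(deriveE _ d) -linearP; congr ('d _ _ _).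
by rewrite scale_row_mx add_row_mx scaler0 addr0.
Qed.

Lemma mu_linear_r x : linear (mu x).
Proof.
move=> c y z; rewrite !mu_DE'.
have d := smooth_at_diff (smooth_at_derive (row_mx x 0) smooth_mul_chart).
rewrite !(deriveE _ d) -linearP; congr ('d _ _ _).
by rewrite scale_row_mx add_row_mx scaler0 addr0.
Qed.

Lemma bracket_linear_l y : linear (bracket A ^~ y).
Proof.
move=> c x z; rewrite !bracketE.
have /= -> := mu_linear_l y c x z; have /= -> := mu_linear_r y c x z.
move: (mu x y) (mu y x) (mu z y) (mu y z) => a1 a2 a3 a4.
by rewrite scalerBr opprD addrACA.
Qed.

Lemma bracketC x y : bracket A x y = - bracket A y x.
Proof. by rewrite !bracketE opprB. Qed.

Lemma bracket_suml (I : finType) (c : I -> R) (u : I -> 'rV[R]_n) y :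
  bracket A (\sum_i c i *: u i) y = \sum_i c i *: bracket A (u i) y.
Proof.
pose L : {linear 'rV[R]_n -> 'rV[R]_n} := HB.pack (bracket A ^~ y)
  (GRing.isLinear.Build _ _ _ _ _ (bracket_linear_l y)).
rewrite -[LHS]/(L _) linear_sum; apply: eq_bigr => i _; exact: linearZ.
Qed.

Lemma bracket_sumr (I : finType) (c : I -> R) (u : I -> 'rV[R]_n) x :
  bracket A x (\sum_i c i *: u i) = \sum_i c i *: bracket A x (u i).
Proof.
rewrite bracketC bracket_suml -sumrN; apply: eq_bigr => i _.
by rewrite (bracketC x) scalerN.
Qed.

Lemma bracketZl c x y : bracket A (c *: x) y = c *: bracket A x y.
Proof.
pose L : {linear 'rV[R]_n -> 'rV[R]_n} := HB.pack (bracket A ^~ y)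
  (GRing.isLinear.Build _ _ _ _ _ (bracket_linear_l y)).
by rewrite -[LHS]/(L _) linearZ.
Qed.

Lemma bracketZr c x y : bracket A x (c *: y) = c *: bracket A x y.
Proof. by rewrite (bracketC x) bracketZl (bracketC x) scalerN. Qed.

(** * Leibniz rules for invariant derivations *)

Lemma derive_real_M (f g : 'rV[R]_n -> R^o) u x :
  smooth_at f u -> smooth_at g u ->
  'D_x ((fun w => f w * g w) : _ -> R^o) u = f u * 'D_x g u + 'D_x f u * g u.
Proof.
move=> sf sg; rewrite [RHS]addrC [X in X + _]mulrC [RHS]addrC.
exact: (deriveM (smooth_at_derivable sf) (smooth_at_derivable sg)).
Qed.

Lemma RdM x (f g : G -> R) p : smooth_fun_at A f p -> smooth_fun_at A g p ->
  Rd x (fun q => f q * g q) p = f p * Rd x g p + Rd x f p * g p.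
Proof.
move=> /smooth_rmul_at sf /smooth_rmul_at sg.
by have := derive_real_M x sf sg; rewrite pt_e !RdF mul1g.
Qed.

Lemma LdM x (f g : G -> R) p : smooth_fun_at A f p -> smooth_fun_at A g p ->
  Ld x (fun q => f q * g q) p = f p * Ld x g p + Ld x f p * g p.
Proof.
move=> /smooth_lmul_at sf /smooth_lmul_at sg.
by have := derive_real_M x sf sg; rewrite pt_e !LdF mulg1.
Qed.

Lemma Rd_sum (I : finType) x (f : I -> G -> R) p :
  (forall i, smooth_fun_at A (f i) p) ->
  Rd x (fun q => \sum_i f i q) p = \sum_i Rd x (f i) p.
Proof.
move=> sf; rewrite RdF (eq_bigr _ (fun i _ => congr1 (fun h => h p) (RdF x (f i)))).
apply: (@derive_sum_fin _ _ R^o I (fun i w => f i (pt w * p)%g)) => i.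
exact: smooth_at_derivable (smooth_rmul_at (sf i)).
Qed.

Lemma Ld_sum (I : finType) x (f : I -> G -> R) p :
  (forall i, smooth_fun_at A (f i) p) ->
  Ld x (fun q => \sum_i f i q) p = \sum_i Ld x (f i) p.
Proof.
move=> sf; rewrite LdF (eq_bigr _ (fun i _ => congr1 (fun h => h p) (LdF x (f i)))).
apply: (@derive_sum_fin _ _ R^o I (fun i w => f i (p * pt w)%g)) => i.
exact: smooth_at_derivable (smooth_lmul_at (sf i)).
Qed.

Lemma smooth_funM (f g : G -> R) p : smooth_fun_at A f p ->
  smooth_fun_at A g p -> smooth_fun_at A (fun q => f q * g q) p.
Proof. exact: smooth_atM. Qed.

Lemma smooth_funD (f g : G -> R) p : smooth_fun_at A f p ->
  smooth_fun_at A g p -> smooth_fun_at A (fun q => f q + g q) p.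
Proof. exact: smooth_atD. Qed.

Lemma smooth_fun_cst (c : R) p : smooth_fun_at A (fun=> c) p.
Proof. exact: smooth_at_cst. Qed.

Lemma RdD x (f g : G -> R) p : smooth_fun_at A f p -> smooth_fun_at A g p ->
  Rd x (fun q => f q + g q) p = Rd x f p + Rd x g p.
Proof.
move=> /smooth_rmul_at sf /smooth_rmul_at sg; rewrite !RdF.
exact: (deriveD (smooth_at_derivable sf) (smooth_at_derivable sg)).
Qed.

Lemma LdD x (f g : G -> R) p : smooth_fun_at A f p -> smooth_fun_at A g p ->
  Ld x (fun q => f q + g q) p = Ld x f p + Ld x g p.
Proof.
move=> /smooth_lmul_at sf /smooth_lmul_at sg; rewrite !LdF.
exact: (deriveD (smooth_at_derivable sf) (smooth_at_derivable sg)).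
Qed.

Lemma smooth_fun_sum (I : finType) (f : I -> G -> R) p :
  (forall i, smooth_fun_at A (f i) p) ->
  smooth_fun_at A (fun q => \sum_i f i q) p.
Proof. exact: (@smooth_at_sum _ _ R^o). Qed.

Lemma Rd_cst x (c : R) p : Rd x (fun=> c) p = 0.
Proof. by rewrite RdF; exact: derive_cst. Qed.

Lemma Ld_cst x (c : R) p : Ld x (fun=> c) p = 0.
Proof. by rewrite LdF; exact: derive_cst. Qed.

Lemma RdZ x c (f : G -> R) p : smooth_fun_at A f p ->
  Rd x (fun q => c * f q) p = c * Rd x f p.
Proof.
by move=> sf; rewrite (RdM _ (smooth_fun_cst c p) sf) Rd_cst mul0r addr0.
Qed.

Lemma LdZ x c (f : G -> R) p : smooth_fun_at A f p ->
  Ld x (fun q => c * f q) p = c * Ld x f p.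
Proof.
by move=> sf; rewrite (LdM _ (smooth_fun_cst c p) sf) Ld_cst mul0r addr0.
Qed.

Lemma Rd_lin x f p : smooth_fun_at A f p ->
  Rd x f p = \sum_i x ord0 i * Rd (delta_mx ord0 i) f p.
Proof.
move=> sf; rewrite RdE // {1}(row_sum_delta x) !linear_sum.
by apply: eq_bigr => i _; rewrite !linearZ RdE.
Qed.

(** * The adjoint action and its derivative *)

Lemma conj_e p : (p * 1 * p^-1)%g = 1%g :> G.
Proof. by rewrite mulg1 mulgV. Qed.

Lemma TL_Ad p x : TL p x = TR p (Ad A p x).
Proof.
have := dmap_comp 1%g x gA gA (smooth_rmul p) (smooth_conj p).
rewrite conj_e => E; apply: etrans _ E.
by apply: dmap_ext => z /=; rewrite mulgVK.
Qed.

Lemma Ld_Ad x f p : smooth_fun_at A f p -> Ld x f p = Rd (Ad A p x) f p.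
Proof. move=> sf; apply: etrans (LdE x sf) (etrans _ (esym (RdE _ sf))).
exact: (congr1 (fun v : 'rV[R]_n => dfun A f p v) (TL_Ad p x)). Qed.

Lemma Ad1 x : Ad A 1%g x = x.
Proof.
rewrite /Ad (_ : (fun z : G => (1 * z * 1^-1)%g) = id); first exact: dmap_id.
by apply/funext => z; rewrite mul1g invg1 mulg1.
Qed.

Lemma AdM p q x : Ad A (p * q)%g x = Ad A p (Ad A q x).
Proof.
have := dmap_comp 1%g x gA gA (smooth_conj p) (smooth_conj q).
rewrite conj_e => E; apply: etrans _ E.
apply: dmap_ext => z /=.
by rewrite invgM !mulgA.
Qed.

Lemma AdVK p x : Ad A p (Ad A p^-1%g x) = x.
Proof. by rewrite -AdM mulgV Ad1. Qed.

(** An entry of Ad_q y is a partial derivative at the identity of the conjugation (q, z) |-> q z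
    q^-1 in coordinates. *)
Lemma smooth_fun_Ad y i p : smooth_fun_at A (fun q => Ad A q y ord0 i) p.
Proof.
pose H u w := (point A p u * pt w * (point A p u)^-1)%g.
have pH : plot A (uncurry_rV H) (row_mx (coord A p p) e).
  apply: plot_mul.
    exact: plot_mul (plot_fst _ (plot_point_center p gA)) (plot_snd _ plot_pt).
  exact: plot_inv (plot_fst _ (plot_point_center p gA)).
have H1 : uncurry_rV H (row_mx (coord A p p) e) = 1%g.
  by rewrite /uncurry_rV row_mxKl row_mxKr /H pt_e mulg1 mulgV.
have [_ ] := pH; rewrite H1 => sH.
have sK := @smooth_at_snd _ _ _ (fun u w => coord A 1%g (H u w) ord0 i : R^o)
  _ _ y (smooth_at_coord i sH).
suff E : (fun q => Ad A q y ord0 i) \o point A p =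
    (fun u => 'D_y ((fun w => coord A 1%g (H u w) ord0 i) : _ -> R^o) e).
  by rewrite /smooth_fun_at E.
apply/funext => u; rewrite /= /Ad (dmapE gA 1%g y (smooth_conj _)).
have plH : plot A (H u) e.
  exact: plot_mul (plot_mul (plot_cst _ _ gA) plot_pt) (plot_cst _ _ gA).
have Hu1 : H u e = 1%g by rewrite /H pt_e mulg1 mulgV.
have [_ sHu] := plH; rewrite Hu1 in sHu.
have EE : pdiff A (H u) e y = 'D_y (fun w => coord A 1%g (H u w)) e.
  by rewrite /pdiff Hu1.
exact: etrans (congr1 (fun v : 'rV[R]_n => v ord0 i) EE) (derive_coord y i sHu).
Qed.

Lemma near_Rd x f g p :
  (\forall w \near e, f (pt w * p)%g = g (pt w * p)%g) -> Rd x f p = Rd x g p.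
Proof. by rewrite !RdF; exact: near_eq_derive. Qed.

Lemma near_Ld x f g p :
  (\forall w \near e, f (p * pt w)%g = g (p * pt w)%g) -> Ld x f p = Ld x g p.
Proof. by rewrite !LdF; exact: near_eq_derive. Qed.

Lemma Ld1 x f : Ld x f 1%g = Rd x f 1%g.
Proof.
rewrite RdF LdF; apply: (congr1 (fun h => 'D_x h e)); apply/funext => w.
by rewrite mul1g mulg1.
Qed.

(** Test functions that detect tangent vectors at 1. They are smooth only on the chart of 1, so
    identities using them are needed near 1 only. *)
Definition chart_fun (a : covec R n) : G -> R := fun q => a (coord A 1%g q).

Lemma smooth_chart_fun a p : dom A 1%g p -> smooth_fun_at A (chart_fun a) p.
Proof. exact: smooth_fun_coord. Qed.

Lemma dcoord1 x : dcoord A 1%g 1%g x = x.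
Proof.
have d1 : dom A 1%g (pt e) by rewrite pt_e; exact: dom1.
have E := pdiff_dcoord mA x plot_pt d1.
rewrite (pdiff_point_center 1%g x gA) pt_e in E; apply: etrans (esym E) _.
rewrite -[RHS](derive_id e x); apply: near_eq_derive.
exact: near_coord_pt.
Qed.

Lemma Rd_chart_fun a x : Rd x (chart_fun a) 1%g = a x.
Proof.
apply: etrans (RdE _ (smooth_chart_fun a dom1)) _.
apply: etrans (dfun_coord mA a _ dom1) _.
by apply: (congr1 (fun v : 'rV[R]_n => a v)); rewrite dcoord1 TR1.
Qed.

Lemma covec_eq (u v : 'rV[R]_n) : (forall a : covec R n, a u = a v) -> u = v.
Proof.
move=> H; apply/rowP => i; have := H (linfun (@rv_coord R n i)).
by rewrite !lfunE.
Qed.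

Lemma smooth_fun_hom (theta : G -> G) f p : smooth_map A A theta ->
  smooth_fun_at A f (theta p) -> smooth_fun_at A (f \o theta) p.
Proof.
move=> /(smooth_mapP gA)/(_ p) pt sf.
apply: (smooth_fun_comp gA _ pt); rewrite /= point_center //.
Qed.

(** * Smooth homomorphisms *)

Section Hom.
Variable theta : G -> G.
Hypothesis smooth_theta : smooth_map A A theta.
Hypothesis thetaM : forall g h, theta (g * h)%g = (theta g * theta h)%g.
Local Notation dtheta := (dmap A A theta 1%g).

Lemma hom1 : theta 1%g = 1%g.
Proof.
by apply: (@mulgI _ (theta 1%g)); rewrite -thetaM !mulg1.
Qed.

Lemma homV g : theta g^-1%g = (theta g)^-1%g.
Proof. by apply: (@mulgI _ (theta g)); rewrite -thetaM !mulgV hom1. Qed.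

Lemma dfun_hom f p v : smooth_fun_at A f (theta p) ->
  dfun A (f \o theta) p v = dfun A f (theta p) (dmap A A theta p v).
Proof.
move=> sf; have sft := smooth_fun_hom smooth_theta sf.
have pp := plot_point_center p gA.
have pth := (smooth_mapP gA theta).1 smooth_theta p.
have sf1 : smooth_fun_at A f ((theta \o point A p) (coord A p p)).
  by rewrite /= point_center.
have E1 := derive_fun_comp gA v sf1 pth.
rewrite /= (point_center p gA) -(dmapE gA p v smooth_theta) in E1.
have sft1 : smooth_fun_at A (f \o theta) (point A p (coord A p p)).
  by rewrite point_center.
have E2 := derive_fun_comp gA v sft1 pp.
rewrite (point_center p gA) (pdiff_point_center p v gA) in E2.
exact: etrans (esym E2) E1.
Qed.

Lemma TL_hom x p :
  dmap A A theta p (TL p x) = TL (theta p) (dtheta x).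
Proof.
have E1 := dmap_comp 1%g x gA gA (smooth_lmul (theta p)) smooth_theta.
rewrite hom1 in E1.
have E2 := dmap_comp 1%g x gA gA smooth_theta (smooth_lmul p).
rewrite mulg1 in E2.
apply: etrans (esym E2) (etrans _ E1).
apply: dmap_ext => z.
by rewrite /= thetaM.
Qed.

Lemma Ld_hom x f p : smooth_fun_at A f (theta p) ->
  Ld x (f \o theta) p = Ld (dtheta x) f (theta p).
Proof.
move=> sf; have sft := smooth_fun_hom smooth_theta sf.
apply: etrans (LdE _ sft) (etrans _ (esym (LdE _ sf))).
apply: etrans (dfun_hom _ sf) _.
exact: (congr1 (fun v : 'rV[R]_n => dfun A f (theta p) v) (TL_hom x p)).
Qed.

(** Tested on [chart_fun]: the bracket is a commutator of left derivations, and theta carries the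
    left derivation along x to the one along its differential at x. *)
Lemma bracket_hom x y :
  dtheta (bracket A x y) = bracket A (dtheta x) (dtheta y).
Proof.
apply: covec_eq => a.
pose u := dtheta (bracket A x y); pose v := bracket A (dtheta x) (dtheta y).
apply: etrans (esym (Rd_chart_fun a u)) (etrans _ (Rd_chart_fun a v)).
apply: etrans (esym (Ld1 u (chart_fun a))) (etrans _ (Ld1 v (chart_fun a))).
rewrite {}/u {}/v.
have s1 : smooth_fun_at A (chart_fun a) 1%g by apply: smooth_chart_fun; exact: dom1.
have s1' : smooth_fun_at A (chart_fun a) (theta 1%g) by rewrite hom1.
apply: etrans _ (Ld_bracket (dtheta x) (dtheta y) s1).
have := Ld_hom (bracket A x y) s1'; rewrite hom1 => E; apply: etrans (esym E) _.
have st := smooth_fun_hom smooth_theta s1'.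
apply: etrans (esym (Ld_bracket x y st)) _.
suff key u v : Ld u (Ld v (chart_fun a \o theta)) 1%g =
    Ld (dtheta u) (Ld (dtheta v) (chart_fun a)) 1%g by rewrite (key x y) (key y x).
have s2 : smooth_fun_at A (Ld (dtheta v) (chart_fun a)) (theta 1%g).
  exact: smooth_Ld.
have := Ld_hom u s2; rewrite hom1 => E'; apply: etrans _ E'.
(* The inner derivation is compared only at points that theta sends into the chart of 1, where the
   test function is smooth. *)
apply: near_Ld.
have [] := (smooth_mapP gA theta).1 smooth_theta 1%g.
rewrite /= pt_e hom1 => dn _; apply: filterS dn => w dw.
by rewrite mul1g /= Ld_hom //; exact: smooth_chart_fun.
Qed.

End Hom.

(* Compare [Rd x (Ld y f)] and [Ld y (Rd x f)], writing
   [Ld y f q = Rd (Ad q y) f q]. *)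
Lemma Rd_Ad x y i : Rd x (fun q => Ad A q y ord0 i) 1%g = bracket A x y ord0 i.
Proof.
have [a aE] : exists a : covec R n, forall u, a u = u ord0 i.
  by exists (linfun (@rv_coord R n i)) => u; rewrite lfunE.
pose f := chart_fun a.
have s1 : smooth_fun_at A f 1%g by apply: smooth_chart_fun; exact: dom1.
have sR j : smooth_fun_at A (Rd (delta_mx ord0 j) f) 1%g by exact: smooth_Rd.
have sAd j : smooth_fun_at A (fun q => Ad A q y ord0 j) 1%g.
  exact: smooth_fun_Ad.
have E1 : Rd x (Ld y f) 1%g = \sum_j (y ord0 j *
    Rd x (Rd (delta_mx ord0 j) f) 1%g + Rd x (fun q => Ad A q y ord0 j) 1%g *
    a (delta_mx ord0 j)).
  have -> : Rd x (Ld y f) 1%g =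
      Rd x (fun q => \sum_j Ad A q y ord0 j * Rd (delta_mx ord0 j) f q) 1%g.
    apply: near_Rd; apply: filterS near_dom_pt => w dw; rewrite mulg1.
    have sw := smooth_chart_fun a dw; rewrite Ld_Ad // Rd_lin //.
  rewrite Rd_sum; last by move=> j; apply: smooth_funM.
  apply: eq_bigr => j _; rewrite (RdM _ (sAd j) (sR j)).
  by move: (Rd x _ _) (Rd x _ _) => c1 c2; rewrite (Ad1 y) (Rd_chart_fun a _).
have E2 : Rd x (Rd y f) 1%g =
    \sum_j y ord0 j * Rd x (Rd (delta_mx ord0 j) f) 1%g.
  have -> : Rd x (Rd y f) 1%g =
      Rd x (fun q => \sum_j y ord0 j * Rd (delta_mx ord0 j) f q) 1%g.
    apply: near_Rd; apply: filterS near_dom_pt => w dw; rewrite mulg1.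
    by have sw := smooth_chart_fun a dw; rewrite Rd_lin.
  rewrite Rd_sum; last by move=> j; apply: smooth_funM => //; exact: smooth_fun_cst.
  by apply: eq_bigr => j _; rewrite (RdZ _ _ (sR j)).
have E3 := Rd_bracket x y s1; rewrite (Rd_chart_fun a (bracket A x y)) aE in E3.
(* At 1 left and right derivations agree, so [R_x, L_y] = 0 equates R_y R_x f with R_x R_y f plus
   the derivative of the entry of Ad. *)
have := Ld_Rd y x s1; rewrite (Ld1 y (Rd x f)) E1 big_split /= -E2 => E4.
have E5 (c : 'I_n -> R) : \sum_j c j * a (delta_mx ord0 j) = c i.
  have ad j : a (delta_mx ord0 j) = (i == j)%:R by rewrite aE mxE eqxx.
  rewrite (eq_bigr (fun j => c j * (i == j)%:R)) => [|j _]; last by rewrite ad.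
  rewrite (bigD1 i) //= eqxx mulr1 big1 ?addr0 // => j ji.
  by rewrite eq_sym (negbTE ji) mulr0.
rewrite (E5 (fun j => Rd x (fun q => Ad A q y ord0 j) 1%g)) in E4.
by move: E3 E4; move: (Rd x _ _) (Rd y _ _) (Rd x _ _) => c1 c2 c3; lra.
Qed.

End LieGroup.

(** * Cyclic sums of iterated brackets *)

Section JacobiSum.
Context {R : realFieldType} {I : finType}.

(* {F, h} for F = {f, g}, expanded by the Leibniz rule; fR, fL are first and
   fLL, fRR, fM second derivatives of f, where fM j i = L_j R_i f = R_i L_j f *)
Definition nested (fR fL gR gL hR hL : I -> R) (fLL fRR fM gLL gRR gM : I -> I -> R)
    (j i : I) : R :=
  hR j * (gM j i * fL i + gR i * fLL j i - (fM j i * gL i + fR i * gLL j i))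
  - (gRR j i * fL i + gR i * fM i j - (fRR j i * gL i + fR i * gM i j)) * hL j.

Lemma sum_antisym (Y : I -> I -> R) : \sum_j \sum_i (Y j i - Y i j) = 0.
Proof.
under eq_bigr do rewrite sumrB.
by rewrite sumrB [X in _ - X]exchange_big subrr.
Qed.

(** Summand by summand the two sides differ by Z j i - Z i j, whose double sum vanishes; no symmetry
    of the second derivatives enters. *)
Lemma nested_cyclic (fR fL gR gL hR hL : I -> R)
    (fLL fRR fM gLL gRR gM hLL hRR hM : I -> I -> R) :
  \sum_j \sum_i nested fR fL gR gL hR hL fLL fRR fM gLL gRR gM j i
  + \sum_j \sum_i nested gR gL hR hL fR fL gLL gRR gM hLL hRR hM j i
  + \sum_j \sum_i nested hR hL fR fL gR gL hLL hRR hM fLL fRR fM j i =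
  \sum_j \sum_i ((fLL j i - fLL i j) * (gR i * hR j)
                 + (fRR j i - fRR i j) * (gL i * hL j))
  + \sum_j \sum_i ((gLL j i - gLL i j) * (hR i * fR j)
                 + (gRR j i - gRR i j) * (hL i * fL j))
  + \sum_j \sum_i ((hLL j i - hLL i j) * (fR i * gR j)
                 + (hRR j i - hRR i j) * (fL i * gL j)).
Proof.
(* The share of the discrepancy that involves second derivatives of f; the cyclic permutations give
   those of g and h. *)
pose Y (fLL fRR fM : I -> I -> R) (gR gL hR hL : I -> R) j i :=
  gR j * hL i * fM j i - fLL j i * gR j * hR i - fRR j i * gL j * hL i
  - hR j * gL i * fM j i.
pose Z j i := Y fLL fRR fM gR gL hR hL j i + Y gLL gRR gM hR hL fR fL j i
  + Y hLL hRR hM fR fL gR gL j i.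
have S (F H : I -> R) : \sum_i F i + \sum_i H i = \sum_i (F i + H i).
  by rewrite big_split.
rewrite -[RHS]addr0 -[X in _ = _ + X](sum_antisym Z) !S; apply: eq_bigr => j _.
rewrite /= !S; apply: eq_bigr => i _.
rewrite /Z /Y /nested /=; ring.
Qed.

End JacobiSum.

(** * Images of 2-tensors and the invariant form *)

Section Push.
Context {R : realType}.

(** [linfun] evaluates to the given function when that function is linear; linearity is bundled
    here, as later for [g_plus] and [r_d]. *)
Lemma pushE n k (T : 'Hom('rV[R]_n, 'rV[R]_k)) (P : bivec R n) b :
  push T P b = T (P (b \o T)%VF).
Proof.
have lin : linear (fun b : covec R k => T (P (b \o T)%VF)).
  by move=> c x y; rewrite -!linearP; congr (T (P _)); rewrite comp_lfunDl comp_lfunZl.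
pose L : {linear covec R k -> 'rV[R]_k} :=
  HB.pack (fun b : covec R k => T (P (b \o T)%VF))
    (GRing.isLinear.Build _ _ _ _ _ lin).
exact: (lfunE L).
Qed.

Lemma push_comp n k l (S : 'Hom('rV[R]_k, 'rV[R]_l)) (T : 'Hom('rV[R]_n, 'rV[R]_k))
  (P : bivec R n) : push S (push T P) = push (S \o T)%VF P.
Proof. by apply/lfunP => b; rewrite !pushE comp_lfunE comp_lfunA. Qed.

Lemma push0 n k (T : 'Hom('rV[R]_n, 'rV[R]_k)) : push T 0 = 0.
Proof. by apply/lfunP => b; rewrite pushE !lfunE linear0. Qed.

Lemma pushB n k (T : 'Hom('rV[R]_n, 'rV[R]_k)) P Q :
  push T (P - Q) = push T P - push T Q.
Proof.
by apply/lfunP => b; rewrite add_lfunE opp_lfunE !pushE add_lfunE opp_lfunE linearB.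
Qed.

Lemma skew_push n k (T : 'Hom('rV[R]_n, 'rV[R]_k)) P : skew P -> skew (push T P).
Proof.
move=> sP a b; rewrite !pushE; have := sP (a \o T)%VF (b \o T)%VF.
by rewrite !comp_lfunE.
Qed.

End Push.

(** * The isomorphism given by a non-degenerate form *)

Section Form.
Context {R : realType} {n : nat} (K : 'Hom('rV[R]_n, covec R n)).
Hypothesis K_sym : forall x y, K x y = K y x.
Hypothesis K_nondegenerate : forall x, (forall y, K x y = 0) -> x = 0.
Local Notation kap := (K^-1)%VF.

Lemma K_ker : lker K = 0%VS.
Proof.
apply/eqP; rewrite -subv0; apply/subvP => x; rewrite memv_ker memv0 => /eqP Kx.
by apply/eqP; apply: K_nondegenerate => y; rewrite Kx lfunE.
Qed.

Lemma kapK x : kap (K x) = x.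
Proof. by apply: lker0_lfunK; rewrite K_ker. Qed.

(** K is injective and the dual space has dimension n, so K is onto, and the inverse in 'Hom is
    two-sided. *)
Lemma Kkap a : K (kap a) = a.
Proof.
apply: limg_lfunVK; suff -> : limg K = fullv by exact: memvf.
have := limg_ker_dim K fullv; rewrite K_ker capv0 dimv0 add0n => E.
apply/eqP; rewrite eqEdim subvf E !dimvf.
have -> : dim (covec R n) = (dim 'rV[R]_n * dim R^o)%N by [].
by rewrite (_ : dim R^o = 1%N) // muln1 leqnn.
Qed.

Lemma formE x y : K x y =
  \sum_i \sum_j x ord0 i * y ord0 j * K (delta_mx ord0 i) (delta_mx ord0 j).
Proof.
rewrite {1}(row_sum_delta x) linear_sum sum_lfunE; apply: eq_bigr => i _.
rewrite linearZ scale_lfunE {1}(row_sum_delta y) linear_sum scaler_sumr.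
by apply: eq_bigr => j _; rewrite linearZ scalerA.
Qed.

End Form.

HB.lock Definition form3 {R : realType} {n : nat} {G : groupType}
    (A : atlas R n G) (K : 'Hom('rV[R]_n, covec R n)) (x y z : 'rV[R]_n) : R :=
  K (bracket A x y) z.

(** * Infinitesimal invariance and the Cartan trilinear form *)

Section InvariantForm.
Context {R : realType} {n : nat} {G : topGroupType} (A : atlas R n G).
Hypothesis G_lie : is_lie_group A.
Variable K : 'Hom('rV[R]_n, covec R n).
Hypothesis K_sym : forall x y, K x y = K y x.
Hypothesis K_invariant : forall g x y, K (Ad A g x) (Ad A g y) = K x y.

(** The function q |-> K (Ad_q y) (Ad_q z) is constant; its right derivative at 1 along x, expanded
    in the entries of Ad, is the left-hand side. *)
Lemma K_ad x y z : K (bracket A x y) z + K y (bracket A x z) = 0.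
Proof.
pose k i j := K (delta_mx ord0 i) (delta_mx ord0 j).
pose F i j q := Ad A q y ord0 i * Ad A q z ord0 j.
have sAd u i := smooth_fun_Ad G_lie u i 1%g.
have sF i j : smooth_fun_at A (F i j) 1%g by apply: smooth_funM.
have sFk i j : smooth_fun_at A (fun q => k i j * F i j q) 1%g.
  by apply: smooth_funM; first exact: smooth_fun_cst.
have D0 : right_deriv A x (fun q => \sum_i \sum_j k i j * F i j q) 1%g = 0.
  apply: etrans (Rd_cst (A := A) x (K y z) 1%g); congr (right_deriv A x _ 1%g).
  apply/funext => q; rewrite -[RHS](K_invariant q y z) [RHS]formE.
  by apply: eq_bigr => i _; apply: eq_bigr => j _; rewrite mulrC.
apply: etrans D0; rewrite (Rd_sum G_lie); last first.
  by move=> i; apply: smooth_fun_sum => j; exact: sFk.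
rewrite (formE K (bracket A x y)) (formE K y) -big_split; apply: eq_bigr => i _ /=.
rewrite (Rd_sum G_lie); last by move=> j; exact: sFk.
rewrite -big_split; apply: eq_bigr => j _ /=.
rewrite (RdZ G_lie _ _ (sF i j)) (RdM G_lie _ (sAd y i) (sAd z j)).
rewrite !(Rd_Ad G_lie) (Ad1 G_lie y) (Ad1 G_lie z).
rewrite /k; ring.
Qed.

Local Notation form3 := (form3 A K).

Lemma form3_swap12 x y z : form3 x y z = - form3 y x z.
Proof. by rewrite !form3.unlock (bracketC G_lie) linearN opp_lfunE. Qed.

Lemma form3_swap23 x y z : form3 x y z = - form3 x z y.
Proof.
rewrite !form3.unlock; have E := K_ad x y z; have E2 := K_sym (bracket A x z) y.
apply: etrans (elimT eqP (etrans (esym (addr_eq0 _ _)) (introT eqP E))) _.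
exact: esym (congr1 -%R E2).
Qed.

Lemma form3_swap13 x y z : form3 x y z = - form3 z y x.
Proof.
by rewrite (form3_swap12 x y z) (form3_swap23 y x z) opprK (form3_swap12 y z x).
Qed.

Lemma form3Bl x x' y z : form3 (x - x') y z = form3 x y z - form3 x' y z.
Proof.
have E : bracket A (x - x') y = bracket A x y - bracket A x' y.
  have /= := bracket_linear_l G_lie y (-1) x' x.
  by rewrite !scaleN1r [- x' + x]addrC [X in _ = X]addrC.
by rewrite !form3.unlock E linearB add_lfunE opp_lfunE.
Qed.

Lemma form3Bm x y y' z : form3 x (y - y') z = form3 x y z - form3 x y' z.
Proof.
rewrite (form3_swap12 x (y - y') z) form3Bl opprB.
by rewrite (form3_swap12 x y z) (form3_swap12 x y' z) opprK addrC.
Qed.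

Lemma form3Br x y z z' : form3 x y (z - z') = form3 x y z - form3 x y z'.
Proof. by rewrite !form3.unlock linearB. Qed.

(** Of the eight terms on the right, the two pure ones cancel by hypothesis; the six mixed ones are
    those on the left, reordered by alternation. *)
Lemma form3_alternating u v w u' v' w' :
  form3 u' v' w' = form3 u v w ->
  (form3 w v u' - form3 w' v' u) + (form3 u w v' - form3 u' w' v)
  + (form3 v u w' - form3 v' u' w) = form3 (u - u') (v - v') (w - w').
Proof.
move=> E; rewrite !(form3Bl, form3Bm, form3Br).
rewrite (form3_swap13 w v u') (form3_swap13 w' v' u).
rewrite (form3_swap23 u w v') (form3_swap23 u' w' v).
rewrite (form3_swap12 v u w') (form3_swap12 v' u' w) E; ring.
Qed.

End InvariantForm.

(** * The bivector field on G *)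

HB.lock Definition rcovec {R : realType} {n : nat} {G : groupType}
    (A : atlas R n G) (p : G) (f : G -> R) : covec R n :=
  (dfun A f p \o dmap A A (fun z : G => (z * p)%g) 1%g)%VF.

HB.lock Definition twist {R : realType} {n : nat} {G : groupType}
    (A : atlas R n G) (sigma : G -> G) (p : G) : 'Hom('rV[R]_n, 'rV[R]_n) :=
  (Ad A p \o dsigma A sigma)%VF.

(** The inverse of [twist], and its adjoint for K. As sigma intertwines Ad, it is also
    Ad_{sigma(p)^-1} \o sigma, the form found in the formula for P_S. *)
HB.lock Definition twistV {R : realType} {n : nat} {G : groupType}
    (A : atlas R n G) (sigma : G -> G) (p : G) : 'Hom('rV[R]_n, 'rV[R]_n) :=
  (dsigma A sigma \o Ad A p^-1%g)%VF.

Section Bivector.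
Context {R : realType} {n : nat} {G : topGroupType} (A : atlas R n G).
Variables (K : 'Hom('rV[R]_n, covec R n)) (sigma : G -> G).
Hypothesis G_lie : is_lie_group A.
Hypothesis K_sym : forall x y, K x y = K y x.
Hypothesis K_nondegenerate : forall x, (forall y, K x y = 0) -> x = 0.
Hypothesis K_invariant : forall g x y, K (Ad A g x) (Ad A g y) = K x y.
Hypothesis sigma_morphism : forall g h, sigma (g * h)%g = (sigma g * sigma h)%g.
Hypothesis sigma_smooth : smooth_map A A sigma.
Hypothesis sigma_involutive : forall g, sigma (sigma g) = g.
Hypothesis sigma_orthogonal : forall x y,
  K (dsigma A sigma x) (dsigma A sigma y) = K x y.
Let gA := lie_charts G_lie.
Implicit Types (x y : 'rV[R]_n) (p : G) (a b : covec R n).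

Local Notation kap := (K^-1)%VF.
Local Notation sg := (dsigma A sigma).
Local Notation Rd := (right_deriv A).
Local Notation Ld := (left_deriv A).
Local Notation TR p := (dmap A A (fun z : G => (z * p)%g) 1%g).
Local Notation TL p := (dmap A A (fun z : G => (p * z)%g) 1%g).

Lemma sgK x : sg (sg x) = x.
Proof.
have := dmap_comp 1%g x gA gA sigma_smooth sigma_smooth.
rewrite (hom1 sigma_morphism) => E; apply: etrans (esym E) _.
by apply: etrans (dmap_id 1%g x gA); apply: dmap_ext => z /=.
Qed.

Lemma sg_Ad p x : sg (Ad A p x) = Ad A (sigma p) (sg x).
Proof.
have E1 := dmap_comp 1%g x gA gA sigma_smooth (smooth_conj G_lie p).
have E2 := dmap_comp 1%g x gA gA (smooth_conj G_lie (sigma p)) sigma_smooth.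
rewrite conj_e in E1; rewrite (hom1 sigma_morphism) in E2.
apply: etrans (esym E1) (etrans _ E2); apply: dmap_ext => z /=.
by rewrite !sigma_morphism (homV sigma_morphism).
Qed.

Local Notation tau := (twist A sigma).
Local Notation tauV := (twistV A sigma).

Lemma tauE p x : tau p x = Ad A p (sg x).
Proof. by rewrite twist.unlock comp_lfunE. Qed.

Lemma tauVE p x : tauV p x = sg (Ad A p^-1%g x).
Proof. by rewrite twistV.unlock comp_lfunE. Qed.

Lemma tauVE' p x : tauV p x = Ad A (sigma p)^-1%g (sg x).
Proof.
apply: etrans (tauVE p x) _; rewrite -(homV sigma_morphism).
exact: sg_Ad.
Qed.

Lemma tauVK p x : tau p (tauV p x) = x.
Proof.
have E1 := tauE p (tauV p x).
have E2 := congr1 (fun y : 'rV[R]_n => Ad A p (sg y)) (tauVE p x).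
have E3 := congr1 (fun y : 'rV[R]_n => Ad A p y) (sgK (Ad A p^-1%g x)).
exact: etrans E1 (etrans E2 (etrans E3 (AdVK G_lie p x))).
Qed.

Lemma K_tau p x y : K (tau p x) (tau p y) = K x y.
Proof.
have E1 := congr2 (fun u v : 'rV[R]_n => K u v) (tauE p x) (tauE p y).
exact: etrans E1 (etrans (K_invariant p (sg x) (sg y)) (sigma_orthogonal x y)).
Qed.

Lemma K_tauV p x y : K x (tauV p y) = K (tau p x) y.
Proof. by rewrite -(K_tau p x) tauVK. Qed.

Lemma bracket_tau p x y : tau p (bracket A x y) = bracket A (tau p x) (tau p y).
Proof.
have cM g h : (p * (g * h) * p^-1 = (p * g * p^-1) * (p * h * p^-1))%g.
  by rewrite !mulgA mulgVK.
have E1 := bracket_hom G_lie sigma_smooth sigma_morphism x y.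
have E2 := bracket_hom G_lie (smooth_conj G_lie p) cM (sg x) (sg y).
have E3 := congr1 (fun u : 'rV[R]_n => Ad A p u) E1.
rewrite !tauE; exact: etrans E3 E2.
Qed.

Definition P_triv p : bivec R n :=
  (2^-1 *: ((Ad A (sigma p)^-1%g - Ad A p) \o sg \o kap))%VF.

Definition P_G p : bivec R n := push (TR p) (P_triv p).

Lemma P_trivE p a : P_triv p a = 2^-1 *: (tauV p (kap a) - tau p (kap a)).
Proof.
rewrite /P_triv scale_lfunE !comp_lfunE add_lfunE opp_lfunE.
have E1 := tauVE' p (kap a); have E2 := tauE p (kap a).
exact: esym (congr2 (fun u v : 'rV[R]_n => 2^-1 *: (u - v)) E1 E2).
Qed.

Lemma covec_tauV p a b : b (tauV p (kap a)) = a (tau p (kap b)).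
Proof.
have := K_tauV p (kap b) (kap a).
by rewrite Kkap // => ->; rewrite K_sym Kkap.
Qed.

(** The adjoint relation between [twist] and [twistV] rewrites both terms with [twist] alone, which
    makes skew-symmetry visible. *)
Lemma P_triv_pair p a b :
  b (P_triv p a) = 2^-1 * (a (tau p (kap b)) - b (tau p (kap a))).
Proof. by rewrite P_trivE linearZ linearB /= covec_tauV. Qed.

Lemma skew_P_triv p : skew (P_triv p).
Proof. by move=> a b; rewrite !P_triv_pair -mulrN opprB. Qed.

Definition eps (i : 'I_n) : covec R n := linfun (@rv_coord R n i).

Lemma epsE i x : eps i x = x ord0 i. Proof. by rewrite lfunE. Qed.

Lemma covec_sum a : a = \sum_i (a (delta_mx ord0 i) : R) *: eps i.
Proof.
apply/lfunP => x; rewrite sum_lfunE {1}(row_sum_delta x) linear_sum.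
apply: eq_bigr => i _.
by rewrite linearZ scale_lfunE epsE [RHS]mulrC.
Qed.

Lemma kap_sum a : kap a = \sum_i (a (delta_mx ord0 i) : R) *: kap (eps i).
Proof.
by rewrite {1}(covec_sum a) linear_sum; apply: eq_bigr => i _; rewrite linearZ.
Qed.

(** sigma e^i, where e^i is the K-dual of the standard basis. *)
Definition dual_basis i := sg (kap (eps i)).

Lemma sg_kap_sum a : sg (kap a) = \sum_i (a (delta_mx ord0 i) : R) *: dual_basis i.
Proof.
by rewrite kap_sum linear_sum; apply: eq_bigr => i _; rewrite linearZ.
Qed.

Section AtPoint.
Variables (p : G).
Local Notation rcovec := (rcovec A p).

Lemma rcovecE f x : smooth_fun_at A f p -> rcovec f x = Rd x f p.
Proof. by move=> sf; rewrite rcovec.unlock comp_lfunE (RdE G_lie x sf). Qed.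

Lemma rcovec_Ad f x : smooth_fun_at A f p -> rcovec f (Ad A p x) = Ld x f p.
Proof. by move=> sf; rewrite rcovecE // (Ld_Ad G_lie x sf). Qed.

Lemma Ld_lin_sum (c : 'I_n -> R) (u : 'I_n -> 'rV[R]_n) f :
  smooth_fun_at A f p ->
  Ld (\sum_i c i *: u i) f p = \sum_i c i * Ld (u i) f p.
Proof.
move=> sf; rewrite (LdE G_lie _ sf) !linear_sum; apply: eq_bigr => i _.
by rewrite (LdE G_lie _ sf) !linearZ.
Qed.

Lemma Rd_lin_sum (c : 'I_n -> R) (u : 'I_n -> 'rV[R]_n) f :
  smooth_fun_at A f p ->
  Rd (\sum_i c i *: u i) f p = \sum_i c i * Rd (u i) f p.
Proof.
move=> sf; rewrite (RdE G_lie _ sf) !linear_sum; apply: eq_bigr => i _.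
by rewrite (RdE G_lie _ sf) !linearZ.
Qed.

(** The factor Ad_p of [twist] turns the right derivation into a left one, and sigma is absorbed in
    [dual_basis]. *)
Lemma rcovec_tau_kap f a : smooth_fun_at A f p ->
  rcovec f (tau p (kap a)) =
  \sum_i a (delta_mx ord0 i) * Ld (dual_basis i) f p.
Proof.
move=> sf; apply: etrans (congr1 (fun v : 'rV[R]_n => rcovec f v) (tauE p _)) _.
apply: etrans (rcovec_Ad _ sf) _; rewrite (sg_kap_sum a) (Ld_lin_sum _ _ sf) //.
Qed.

Lemma bracket_of_rcovec f g : bracket_of A P_G f g p =
  rcovec g (P_triv p (rcovec f)).
Proof. by rewrite /bracket_of /P_G pushE rcovec.unlock comp_lfunE. Qed.

Lemma bracket_P_G f g : smooth_fun_at A f p -> smooth_fun_at A g p ->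
  bracket_of A P_G f g p = 2^-1 * \sum_i
    (Rd (delta_mx ord0 i) g p * Ld (dual_basis i) f p
     - Rd (delta_mx ord0 i) f p * Ld (dual_basis i) g p).
Proof.
move=> sf sg'; rewrite bracket_of_rcovec P_triv_pair.
rewrite (rcovec_tau_kap _ sf) (rcovec_tau_kap _ sg') -sumrB.
congr (_ * _); apply: eq_bigr => i _.
by rewrite !rcovecE.
Qed.

End AtPoint.

Local Notation db := (dual_basis).
Local Notation de i := (delta_mx ord0 i : 'rV[R]_n).

(** The minus sign is written as a constant factor, so that the sum and product rules suffice to
    differentiate the summands. *)
Lemma bracket_P_G_fun f g : (forall q, smooth_fun_at A f q) ->
  (forall q, smooth_fun_at A g q) ->
  bracket_of A P_G f g = fun q => 2^-1 * \sum_i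
    (Rd (de i) g q * Ld (db i) f q + - 1 * (Rd (de i) f q * Ld (db i) g q)).
Proof.
move=> sf sg'; apply/funext => q.
rewrite (bracket_P_G (sf q) (sg' q)).
by congr (_ * _); apply: eq_bigr => i _; rewrite mulN1r.
Qed.

Lemma smooth_bracket_summand f g p i : smooth_fun_at A f p -> smooth_fun_at A g p ->
  smooth_fun_at A (fun q =>
  Rd (de i) g q * Ld (db i) f q + - 1 * (Rd (de i) f q * Ld (db i) g q)) p.
Proof.
move=> sf sg'.
apply: smooth_funD; first by apply: smooth_funM; [apply: smooth_Rd|apply: smooth_Ld].
apply: smooth_funM; first exact: smooth_fun_cst.
by apply: smooth_funM; [apply: smooth_Rd|apply: smooth_Ld].
Qed.

Lemma smooth_bracket f g p : (forall q, smooth_fun_at A f q) ->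
  (forall q, smooth_fun_at A g q) -> smooth_fun_at A (bracket_of A P_G f g) p.
Proof.
move=> sf sg'; rewrite (bracket_P_G_fun sf sg').
apply: smooth_funM; first exact: smooth_fun_cst.
by apply: smooth_fun_sum => i; exact: smooth_bracket_summand.
Qed.

Lemma Rd_bracket_summand f g p x i : smooth_fun_at A f p -> smooth_fun_at A g p ->
  Rd x (fun q =>
    Rd (de i) g q * Ld (db i) f q + - 1 * (Rd (de i) f q * Ld (db i) g q)) p =
  Rd (de i) g p * Rd x (Ld (db i) f) p + Rd x (Rd (de i) g) p * Ld (db i) f p
  - (Rd (de i) f p * Rd x (Ld (db i) g) p + Rd x (Rd (de i) f) p * Ld (db i) g p).
Proof.
move=> sf sg'.
have sRf := smooth_Rd G_lie (de i) sf; have sRg := smooth_Rd G_lie (de i) sg'.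
have sLf := smooth_Ld G_lie (db i) sf; have sLg := smooth_Ld G_lie (db i) sg'.
have s1 := smooth_funM sRg sLf; have s2 := smooth_funM sRf sLg.
have s3 := smooth_funM (smooth_fun_cst (A := A) (- 1) p) s2.
rewrite (RdD G_lie x s1 s3) (RdZ G_lie x (- 1) s2) mulN1r.
by rewrite (RdM G_lie x sRg sLf) (RdM G_lie x sRf sLg).
Qed.

Lemma Ld_bracket_summand f g p x i : smooth_fun_at A f p -> smooth_fun_at A g p ->
  Ld x (fun q =>
    Rd (de i) g q * Ld (db i) f q + - 1 * (Rd (de i) f q * Ld (db i) g q)) p =
  Rd (de i) g p * Ld x (Ld (db i) f) p + Ld x (Rd (de i) g) p * Ld (db i) f p
  - (Rd (de i) f p * Ld x (Ld (db i) g) p + Ld x (Rd (de i) f) p * Ld (db i) g p).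
Proof.
move=> sf sg'.
have sRf := smooth_Rd G_lie (de i) sf; have sRg := smooth_Rd G_lie (de i) sg'.
have sLf := smooth_Ld G_lie (db i) sf; have sLg := smooth_Ld G_lie (db i) sg'.
have s1 := smooth_funM sRg sLf; have s2 := smooth_funM sRf sLg.
have s3 := smooth_funM (smooth_fun_cst (A := A) (- 1) p) s2.
rewrite (LdD G_lie x s1 s3) (LdZ G_lie x (- 1) s2) mulN1r.
by rewrite (LdM G_lie x sRg sLf) (LdM G_lie x sRf sLg).
Qed.

(** * The Jacobiator of the bracket *)

Section Jacobi.
Variables (p : G) (f g h : G -> R).
Hypothesis sf : forall q, smooth_fun_at A f q.
Hypothesis sg' : forall q, smooth_fun_at A g q.
Hypothesis sh : forall q, smooth_fun_at A h q.

Local Notation r f := (fun i => Rd (de i) f p).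
Local Notation l f := (fun i => Ld (db i) f p).
Local Notation ll f := (fun j i => Ld (db j) (Ld (db i) f) p).
Local Notation rr f := (fun j i => Rd (de j) (Rd (de i) f) p).
Local Notation lr f := (fun j i => Ld (db j) (Rd (de i) f) p).

Lemma bracket_nested : bracket_of A P_G (bracket_of A P_G f g) h p =
  4^-1 * \sum_j \sum_i
    nested (r f) (l f) (r g) (l g) (r h) (l h)
      (ll f) (rr f) (lr f) (ll g) (rr g) (lr g) j i.
Proof.
have sF := smooth_bracket p sf sg'.
rewrite (bracket_P_G sF (sh p)) (bracket_P_G_fun sf sg').
pose T i q := Rd (de i) g q * Ld (db i) f q + - 1 * (Rd (de i) f q * Ld (db i) g q).
have sT i : smooth_fun_at A (T i) p by exact: smooth_bracket_summand.
have sS : smooth_fun_at A (fun q => \sum_i T i q) p by exact: smooth_fun_sum.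
have -> : (4 : R)^-1 = 2^-1 * 2^-1 by field.
rewrite -mulrA; congr (_ * _); rewrite mulr_sumr; apply: eq_bigr => j _.
rewrite (LdZ G_lie _ _ sS) (RdZ G_lie _ _ sS).
rewrite (Rd_sum G_lie _ sT) (Ld_sum G_lie _ sT).
rewrite mulrCA -mulrA -mulrBr; congr (_ * _).
rewrite mulr_sumr mulr_suml -sumrB; apply: eq_bigr => i _.
rewrite /T (Rd_bracket_summand _ _ (sf p) (sg' p)).
rewrite (Ld_bracket_summand _ _ (sf p) (sg' p)) /nested.
(* Commutation of R and L brings every mixed derivative to the form L R, the single array fM of
   [nested]. *)
rewrite -(Ld_Rd G_lie (db i) (de j) (sf p)) -(Ld_Rd G_lie (db i) (de j) (sg' p)).
ring.
Qed.

Local Notation u f := (kap (rcovec A p f)).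

Lemma K_kap a x : K (kap a) x = a x.
Proof. by rewrite Kkap. Qed.

Lemma sum_kap f1 : smooth_fun_at A f1 p ->
  \sum_i Rd (de i) f1 p *: db i = sg (u f1).
Proof.
by move=> s1; rewrite sg_kap_sum; apply: eq_bigr => i _; rewrite rcovecE.
Qed.

(** The i-th coordinate of tau^-1 u is, by adjunction, the value of the covector of f1 on tau e^i =
    Ad_p (sigma e^i), that is, a left derivative. *)
Lemma sum_tauV f1 : smooth_fun_at A f1 p ->
  \sum_i Ld (db i) f1 p *: de i = tauV p (u f1).
Proof.
move=> s1; rewrite [RHS]row_sum_delta; apply: eq_bigr => i _; congr (_ *: _).
rewrite -epsE covec_tauV -(rcovec_Ad _ s1); congr (rcovec A p f1 _).
exact: esym (tauE p (kap (eps i))).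
Qed.

Lemma Ld_bracket_sum (c d : 'I_n -> R) (w : 'I_n -> 'rV[R]_n) f1 :
  smooth_fun_at A f1 p ->
  Ld (bracket A (\sum_j c j *: w j) (\sum_i d i *: w i)) f1 p =
  \sum_j \sum_i (Ld (w j) (Ld (w i) f1) p - Ld (w i) (Ld (w j) f1) p) * (d i * c j).
Proof.
move=> s1; rewrite (bracket_suml G_lie) (Ld_lin_sum _ _ s1).
apply: eq_bigr => j _; rewrite (bracket_sumr G_lie) (Ld_lin_sum _ _ s1) mulr_sumr.
apply: eq_bigr => i _; rewrite (Ld_bracket G_lie _ _ s1).
ring.
Qed.

Lemma Rd_bracket_sum (c d : 'I_n -> R) (w : 'I_n -> 'rV[R]_n) f1 :
  smooth_fun_at A f1 p ->
  Rd (bracket A (\sum_j c j *: w j) (\sum_i d i *: w i)) f1 p =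
  - \sum_j \sum_i (Rd (w j) (Rd (w i) f1) p - Rd (w i) (Rd (w j) f1) p) * (d i * c j).
Proof.
move=> s1; rewrite (bracket_suml G_lie) (Rd_lin_sum _ _ s1) -sumrN.
apply: eq_bigr => j _; rewrite (bracket_sumr G_lie) (Rd_lin_sum _ _ s1) mulr_sumr -sumrN.
apply: eq_bigr => i _; rewrite (Rd_bracket G_lie _ _ s1).
ring.
Qed.

(** The left part is the left derivative of f along sigma [u_h, u_g], i.e. the covector of f on
    [tau u_h, tau u_g]. The right part is a derivative along [tau^-1 u_h, tau^-1 u_g], with the sign
    of [Rd_bracket]. *)
Lemma structure_sum : \sum_j \sum_i
    ((ll f j i - ll f i j) * (r g i * r h j) + (rr f j i - rr f i j) * (l g i * l h j)) =
  form3 A K (tau p (u h)) (tau p (u g)) (u f)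
  - form3 A K (tauV p (u h)) (tauV p (u g)) (u f).
Proof.
have -> : form3 A K (tau p (u h)) (tau p (u g)) (u f) =
    \sum_j \sum_i (ll f j i - ll f i j) * (r g i * r h j).
  rewrite form3.unlock; apply: etrans (K_sym _ _) _; apply: etrans (K_kap _ _) _.
  apply: etrans (congr1 (rcovec A p f) (esym (bracket_tau p (u h) (u g)))) _.
  apply: etrans (congr1 (rcovec A p f) (tauE p (bracket A (u h) (u g)))) _.
  apply: etrans (rcovec_Ad _ (sf p)) _.
  have E := bracket_hom G_lie sigma_smooth sigma_morphism (u h) (u g).
  apply: etrans (congr1 (fun v => Ld v f p) E) _.
  have E1 := esym (sum_kap (sh p)); have E2 := esym (sum_kap (sg' p)).
  apply: etrans (congr1 (fun v => Ld v f p) (congr2 (bracket A) E1 E2)) _.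
  exact: Ld_bracket_sum (sf p).
have -> : form3 A K (tauV p (u h)) (tauV p (u g)) (u f) =
    - \sum_j \sum_i (rr f j i - rr f i j) * (l g i * l h j).
  rewrite form3.unlock; apply: etrans (K_sym _ _) _; apply: etrans (K_kap _ _) _.
  apply: etrans (rcovecE _ (sf p)) _.
  rewrite -(sum_tauV (sh p)) -(sum_tauV (sg' p)).
  exact: Rd_bracket_sum (sf p).
by rewrite opprK -big_split; apply: eq_bigr => j _; rewrite big_split.
Qed.

End Jacobi.

Local Notation u f p := (kap (rcovec A p f)).

Lemma form3_tau p x y z : form3 A K (tau p x) (tau p y) z = form3 A K x y (tauV p z).
Proof.
rewrite !form3.unlock; have E := K_tauV p (bracket A x y) z.
by rewrite (bracket_tau p x y) in E; exact: esym E.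
Qed.

Lemma half_schouten_P_G p f g h : (forall q, smooth_fun_at A f q) ->
  (forall q, smooth_fun_at A g q) -> (forall q, smooth_fun_at A h q) ->
  half_schouten A P_G f g h p = 4^-1 *
    form3 A K (u f p - tauV p (u f p)) (u g p - tauV p (u g p))
              (u h p - tauV p (u h p)).
Proof.
move=> sf sg' sh; rewrite /half_schouten.
have e1 := bracket_nested p sf sg' sh; have e2 := bracket_nested p sg' sh sf.
have e3 := bracket_nested p sh sf sg'.
apply: etrans (congr2 +%R (congr2 +%R e1 e2) e3) _; rewrite -!mulrDr.
congr (_ * _); rewrite nested_cyclic.
have s1 := structure_sum p sf sg' sh; have s2 := structure_sum p sg' sh sf.
have s3 := structure_sum p sh sf sg'.
apply: etrans (congr2 +%R (congr2 +%R s1 s2) s3) _.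
(* Moving tau to the third argument as tau^-1 leaves only vectors u and u' = tau^-1 u, as
   [form3_alternating] requires. *)
rewrite !form3_tau; apply: (form3_alternating G_lie K_sym K_invariant).
by rewrite -form3_tau !tauVK.
Qed.

Lemma skew_P_G p : skew (P_G p).
Proof. by apply: skew_push; exact: skew_P_triv. Qed.

(** The components of P in a chart are the brackets of its coordinate functions, for which the
    formula in invariant derivatives is visibly smooth. *)
Lemma bivector_field_P_G : bivector_field A P_G.
Proof.
split=> [p|m a b]; first exact: skew_P_G.
have [_ o _] := gA m.
pose ca a q := a (coord A m q) : R.
apply/(smooth_onP _ o) => v iv.
have E : \forall w \near v, bracket_of A P_G (ca a) (ca b) (point A m w) =
    b (push (dcoord A m (point A m w)) (P_G (point A m w)) a).
  apply: filterS (near_img gA iv) => w iw; have [dw _] := imgP gA iw.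
  rewrite pushE /bracket_of (dfun_coord (lie_manifold G_lie) b _ dw).
  congr (b (_ (P_G _ _))); apply/lfunP => x.
  by rewrite (dfun_coord (lie_manifold G_lie) a x dw) comp_lfunE.
apply: smooth_at_eq E _.
pose F q := 2^-1 * \sum_i
    (Rd (de i) (ca b) q * Ld (db i) (ca a) q
     + - 1 * (Rd (de i) (ca a) q * Ld (db i) (ca b) q)).
have sca c w : img A m w -> smooth_fun_at A (ca c) (point A m w).
  move=> iw; have [dw _] := imgP gA iw.
  exact: (smooth_fun_coord (lie_manifold G_lie)).
have EF : \forall w \near v, F (point A m w) =
    bracket_of A P_G (ca a) (ca b) (point A m w).
  apply: filterS (near_img gA iv) => w iw.
  rewrite (bracket_P_G (sca a w iw) (sca b w iw)) /F; congr (_ * _).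
  by apply: eq_bigr => i _; rewrite mulN1r.
apply: smooth_at_eq EF _.
have sF : smooth_fun_at A F (point A m v).
  apply: smooth_funM; first exact: smooth_fun_cst.
  by apply: smooth_fun_sum => i; apply: smooth_bracket_summand; exact: sca.
exact: (smooth_fun_comp gA sF (plot_point (lie_manifold G_lie) iv)).
Qed.

Lemma kap_eq a x : (forall y, K x y = a y) -> kap a = x.
Proof.
move=> E; rewrite -(kapK K_nondegenerate x); congr (kap _).
by apply/lfunP => y; rewrite E.
Qed.

Lemma sg_selfadjoint x y : K (sg x) y = K x (sg y).
Proof. by rewrite -(sigma_orthogonal x (sg y)) sgK. Qed.

(** * The quasi-triple and its projection *)

Lemma g_plusE x : g_plus A sigma x = row_mx x (sg x).
Proof.
have lin : linear (fun x : 'rV[R]_n => row_mx x (sg x)).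
  by move=> c y z; rewrite linearP scale_row_mx add_row_mx.
pose L : {linear 'rV[R]_n -> 'rV[R]_(n + n)} :=
  HB.pack (fun x : 'rV[R]_n => row_mx x (sg x))
    (GRing.isLinear.Build _ _ _ _ _ lin).
exact: (lfunE L).
Qed.

Lemma form_d_minus y x : form_d K (row_mx y (- sg y)) (g_plus A sigma x) = 2 * K y x.
Proof.
rewrite /form_d g_plusE !row_mxKl !row_mxKr linearN opp_lfunE.
by rewrite sigma_orthogonal opprK -mulr2n mulr_natl.
Qed.

(** The form pairs (y, - sigma y) with (x, sigma x) to 2 K y x, by orthogonality of sigma; hence the
    factor 1/2 and uniqueness. *)
Lemma jmapE a : jmap A K sigma a = row_mx (2^-1 *: kap a) (- sg (2^-1 *: kap a)).
Proof.
have two : (2 : R) * 2^-1 = 1 by rewrite divff.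
apply: xget_unique.
  split; first by exists (2^-1 *: kap a).
  move=> x; rewrite form_d_minus linearZ scale_lfunE (K_kap a x).
  by rewrite /GRing.scale /= mulrA two mul1r.
move=> _ [[y _ <-] E]; suff -> : y = 2^-1 *: kap a by [].
suff -> : kap a = 2 *: y by rewrite scalerA mulrC two scale1r.
apply: kap_eq => x; rewrite -E form_d_minus linearZ scale_lfunE.
by [].
Qed.

Lemma r_dE theta : r_d A K sigma theta = jmap A K sigma (theta \o g_plus A sigma)%VF.
Proof.
have lin : linear (fun theta : covec R (n + n) =>
    jmap A K sigma (theta \o g_plus A sigma)%VF).
  move=> c s t; rewrite !jmapE comp_lfunDl -comp_lfunZl.
  move: (s \o _)%VF (t \o _)%VF => {}s {}t.
  have -> : 2^-1 *: kap (c *: s + t) = c *: (2^-1 *: kap s) + 2^-1 *: kap t.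
    by rewrite linearP scalerDr !scalerA (mulrC c).
  move: (2^-1 *: kap s) (2^-1 *: kap t) => y z.
  by rewrite linearP scale_row_mx add_row_mx opprD scalerN.
pose L : {linear covec R (n + n) -> 'rV[R]_(n + n)} :=
  HB.pack (fun theta : covec R (n + n) => jmap A K sigma (theta \o g_plus A sigma)%VF)
    (GRing.isLinear.Build _ _ _ _ _ lin).
exact: (lfunE L).
Qed.

(** Evaluates the r-matrix from a guessed y: it suffices that 2 K y represents the covector pulled
    back to g_+^sigma. *)
Lemma push_r_d k (T : 'Hom('rV[R]_(n + n), 'rV[R]_k)) (b : covec R k) y :
  (forall x, 2 * K y x = b (T (row_mx x (sg x)))) ->
  push T (r_d A K sigma) b = T (row_mx y (- sg y)).
Proof.
move=> H; rewrite pushE r_dE jmapE; congr (T _).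
suff -> : kap ((b \o T) \o g_plus A sigma)%VF = 2 *: y.
  by rewrite scalerA mulVf ?scale1r // pnatr_eq0.
apply: kap_eq => x; rewrite !comp_lfunE g_plusE -H linearZ scale_lfunE.
by [].
Qed.

Let gD := good_charts_prod gA gA.
Local Notation DD := (atlasD A).

Lemma dmap_cst k l (M N : Type) (B : atlas R k M) (C : atlas R l N) (c : N) m v :
  good_charts B -> good_charts C -> dmap B C (fun=> c) m v = 0.
Proof.
by move=> gB gC; rewrite (dmapE gB m v (smooth_map_cst c gB gC)) pdiff_cst.
Qed.

Lemma smooth_mul : smooth_map DD A (fun z : G * G => (z.1 * z.2)%g).
Proof. by have [_ ] := G_lie. Qed.

Lemma dmap_mul11 x y :
  dmap DD A (fun z : G * G => (z.1 * z.2)%g) (1%g, 1%g) (row_mx x y) = x + y.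
Proof.
apply: etrans (dmap_prod (1%g, 1%g) x y gA gA smooth_mul) _.
congr (_ + _).
  by apply: etrans (dmap_id 1%g x gA); apply: dmap_ext => z; rewrite /= mulg1.
by apply: etrans (dmap_id 1%g y gA); apply: dmap_ext => z; rewrite /= mul1g.
Qed.

Lemma smooth_inv : smooth_map A A (fun z : G => z^-1%g).
Proof. by have [_ ] := G_lie. Qed.

(** Differentiate z * z^-1 = 1. *)
Lemma dmap_inv y : dmap A A (fun z : G => z^-1%g) 1%g y = - y.
Proof.
have sp := smooth_pair gA (smooth_map_id gA) smooth_inv.
have E1 := dmap_comp 1%g y gA gD smooth_mul sp.
have E2 := dmap_pair 1%g y gA (smooth_map_id gA) smooth_inv.
rewrite /= invg1 in E1.
have E3 : dmap A A ((fun z : G * G => (z.1 * z.2)%g) \o (fun z => (id z, z^-1%g)))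
    1%g y = 0.
  apply: etrans (dmap_cst 1%g 1%g y gA gA); apply: dmap_ext => z /=.
  by rewrite mulgV.
pose v := dmap A A (fun z : G => z^-1%g) 1%g y.
have E4 := congr1 (fun u : 'rV[R]_n => row_mx u v) (dmap_id 1%g y gA).
have E5 := congr1 (fun w : 'rV[R]_(n + n) =>
  dmap DD A (fun z : G * G => (z.1 * z.2)%g) (1%g, 1%g) w) (etrans E2 E4).
have E6 : 0 = y + v := etrans (esym E3) (etrans E1 (etrans E5 (dmap_mul11 y v))).
have key w : 0 = y + w -> w = - y.
  by move=> E; apply/eqP; rewrite -addr_eq0 addrC -E.
exact: key E6.
Qed.

(** The projection D -> S, read in G. *)
Definition quot (d : G * G) : G := (d.1 * d.2^-1)%g.

Lemma smooth_quot : smooth_map DD A quot.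
Proof.
have S := smooth_mulg G_lie gD (smooth_fst gA gA)
  (smooth_invg G_lie gD (smooth_snd gA gA)).
exact: S.
Qed.

Lemma smooth_lmulD (d : G * G) : smooth_map DD DD (fun z => (d * z)%g).
Proof.
apply: (smooth_pair gD).
  by have S := smooth_mulg G_lie gD (smooth_map_cst _ gD gA) (smooth_fst gA gA); exact: S.
by have S := smooth_mulg G_lie gD (smooth_map_cst _ gD gA) (smooth_snd gA gA); exact: S.
Qed.

Lemma smooth_rmulD (d : G * G) : smooth_map DD DD (fun z => (z * d)%g).
Proof.
apply: (smooth_pair gD).
  by have S := smooth_mulg G_lie gD (smooth_fst gA gA) (smooth_map_cst _ gD gA); exact: S.
by have S := smooth_mulg G_lie gD (smooth_snd gA gA) (smooth_map_cst _ gD gA); exact: S.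
Qed.

Lemma dmap_lmulD (d : G * G) x y :
  dmap DD DD (fun z => (d * z)%g) 1%g (row_mx x y) =
  row_mx (TL d.1 x) (TL d.2 y).
Proof.
have s1 := smooth_fst gA gA; have s2 := smooth_snd gA gA.
have f1 := smooth_mulg G_lie gD (smooth_map_cst d.1 gD gA) s1.
have f2 := smooth_mulg G_lie gD (smooth_map_cst d.2 gD gA) s2.
apply: etrans (dmap_pair (1%g : G * G) (row_mx x y) gD f1 f2) _.
have E1 := dmap_prod (1%g : G * G) x y gA gA f1.
have E2 := dmap_prod (1%g : G * G) x y gA gA f2.
have F1 := congr1 (fun v : 'rV[R]_n => TL d.1 x + v)
  (dmap_cst (d.1 * 1)%g 1%g y gA gA).
have F2 := congr1 (fun v : 'rV[R]_n => v + TL d.2 y)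
  (dmap_cst (d.2 * 1)%g 1%g x gA gA).
have H1 := etrans E1 (etrans F1 (addr0 _)).
have H2 := etrans E2 (etrans F2 (add0r _)).
exact: (congr2 (fun v w : 'rV[R]_n => row_mx v w) H1 H2).
Qed.

Lemma dmap_rmulD (d : G * G) x y :
  dmap DD DD (fun z => (z * d)%g) 1%g (row_mx x y) =
  row_mx (TR d.1 x) (TR d.2 y).
Proof.
have s1 := smooth_fst gA gA; have s2 := smooth_snd gA gA.
have f1 := smooth_mulg G_lie gD s1 (smooth_map_cst d.1 gD gA).
have f2 := smooth_mulg G_lie gD s2 (smooth_map_cst d.2 gD gA).
apply: etrans (dmap_pair (1%g : G * G) (row_mx x y) gD f1 f2) _.
have E1 := dmap_prod (1%g : G * G) x y gA gA f1.
have E2 := dmap_prod (1%g : G * G) x y gA gA f2.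
have F1 := congr1 (fun v : 'rV[R]_n => TR d.1 x + v)
  (dmap_cst (1 * d.1)%g 1%g y gA gA).
have F2 := congr1 (fun v : 'rV[R]_n => v + TR d.2 y)
  (dmap_cst (1 * d.2)%g 1%g x gA gA).
have H1 := etrans E1 (etrans F1 (addr0 _)).
have H2 := etrans E2 (etrans F2 (add0r _)).
exact: (congr2 (fun v w : 'rV[R]_n => row_mx v w) H1 H2).
Qed.

Lemma dmap_conj_rmul (h1 h2 : G) x :
  dmap A A (fun z : G => (h1 * z * h2)%g) 1%g x = TR (h1 * h2)%g (Ad A h1 x).
Proof.
have E := dmap_comp 1%g x gA gA (smooth_rmul G_lie (h1 * h2)%g) (smooth_conj G_lie h1).
rewrite conj_e in E; apply: etrans _ E; apply: dmap_ext => z /=.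
by rewrite !mulgA mulgVK.
Qed.

(** With q = quot d, the map is (z1, z2) |-> z1 q z2^-1 = z1 (q z2^-1 q^-1) q. *)
Lemma dmap_quot_r (d : G * G) x y :
  dmap DD A (fun z => quot (z * d)%g) 1%g (row_mx x y) =
  TR (quot d) (x - Ad A (quot d) y).
Proof.
have sq := smooth_map_comp gD gD smooth_quot (smooth_rmulD d).
apply: etrans (dmap_prod (1%g : G * G) x y gA gA sq) _.
have E1 : dmap A A (fun z => quot ((z, 1%g) * d)%g) 1%g x = TR (quot d) x.
  by apply: dmap_ext => z; rewrite /quot /= mul1g mulgA.
have E := dmap_comp 1%g y gA gA (smooth_map_comp gA gA (smooth_rmul G_lie (quot d))
   (smooth_conj G_lie (quot d))) smooth_inv.
rewrite invg1 in E.
have E2 := dmap_comp 1%g y gA gA (smooth_rmul G_lie (quot d))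
  (smooth_conj G_lie (quot d)).
rewrite conj_e in E2.
pose S z := (quot d * z * (quot d)^-1 * quot d)%g.
have E3 := congr1 (fun v : 'rV[R]_n => dmap A A S 1%g v) (dmap_inv y).
have E4 := linearN (dmap A A S 1%g) y.
have E5 : dmap A A (fun z => quot ((1%g, z) * d)%g) 1%g y =
    - TR (quot d) (Ad A (quot d) y).
  apply: etrans (etrans _ (etrans E (etrans E3 E4))) (congr1 -%R E2).
  apply: dmap_ext => z /=.
  by rewrite mulgVK /quot /= mul1g invgM mulgA.
apply: etrans (congr2 +%R E1 E5) _.
exact: (esym (linearB (TR (quot d)) x (Ad A (quot d) y))).
Qed.

Lemma dmap_quot_l (d : G * G) x y :
  dmap DD A (fun z => quot (d * z)%g) 1%g (row_mx x y) =
  TR (quot d) (Ad A d.1 (x - y)).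
Proof.
have sq := smooth_map_comp gD gD smooth_quot (smooth_lmulD d).
apply: etrans (dmap_prod (1%g : G * G) x y gA gA sq) _.
have E1 : dmap A A (fun z => quot (d * (z, 1%g))%g) 1%g x = TR (quot d) (Ad A d.1 x).
  have E := dmap_conj_rmul d.1 d.2^-1%g x; apply: etrans _ E.
  by apply: dmap_ext => z; rewrite /quot /= mulg1.
pose S z := (d.1 * z * d.2^-1)%g.
have sc : smooth_map A A S.
  by have H := smooth_mulg G_lie gA (smooth_lmul G_lie d.1)
    (smooth_map_cst (d.2^-1)%g gA gA); exact: H.
have E := dmap_comp 1%g y gA gA sc smooth_inv.
rewrite invg1 in E.
have E2 := dmap_conj_rmul d.1 d.2^-1%g y.
have E3 := congr1 (fun v : 'rV[R]_n => dmap A A S 1%g v) (dmap_inv y).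
have E4 := linearN (dmap A A S 1%g) y.
have E5 : dmap A A (fun z => quot (d * (1%g, z))%g) 1%g y = - TR (quot d) (Ad A d.1 y).
  apply: etrans (etrans _ (etrans E (etrans E3 E4))) (congr1 -%R E2).
  apply: dmap_ext => z /=.
  by rewrite /quot /S /= mulg1 invgM mulgA.
apply: etrans (congr2 +%R E1 E5) _.
have L1 := esym (linearB (TR (quot d)) (Ad A d.1 x) (Ad A d.1 y)).
have L2 := congr1 (fun v : 'rV[R]_n => TR (quot d) v) (esym (linearB (Ad A d.1) x y)).
exact: etrans L1 L2.
Qed.

(** * Projection of the bivector field of D and its restriction to G_+^sigma *)

Local Notation P := P_G.
Local Notation PD := (P_D A K sigma).
Local Notation r_d := (r_d A K sigma).

(** The right-hand side is b on the infinitesimal action of x, so u - tau^-1 u is the vector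
    representing the pull-back of b by that action. *)
Lemma TR_pair_kap p (b : covec R n) x :
  K (kap (b \o TR p)%VF - tauV p (kap (b \o TR p)%VF)) x =
  b (TR p (x - tau p x)).
Proof.
have E := K_tauV p x (kap (b \o TR p)%VF).
rewrite linearB add_lfunE opp_lfunE (K_kap _ x) (K_sym (tauV p _)) E K_sym K_kap.
by rewrite !comp_lfunE !linearB.
Qed.

Lemma quot_push_left d (b : covec R n) :
  push (dmap DD A quot d) (left_tensor DD r_d d) b = 0.
Proof.
have sc := smooth_lmulD d.
rewrite /left_tensor push_comp.
set T := (_ \o _)%VF.
have TE x y : T (row_mx x y) = TR (quot d) (Ad A d.1 (x - y)).
  rewrite /T comp_lfunE; apply: etrans _ (dmap_quot_l d x y).
  have := dmap_comp (1%g : G * G) (row_mx x y) gD gD smooth_quot sc.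
  by rewrite /= mulg1 => E; exact: esym E.
move: T TE => T TE.
pose a : covec R n := (b \o (TR (quot d) \o Ad A d.1))%VF.
have aE x : a x = b (TR (quot d) (Ad A d.1 x)) by rewrite /a !comp_lfunE.
(* The pulled-back covector is x |-> a (x - sigma x), and sigma is self-adjoint. As - sigma w = w,
   the resulting vector (w, w) is killed. *)
pose w := 2^-1 *: (kap a - sg (kap a)).
have sgw : - sg w = w.
  by rewrite /w linearZ linearB -scalerN opprB /= sgK.
rewrite (@push_r_d _ T b w).
  apply: etrans (TE _ _) _; rewrite sgw subrr.
  have Z := congr1 (fun v : 'rV[R]_n => TR (quot d) v) (linear0 (Ad A d.1)).
  exact: etrans Z (linear0 (TR (quot d))).
move=> x; rewrite (TE x (sg x)) -aE /w linearZ scale_lfunE mulrA divff ?mul1r //.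
rewrite linearB add_lfunE opp_lfunE K_kap sg_selfadjoint K_kap.
by rewrite -linearB.
Qed.

(** Here w = (u - tau^-1 u) / 2, and (w, - sigma w) projects to w + tau w = (tau u - tau^-1 u) / 2,
    the opposite of the formula for P. *)
Lemma quot_push_right d (b : covec R n) :
  push (dmap DD A quot d) (right_tensor DD r_d d) b = - P (quot d) b.
Proof.
have sc := smooth_rmulD d.
rewrite /right_tensor push_comp.
set T := (_ \o _)%VF.
have TE x y : T (row_mx x y) = TR (quot d) (x - Ad A (quot d) y).
  rewrite /T comp_lfunE; apply: etrans _ (dmap_quot_r d x y).
  have := dmap_comp (1%g : G * G) (row_mx x y) gD gD smooth_quot sc.
  by rewrite /= mul1g => E; exact: esym E.
move: T TE => T TE.
pose u := kap (b \o TR (quot d))%VF.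
pose w := 2^-1 *: (u - tauV (quot d) u).
rewrite (@push_r_d _ T b w).
  apply: etrans (TE _ _) _; rewrite /P_G pushE.
  apply: etrans _ (linearN (TR (quot d)) (P_triv (quot d) (b \o TR (quot d))%VF)).
  apply: (congr1 (fun v : 'rV[R]_n => TR (quot d) v)).
  have E1 := P_trivE (quot d) (b \o TR (quot d))%VF.
  have E2 := tauVK (quot d) u.
  have L := linearN (Ad A (quot d)) (sg w).
  have F1 := etrans L (congr1 -%R (esym (tauE (quot d) w))).
  apply: etrans (congr1 (fun v : 'rV[R]_n => w - v) F1) _.
  apply: etrans _ (esym (congr1 -%R E1)); rewrite -/u opprK /w.
  have -> : tau (quot d) (2^-1 *: (u - tauV (quot d) u)) =
      2^-1 *: (tau (quot d) u - u) by rewrite linearZ linearB /= E2.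
  move: (tau (quot d) u) (tauV (quot d) u) => v1 v2.
  by rewrite -scalerDr -scalerN opprB (addrC (u - v2)) addrA addrNK.
move=> x; have F := TR_pair_kap (quot d) b x; rewrite -/u in F.
have F1 := congr1 (fun v : 'rV[R]_n => TR (quot d) (x - v)) (tauE (quot d) x).
apply: etrans _ (congr1 (fun v : 'rV[R]_n => b v) (etrans F1 (esym (TE x (sg x))))).
apply: etrans _ F; rewrite /w linearZ scale_lfunE.
by rewrite /GRing.scale /= mulrA divff ?mul1r.
Qed.

Lemma quot_push_P_D d : push (dmap DD A quot d) (PD d) = P (quot d).
Proof.
rewrite /P_D pushB; apply/lfunP => b.
have E := congr2 (fun v w : 'rV[R]_n => v - w) (quot_push_left d b) (quot_push_right d b).
apply: etrans (etrans _ E) _; first by rewrite add_lfunE opp_lfunE.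
by rewrite sub0r opprK.
Qed.

Lemma P_D_restr g : PD (incl_sigma sigma g) = 0.
Proof.
set d := incl_sigma sigma g.
have dLE x y : dmap DD DD (fun z => (d * z)%g) 1%g (row_mx x y) =
    row_mx (TR g (Ad A g x)) (TR (sigma g) (Ad A (sigma g) y)).
  apply: etrans (dmap_lmulD d x y) _.
  exact: (congr2 (fun v w : 'rV[R]_n => row_mx v w) (TL_Ad G_lie g x)
    (TL_Ad G_lie (sigma g) y)).
have dRE x y := dmap_rmulD d x y.
apply/eqP; rewrite subr_eq0; apply/eqP/lfunP => b; rewrite /left_tensor /right_tensor.
move: (dmap DD DD (fun z => (d * z)%g) 1%g) dLE => L LE.
move: (dmap DD DD (fun z => (z * d)%g) 1%g) dRE => Rt RtE.
pose a : covec R n := ((b \o Rt) \o g_plus A sigma)%VF.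
have aE x : a x = b (Rt (row_mx x (sg x))) by rewrite /a !comp_lfunE g_plusE.
pose w := 2^-1 *: kap a.
have E x := sg_Ad g x.
have LR x : L (row_mx x (sg x)) = Rt (row_mx (Ad A g x) (sg (Ad A g x))).
  rewrite LE RtE.
  exact: (congr1 (fun v : 'rV[R]_n => row_mx (TR g (Ad A g x)) (TR (sigma g) v))
    (esym (E x))).
have LR' x : L (row_mx x (- sg x)) = Rt (row_mx (Ad A g x) (- sg (Ad A g x))).
  rewrite LE RtE.
  exact: (congr1 (fun v : 'rV[R]_n => row_mx (TR g (Ad A g x)) (TR (sigma g) v))
    (etrans (linearN (Ad A (sigma g)) (sg x)) (congr1 -%R (esym (E x))))).
have half x : 2 * K w x = a x.
  by rewrite /w linearZ scale_lfunE K_kap /GRing.scale /= mulrA divff ?mul1r.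
have wE := AdVK G_lie g w.
(* Left translation is right translation after Ad of (g, sigma g), which preserves g_+^sigma and
   g_-^sigma; the vector for the left side is therefore moved by Ad_{g^-1}. *)
rewrite (@push_r_d _ L b (Ad A g^-1%g w)); last first.
  move=> x; apply: etrans _ (congr1 (fun v : 'rV[R]_(n + n) => b v) (esym (LR x))).
  apply: etrans _ (aE (Ad A g x)); apply: etrans _ (half (Ad A g x)).
  apply: (congr1 (fun c : R => 2 * c)).
  apply: etrans (esym (K_invariant g (Ad A g^-1%g w) x)) _.
  exact: (congr1 (fun v : 'rV[R]_n => K v (Ad A g x)) wE).
rewrite (@push_r_d _ Rt b w); last by move=> x; rewrite -aE half.
apply: etrans (LR' _) _.
exact: (congr1 (fun v : 'rV[R]_n => Rt (row_mx v (- sg v))) wE).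
Qed.

(** With q = g p sigma(g)^-1, one has tau_q = Ad_g tau_p Ad_g^-1, and K^-1 is equivariant by
    invariance of K. *)
Lemma P_G_equivariant g p : P (g * p * (sigma g)^-1)%g =
  push (dmap A A (fun z : G => (g * z * (sigma g)^-1)%g) p) (P p).
Proof.
set q := (g * p * (sigma g)^-1)%g; apply/lfunP => b.
pose S z := (g * z * (sigma g)^-1)%g.
have sS : smooth_map A A S.
  by have H := smooth_mulg G_lie gA (smooth_lmul G_lie g)
    (smooth_map_cst (sigma g)^-1%g gA gA); exact: H.
have SE x : dmap A A S p (TR p x) = TR q (Ad A g x).
  have E := dmap_comp 1%g x gA gA sS (smooth_rmul G_lie p).
  rewrite mul1g in E; apply: etrans (esym E) _.
  have E2 := dmap_conj_rmul g (p * (sigma g)^-1)%g x.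
  rewrite mulgA -/q in E2; apply: etrans _ E2; apply: dmap_ext => z.
  by rewrite /S /= !mulgA.
pose a : covec R n := (b \o TR q)%VF.
have aE : ((b \o dmap A A S p) \o TR p)%VF = (a \o Ad A g)%VF.
  apply/lfunP => x.
  have L1 := comp_lfunE (b \o dmap A A S p)%VF (TR p) x.
  have L2 := comp_lfunE b (dmap A A S p) (TR p x).
  have L3 := comp_lfunE a (Ad A g) x; have L4 := comp_lfunE b (TR q) (Ad A g x).
  have L5 := congr1 (fun v : 'rV[R]_n => b v) (SE x).
  exact: etrans L1 (etrans L2 (etrans L5 (esym (etrans L3 L4)))).
have R1 := pushE (dmap A A S p) (P p) b.
have R2 := pushE (TR p) (P_triv p) (b \o dmap A A S p)%VF.
rewrite aE in R2.
apply: etrans (pushE (TR q) (P_triv q) b) _.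
apply: etrans _ (esym (etrans R1 (etrans
  (congr1 (fun v : 'rV[R]_n => dmap A A S p v) R2) (SE _)))).
apply: (congr1 (fun v : 'rV[R]_n => TR q v)).
have kE : kap (a \o Ad A g)%VF = Ad A g^-1%g (kap a).
  apply: kap_eq => x; apply: etrans _ (esym (comp_lfunE a (Ad A g) x)).
  have E := K_invariant g (Ad A g^-1%g (kap a)) x.
  apply: etrans (esym E) _.
  have E2 := congr1 (fun v : 'rV[R]_n => K v (Ad A g x)) (AdVK G_lie g (kap a)).
  by apply: etrans E2 _; exact: K_kap.
have P1 := P_trivE q a.
have P2 := P_trivE p (a \o Ad A g)%VF.
rewrite kE in P2; move: (kap a) P1 P2 => v P1 P2.
have T1 : Ad A g (tau p (Ad A g^-1%g v)) = tau q v.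
  have F1 := tauE p (Ad A g^-1%g v).
  have F2 := sg_Ad g^-1%g v.
  have F3 := tauE q v.
  rewrite (homV sigma_morphism) in F2.
  apply: etrans _ (esym F3); rewrite /q.
  have M1 := AdM G_lie (g * p)%g (sigma g)^-1%g (sg v).
  have M2 := AdM G_lie g p (Ad A (sigma g)^-1%g (sg v)).
  apply: etrans (congr1 (fun u : 'rV[R]_n => Ad A g u) F1) _.
  apply: etrans (congr1 (fun u : 'rV[R]_n => Ad A g (Ad A p u)) F2) _.
  exact: etrans (esym M2) (esym M1).
(* Since sigma is an involution, Ad_g sigma = sigma Ad_{sigma(g)}. *)
have T2 : Ad A g (tauV p (Ad A g^-1%g v)) = tauV q v.
  have F1 := tauVE p (Ad A g^-1%g v).
  have F3 := tauVE q v.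
  have F2 := sg_Ad.
  have qV : q^-1%g = (sigma g * (p^-1 * g^-1))%g.
    by rewrite /q !invgM invgK.
  rewrite qV in F3.
  have M1 := AdM G_lie (sigma g) (p^-1 * g^-1)%g v.
  have M2 := AdM G_lie p^-1%g g^-1%g v.
  have F4 := F2 (sigma g) (Ad A p^-1%g (Ad A g^-1%g v)).
  rewrite sigma_involutive in F4.
  apply: etrans (congr1 (fun u : 'rV[R]_n => Ad A g u) F1) _.
  apply: etrans (esym F4) _; apply: etrans _ (esym F3).
  apply: (congr1 (fun u : 'rV[R]_n => sg u)).
  apply: etrans (congr1 (fun u : 'rV[R]_n => Ad A (sigma g) u) (esym M2)) _.
  exact: esym M1.
apply: etrans P1 _.
apply: etrans _ (esym (congr1 (fun u : 'rV[R]_n => Ad A g u) P2)).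
apply: esym; apply: etrans (linearZ _ _) _.
apply: (congr1 (fun u : 'rV[R]_n => 2^-1 *: u)).
apply: etrans (linearB _ _ _) _.
exact: (congr2 (fun u u' : 'rV[R]_n => u - u') T2 T1).
Qed.

(** * Twisted conjugation and the trivector it induces *)

Definition act_G g z : G := (g * z * (sigma g)^-1)%g.

(** The orbit map is g |-> quot ((g, sigma g) * (p, 1)), so [dmap_quot_r] applies. *)
Lemma inf_act_G p x : dmap A A (fun g => act_G g p) 1%g x = TR p (x - tau p x).
Proof.
have sp := smooth_pair gA (smooth_map_id gA) sigma_smooth.
pose d : G * G := (p, 1%g).
have sq := smooth_map_comp gD gD smooth_quot (smooth_rmulD d).
have E1 := dmap_comp 1%g x gA gD sq sp.
have E2 := dmap_pair 1%g x gA (smooth_map_id gA) sigma_smooth.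
have E3 := congr1 (fun u : 'rV[R]_n => row_mx u (sg x)) (dmap_id 1%g x gA).
have h1 : (id (1%g : G), sigma 1%g) = (1%g : G * G).
  by rewrite (hom1 sigma_morphism).
rewrite h1 in E1.
have E4 := dmap_quot_r d x (sg x).
have qd : quot d = p by rewrite /quot /= invg1 mulg1.
rewrite qd in E4.
have E5 := congr1 (fun u : 'rV[R]_(n + n) => dmap DD A (fun z => quot (z * d)%g) 1%g u)
  (etrans E2 E3).
have E6 := congr1 (fun u : 'rV[R]_n => TR p (x - u)) (esym (tauE p x)).
apply: etrans (etrans _ (etrans E1 E5)) (etrans E4 E6).
apply: dmap_ext => z; rewrite /act_G /quot /=.
by rewrite mulg1.
Qed.

Lemma P_G_tangent p b :
  P p b = dmap A A (fun g => act_G g p) 1%g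
    (2^-1 *: (kap (b \o TR p)%VF + tauV p (kap (b \o TR p)%VF))).
Proof.
rewrite /P_G pushE; apply: etrans _ (esym (inf_act_G p _)).
apply: (congr1 (fun u : 'rV[R]_n => TR p u)).
have P1 := P_trivE p (b \o TR p)%VF.
move: (kap _) P1 => u P1; rewrite {}P1.
have E2 := tauVK p u.
have -> : tau p (2^-1 *: (u + tauV p u)) = 2^-1 *: (tau p u + u).
  by rewrite linearZ linearD /= E2.
move: (tau p u) (tauV p u) => v1 v2.
by rewrite -scalerBr (addrC u) (addrC v1) opprD addrA addrK.
Qed.

(** Each argument of j contributes 1/2. The second component of d carries three signs and the minus
    of the form, so it adds an equal term, and 2 (1/2)^3 = 1/4. *)
Lemma phi_act_G p (b1 b2 b3 : covec R n) :
  let inf := dmap A A (fun g => act_G g p) 1%g in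
  let u b := kap (b \o TR p)%VF in
  phi_sigma A K sigma (b1 \o inf)%VF (b2 \o inf)%VF (b3 \o inf)%VF =
  4^-1 * form3 A K (u b1 - tauV p (u b1)) (u b2 - tauV p (u b2)) (u b3 - tauV p (u b3)).
Proof.
move=> inf u.
have kE (b : covec R n) : kap (b \o inf)%VF = u b - tauV p (u b).
  apply: kap_eq => x; apply: etrans (TR_pair_kap p b x) _.
  apply: etrans _ (esym (comp_lfunE b inf x)).
  exact: esym (congr1 (fun v : 'rV[R]_n => b v) (inf_act_G p x)).
rewrite /phi_sigma /form_d /bracket_d !jmapE !kE.
move: (u b1 - _) (u b2 - _) (u b3 - _) => x y z.
rewrite !row_mxKl !row_mxKr form3.unlock -(scaleN1r (sg (2^-1 *: x))).
rewrite -(scaleN1r (sg (2^-1 *: y))) -(scaleN1r (sg (2^-1 *: z))).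
pose c : R := 2^-1.
have B1 : bracket A (-1 *: sg (c *: x)) (-1 *: sg (c *: y)) =
    sg (bracket A (c *: x) (c *: y)).
  rewrite (bracketZl G_lie) (bracketZr G_lie) scalerA mulN1r opprK scale1r.
  exact: esym (bracket_hom G_lie sigma_smooth sigma_morphism (c *: x) (c *: y)).
have B2 : K (-1 *: sg (c *: z)) (sg (bracket A (c *: x) (c *: y))) =
    - K (c *: z) (bracket A (c *: x) (c *: y)).
  by rewrite linearZ scale_lfunE sigma_orthogonal scaleN1r.
have B3 : K (c *: z) (bracket A (c *: x) (c *: y)) = c * (c * (c * K (bracket A x y) z)).
  have Kl v w : K (c *: v) w = c * K v w by rewrite linearZ scale_lfunE.
  have Kr v w : K v (c *: w) = c * K v w by rewrite linearZ.
  by rewrite (bracketZl G_lie) (bracketZr G_lie) Kl !Kr K_sym.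
apply: etrans (congr1 (fun v : 'rV[R]_n => K (c *: z) (bracket A (c *: x) (c *: y))
   - K (-1 *: sg (c *: z)) v) B1) _.
by rewrite B2 B3 /c; field.
Qed.

(** * The action on S *)

Local Notation AS := (atlasS A).

Lemma img_atlasS s : img AS s = img A (S_to_G s).
Proof.
apply/seteqP; split=> u [z dz <-]; first by exists (S_to_G z).
by exists (G_to_S z); rewrite /= G_to_SK.
Qed.

Lemma good_charts_S : good_charts AS.
Proof.
move=> s; have [d o K0] := gA (S_to_G s).
split=> //; first by rewrite img_atlasS.
by move=> z dz /=; rewrite K0 // S_to_GK.
Qed.
Let gS := good_charts_S.

(** [atlasS] reads S through [S_to_G], so in charts this map has the expression of the identity of
    S. *)
Lemma smooth_S_to_G : smooth_map AS A (@S_to_G G).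
Proof. exact: smooth_map_id gS. Qed.

Lemma dmap_atlasS k (M : Type) (B : atlas R k M) (F : quotS G -> M) s :
  dmap AS B F s = dmap A B (F \o @G_to_S G) (S_to_G s).
Proof. by rewrite /dmap /= S_to_GK. Qed.

Local Notation PS := (fun s => P (S_to_G s)).

Lemma dcoord_atlasS s t : dcoord AS s t = dcoord A (S_to_G s) (S_to_G t).
Proof.
rewrite /dcoord.
have -> : coord AS s \o point AS t =
    coord A (S_to_G s) \o point A (S_to_G t) :> ('rV[R]_n -> 'rV[R]_n).
  by apply/funext => v; rewrite /= G_to_SK.
by [].
Qed.

Lemma bivector_field_atlasS (Q : G -> bivec R n) :
  bivector_field A Q -> bivector_field AS (fun s => Q (S_to_G s)).
Proof.
move=> [skQ smQ]; split=> [s|s b c]; first exact: skQ.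
rewrite img_atlasS; have H := smQ (S_to_G s) b c.
have E : (fun v => let t := point AS s v in
      c (push (dcoord AS s t) (Q (S_to_G t)) b)) =
    (fun v => let p := point A (S_to_G s) v in
      c (push (dcoord A (S_to_G s) p) (Q p) b)).
  apply/funext => v; cbv zeta; rewrite dcoord_atlasS.
  have -> : S_to_G (point AS s v) = point A (S_to_G s) v by exact: G_to_SK.
  by [].
by rewrite E.
Qed.

Lemma smooth_fun_atlasS f : smooth_fun AS f ->
  forall p, smooth_fun_at A (f \o @G_to_S G) p.
Proof.
move=> sf p; move: p; apply/(smooth_funP (lie_manifold G_lie)) => p.
by have := sf (G_to_S p); rewrite img_atlasS /= G_to_SK.
Qed.

Lemma bracket_of_atlasS f g s :
  bracket_of AS PS f g s = bracket_of A P (f \o @G_to_S G) (g \o @G_to_S G) (S_to_G s).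
Proof. by []. Qed.

Lemma half_schouten_atlasS f g h s : half_schouten AS PS f g h s =
  half_schouten A P (f \o @G_to_S G) (g \o @G_to_S G) (h \o @G_to_S G) (S_to_G s).
Proof.
have E f1 g1 : bracket_of AS PS f1 g1 \o @G_to_S G =
    bracket_of A P (f1 \o @G_to_S G) (g1 \o @G_to_S G).
  by apply/funext => p; rewrite /= bracket_of_atlasS G_to_SK.
have step f1 g1 h1 := etrans (bracket_of_atlasS (bracket_of AS PS f1 g1) h1 s)
  (congr1 (fun F => bracket_of A P F (h1 \o @G_to_S G) (S_to_G s)) (E f1 g1)).
pose add (c d : R) := c + d.
exact: (congr2 add (congr2 add (step f g h) (step g h f)) (step h f g)).
Qed.

Lemma dmap_act_S g s : dmap AS AS (actS sigma g) s = dmap A A (act_G g) (S_to_G s).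
Proof.
apply: etrans (dmap_atlasS AS (actS sigma g) s) _.
have E : @S_to_G G \o (actS sigma g \o @G_to_S G) = act_G g.
  by apply/funext => z; rewrite /= /actS !G_to_SK.
exact: (congr1 (fun F => dmap A A F (S_to_G s)) E).
Qed.

Lemma inf_action_S s :
  inf_action A AS (actS sigma) s = dmap A A (fun g => act_G g (S_to_G s)) 1%g.
Proof.
have E : @S_to_G G \o (fun g => actS sigma g s) = (fun g => act_G g (S_to_G s)).
  by apply/funext => z; rewrite /= /actS !G_to_SK.
exact: (congr1 (fun F => dmap A A F 1%g) E).
Qed.

Lemma smooth_action_S : is_smooth_action A AS (actS sigma).
Proof.
split=> [s|g h s|].
- by rewrite /actS (hom1 sigma_morphism) mul1g invg1 mulg1 S_to_GK.
- by rewrite /actS G_to_SK sigma_morphism invgM !mulgA.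
have gP := good_charts_prod gA gS.
have s1 := smooth_fst gA gS.
have s2 := smooth_map_comp gP gS smooth_S_to_G (smooth_snd gA gS).
have s3 := smooth_invg G_lie gP (smooth_map_comp gP gA sigma_smooth s1).
have s4 := smooth_mulg G_lie gP (smooth_mulg G_lie gP s1 s2) s3.
have E : (fun z : G * quotS G => @S_to_G G (actS sigma z.1 z.2)) =
    (fun z => (z.1 * S_to_G z.2 * (sigma z.1)^-1)%g).
  by apply/funext => z; rewrite /actS G_to_SK.
have s5 : smooth_map (prod_atlas A AS) A
    (fun z : G * quotS G => @S_to_G G (actS sigma z.1 z.2)).
  by rewrite E; exact: s4.
exact: s5.
Qed.

(** With the zero bivector on the group, multiplicativity of the action reduces to equivariance of
    P. *)
Lemma quasi_poisson_S :
  quasi_poisson_action A AS (actS sigma) (fun=> 0) (phi_sigma A K sigma) PS.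
Proof.
split; first exact: smooth_action_S.
- move=> g s.
  have E : S_to_G (actS sigma g s) = (g * S_to_G s * (sigma g)^-1)%g.
    exact: G_to_SK.
  have Z := push0 (dmap A AS (fun g' => actS sigma g' s) g).
  apply: etrans _ (esym (congr1 (fun X : bivec R n =>
    push (dmap AS AS (actS sigma g) s) (PS s) + X) Z)).
  apply: etrans _ (esym (addr0 _)).
  have E1 := congr1 P E.
  have E2 := P_G_equivariant g (S_to_G s).
  have E3 := congr1 (fun T : 'Hom('rV[R]_n, 'rV[R]_n) => push T (P (S_to_G s)))
    (esym (dmap_act_S g s)).
  have E4 := etrans E1 E2.
  have E5 := etrans E4 E3.
  exact: E5.
- move=> f g h sf sg' sh s; rewrite (inf_action_S s).
  have sf' := smooth_fun_atlasS sf; have sg'' := smooth_fun_atlasS sg'.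
  have sh' := smooth_fun_atlasS sh.
  apply: etrans (half_schouten_atlasS f g h s) _.
  have H := half_schouten_P_G (S_to_G s) sf' sg'' sh'.
  rewrite rcovec.unlock in H.
  apply: etrans H _; apply: esym.
  exact: phi_act_G.
Qed.

Lemma dmap_projS d : dmap DD AS (@projS G) d = dmap DD A quot d.
Proof.
have E : @S_to_G G \o @projS G = quot by apply/funext => z; exact: S_to_GE.
exact: (congr1 (fun F => dmap DD A F d) E).
Qed.

Lemma push_projS d : push (dmap DD AS (@projS G) d) (PD d) = PS (projS d).
Proof.
rewrite dmap_projS.
have E : S_to_G (projS d) = quot d by exact: S_to_GE.
apply: etrans _ (esym (congr1 P E)).
exact: (quot_push_P_D d).
Qed.

(** The differential at s of t |-> t s^-1 inverts right translation, so it recovers [P_triv] from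
    [P_G]. *)
Lemma P_S_formula s xi :
  push (dmap AS A (fun t => S_to_G t * (S_to_G s)^-1)%g s) (PS s) xi =
  2^-1 *: (Ad A (sigma (S_to_G s))^-1%g - Ad A (S_to_G s)) (sg (kap xi)).
Proof.
set p := S_to_G s.
have E0 : dmap AS A (fun t => S_to_G t * p^-1)%g s =
    dmap A A (fun z : G => (z * p^-1)%g) p.
  apply: etrans (dmap_atlasS A _ s) _.
  apply: (congr1 (fun F => dmap A A F p)); apply/funext => z.
  by rewrite /= G_to_SK.
rewrite E0.
have TE x : dmap A A (fun z : G => (z * p^-1)%g) p (TR p x) = x.
  have E := dmap_comp 1%g x gA gA (smooth_rmul G_lie p^-1%g) (smooth_rmul G_lie p).
  rewrite mul1g in E; apply: etrans (esym E) (etrans _ (dmap_id 1%g x gA)).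
  by apply: dmap_ext => z; rewrite /= mulgK.
have xiE : ((xi \o dmap A A (fun z : G => (z * p^-1)%g) p) \o TR p)%VF = xi.
  apply/lfunP => x.
  apply: etrans (comp_lfunE (xi \o dmap A A (fun z : G => (z * p^-1)%g) p)%VF (TR p) x) _.
  apply: etrans (comp_lfunE xi _ (TR p x)) _.
  exact: (congr1 (fun v : 'rV[R]_n => xi v) (TE x)).
have R1 := pushE (dmap A A (fun z : G => (z * p^-1)%g) p) (P p) xi.
have R2 := pushE (TR p) (P_triv p) (xi \o dmap A A (fun z : G => (z * p^-1)%g) p)%VF.
rewrite xiE in R2.
apply: etrans R1 (etrans (congr1 (fun v : 'rV[R]_n =>
  dmap A A (fun z : G => (z * p^-1)%g) p v) R2) _).
apply: etrans (TE _) _; rewrite /P_triv scale_lfunE.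
apply: (congr1 (fun v : 'rV[R]_n => 2^-1 *: v)).
apply: etrans (comp_lfunE _ _ xi) _; exact: comp_lfunE.
Qed.

Lemma P_S_tangent s :
  (limg (PS s) <= limg (inf_action A AS (actS sigma) s))%VS.
Proof.
rewrite inf_action_S; apply/subvP => v /memv_imgP[xi _ ->].
by rewrite P_G_tangent; apply: memv_img; exact: memvf.
Qed.

Lemma P_plus_restr g :
  push (dmap A DD (incl_sigma sigma) g) 0 = PD (incl_sigma sigma g).
Proof.
rewrite push0; apply: esym.
exact: P_D_restr.
Qed.

Lemma bivector_field0 : bivector_field A (fun=> 0).
Proof.
have Z (b c : covec R n) : c ((0 : bivec R n) b) = 0 by rewrite zero_lfunE linear0.
split=> [p b c|m b c].
  exact: etrans (Z b c) (esym (etrans (congr1 -%R (Z c b)) (oppr0 _))).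
have E : (fun v => let p := point A m v in c (push (dcoord A m p) 0 b)) =
    (fun=> 0) :> ('rV[R]_n -> R^o).
  by apply/funext => v; cbv zeta; rewrite push0 Z.
rewrite E => k; exact: Ck_on_cst.
Qed.

End Bivector.

Theorem theorem2p1 (R : realType) (n : nat) (G : topGroupType)
    (A : atlas R n G) (K : 'Hom('rV[R]_n, covec R n)) (sigma : G -> G)
    (G_lie : is_lie_group A) (G_connected : connected [set: G])
    (K_sym : forall x y, K x y = K y x)
    (K_nondegenerate : forall x, (forall y, K x y = 0) -> x = 0)
    (K_invariant : forall g x y, K (Ad A g x) (Ad A g y) = K x y)
    (sigma_morphism : forall g h, sigma (g * h)%g = (sigma g * sigma h)%g)
    (sigma_smooth : smooth_map A A sigma)
    (sigma_involutive : forall g, sigma (sigma g) = g)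
    (sigma_orthogonal : forall x y,
       K (dsigma A sigma x) (dsigma A sigma y) = K x y) :
  exists P_S : quotS G -> bivec R n,
    (* (1) *)
    [/\ bivector_field (atlasS A) P_S /\
        (forall d : G * G,
           push (dmap (atlasD A) (atlasS A) (@projS G) d) (P_D A K sigma d)
           = P_S (projS d)),
    (* (2) *)
        (forall (s : quotS G) (xi : covec R n),
           push (dmap (atlasS A) A
                   (fun t => S_to_G t * (S_to_G s)^-1)%g s) (P_S s) xi
           = 2^-1 *: (Ad A (sigma (S_to_G s))^-1%g - Ad A (S_to_G s))
                       (dsigma A sigma ((K^-1)%VF xi))),
    (* (3) *)
        (exists P_plus : G -> bivec R n,
           [/\ bivector_field A P_plus,
               forall g, push (dmap A (atlasD A) (incl_sigma sigma) g)
                              (P_plus g)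
                         = P_D A K sigma (incl_sigma sigma g) &
               quasi_poisson_action A (atlasS A) (actS sigma)
                 P_plus (phi_sigma A K sigma) P_S]) &
    (* (4) *)
        forall s : quotS G,
          (limg (P_S s) <= limg (inf_action A (atlasS A) (actS sigma) s))%VS].
Proof.
exists (fun s => P_G A K sigma (S_to_G s)); split.
- split; last exact: push_projS.
  exact/bivector_field_atlasS/bivector_field_P_G.
- exact: P_S_formula.
- exists (fun=> 0); split; first exact: bivector_field0.
    by move=> g; exact: P_plus_restr.
  exact: quasi_poisson_S.
- exact: P_S_tangent.
Qed.
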